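(* Let $\lambda_1(L_{w,n,\epsilon})\le\dots\le\lambda_n(L_{w,n,\epsilon})$ be the eigenvalues of the weighted graph Laplacian $L_{w,n,\epsilon}$. Under the assumptions stated in the context, there exist constants $C,C',C_1,C_2,C_3,c>0$ and $N>0$, not depending on $n$, such that for $n\ge N$ and $C_1(\log n/n)^{1/d}\le\epsilon\le C_2$, with probability larger than $1-C_3ne^{-cn\epsilon^{d}}$, it holds that $$C'\min\{l^{2/d},\epsilon^{-2}\}\le\lambda_l(L_{w,n,\epsilon})\le C\min\{l^{2/d},\epsilon^{-2}\}\qquad\text{for all }2\le l\le n .$$
   Context: Fix $d\ge1$ and $w=(p,q,r)\in\mathbb R^3$. Let $X_1,\dots,X_n$ be i.i.d. from a distribution $G$ on $\mathcal X\subset\mathbb R^d$ with density $g$. **Assumptions.** (A1) $G$ is supported on $\mathcal X$, an open, connected, bounded subset of $\mathbb R^d$ with Lipschitz boundary. (A2) There are $g_{\min},g_{\max}$ with $0<g_{\min}\le g(x)\le g_{\max}<\infty$ for all $x\in\mathcal X$, and $g$ is Lipschitz on $\mathcal X$. (A3) The kernel $\eta$ is a non-negative, monotonically non-increasing function on $[0,\infty)$ supported on $[0,1]$, its restriction to $[0,1]$ is Lipschitz, $\eta(1/2)>0$, and $\int_{\mathbb R^d}\eta(\|x\|)\,dx=1$. (A4) Let $\mathscr K=\{y\mapsto\eta(\|x-y\|/\epsilon):\epsilon>0,\ x\in\mathbb R^d\}$. For a density $\rho$ let $N(\zeta,\mathscr K,\|\cdot\|_{L^2(\mathcal X,\rho)})$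 be the smallest number of $L^2(\mathcal X,\rho)$-balls of radius $\zeta$ needed to cover $\mathscr K$. There are constants $A,\nu>0$ with $\sup_\rho N(\zeta,\mathscr K,\|\cdot\|_{L^2(\mathcal X,\rho)})\le (A/\zeta)^{\nu}$ for all $\zeta\in(0,1)$, the supremum being over densities $\rho$. **Weighted graph Laplacian.** Let $\tilde w_{i,j}^{\epsilon}=\frac1{n\epsilon^d}\eta(\|X_i-X_j\|/\epsilon)$, $\tilde d_i=\sum_{j=1}^n\tilde w^\epsilon_{i,j}$, $w^\epsilon_{i,j}=\tilde w^\epsilon_{i,j}/(\tilde d_i^{\,1-q/2}\tilde d_j^{\,1-q/2})$, $W=(w^\epsilon_{i,j})$, $d_i=\sum_{j=1}^n w^\epsilon_{i,j}$, $D=\mathrm{diag}(d_1,\dots,d_n)$. Then $L_{w,n,\epsilon}=\epsilon^{-2}D^{\frac{1-p}{q-1}}(D-W)D^{-\frac r{q-1}}$ if $q\ne1$, and $L_{w,n,\epsilon}=\epsilon^{-2}(D-W)$ if $q=1$. It is self-adjoint with respect to the inner product $\langle u,v\rangle=u^TD^{\frac{p-1-r}{q-1}}v$ if $q\ne1$ (Euclidean if $q=1$), so its eigenvalues are real; they satisfy $0=\lambda_1\le\dots\le\lambda_n$. *)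

(* Defs.v *)
From HB Require Import structures.
From mathcomp Require Import all_boot all_order all_algebra.
From mathcomp Require Import all_classical all_reals all_analysis.

Set Implicit Arguments.
Unset Strict Implicit.
Unset Printing Implicit Defensive.

Import Order.TTheory GRing.Theory Num.Theory.
Import numFieldNormedType.Exports.

Local Open Scope classical_set_scope.
Local Open Scope ring_scope.

(** * R^d as ['rV[R]_d] *)

(* The library's norm on ['rV[R]_d] is the sup norm, which induces the same
   topology and the same bounded sets as this one. *)
Definition enorm (R : realType) (d : nat) (x : 'rV[R]_d) : R :=
  Num.sqrt (\sum_(i < d) x 0 i ^+ 2).

(* ['rV[R]_d] carries the sigma-algebra generated by the coordinates, as the
   library does for [d.-tuple R]; it is the Borel sigma-algebra of R^d. *)
Definition rV_display : measure_display. Proof. exact: default_measure_display. Qed.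

Section measurable_rV.
Context {R : realType} (d : nat).

Definition rV_coord (i : 'I_d) (x : 'rV[R]_d) : R := x 0 i.

Let rV_set0 : g_sigma_preimage rV_coord set0.
Proof. exact: sigma_algebra0. Qed.

Let rV_setC A : g_sigma_preimage rV_coord A -> g_sigma_preimage rV_coord (~` A).
Proof. exact: sigma_algebraC. Qed.

Let rV_bigcup (F : (set 'rV[R]_d)^nat) :
  (forall i, g_sigma_preimage rV_coord (F i)) ->
  g_sigma_preimage rV_coord (\bigcup_i (F i)).
Proof. exact: sigma_algebra_bigcup. Qed.

HB.instance Definition _ := @isMeasurable.Build rV_display
  'rV[R]_d (g_sigma_preimage rV_coord) rV_set0 rV_setC rV_bigcup.

End measurable_rV.

Definition rV_cons (R : realType) (d : nat) (z : 'rV[R]_d * R) : 'rV[R]_d.+1 :=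
  row_mx (const_mx z.2 : 'rV[R]_1) z.1.

Lemma rV_cons0 (R : realType) (d : nat) (z : 'rV[R]_d * R) :
  rV_cons z 0 ord0 = z.2.
Proof. by rewrite /rV_cons mxE; case: splitP => // j _; rewrite mxE. Qed.

Lemma rV_consS (R : realType) (d : nat) (z : 'rV[R]_d * R) (j : 'I_d) :
  rV_cons z 0 (lift ord0 j) = z.1 0 j.
Proof. by rewrite /rV_cons -(@rshift1 d j) (@row_mxEr _ _ 1). Qed.

Lemma measurable_rV_coord (R : realType) (d : nat) (i : 'I_d) :
  measurable_fun [set: 'rV[R]_d] (rV_coord i).
Proof.
move=> _ Y mY; rewrite setTI; apply: sub_sigma_algebra => /=.
rewrite -bigcup_seq/=; exists i => /=; first by rewrite mem_index_enum.
by exists Y => //; rewrite setTI.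
Qed.

Lemma measurable_fun_rV (R : realType) d0 (T : measurableType d0) (d : nat)
    (f : T -> 'rV[R]_d) :
  (forall i, measurable_fun [set: T] (fun t => f t 0 i)) ->
  measurable_fun [set: T] f.
Proof.
move=> mf _ A mA.
have : preimage_set_system [set: T] f (g_sigma_preimage (@rV_coord R d)) `<=`
    measurable.
  rewrite -g_sigma_preimage_comp; apply: smallest_sub.
    exact: sigma_algebra_measurable.
  rewrite -bigcup_seq /=; apply: bigcup_sub => i _ B [C mC <-].
  exact: mf.
by apply; exists A.
Qed.

Lemma measurable_rV_cons (R : realType) (d : nat) :
  measurable_fun [set: 'rV[R]_d * R] (@rV_cons R d).
Proof.
apply: measurable_fun_rV => i.
case: (unliftP ord0 i) => [j|] ->; last first.
  under eq_fun do rewrite rV_cons0.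
  exact: measurable_snd.
under eq_fun do rewrite rV_consS.
apply: (measurableT_comp (measurable_rV_coord j)); exact: measurable_fst.
Qed.

Section lebesgue_step.
Context {R : realType} (d : nat) (mu : {measure set 'rV[R]_d -> \bar R}).

Definition lebesgue_step : set 'rV[R]_d.+1 -> \bar R :=
  pushforward (mu \x (@lebesgue_measure R))%E (@rV_cons R d).

HB.instance Definition _ := Measure.copy lebesgue_step
  (measure_function_pushforward__canonical__measure_function_Measure
     (mu \x (@lebesgue_measure R))%E (@measurable_rV_cons R d)).

End lebesgue_step.

Fixpoint lebesgue_rV (R : realType) (d : nat) :
    {measure set 'rV[R]_d -> \bar R} :=
  if d is d'.+1 then lebesgue_step (lebesgue_rV R d') else dirac (0 : 'rV[R]_0).

Lemma measurable_box (R : realType) (d : nat) (a b : 'rV[R]_d) :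
  measurable [set x : 'rV[R]_d | forall i, a 0 i <= x 0 i <= b 0 i].
Proof.
rewrite (_ : [set _ | _] =
    \bigcap_(i in [set: 'I_d]) (rV_coord i @^-1` `[a 0 i, b 0 i])); last first.
  apply/seteqP; split => x /= hx i; first by move=> _; rewrite /rV_coord /= in_itv /=; exact: hx.
  by have := hx i I; rewrite /rV_coord /= in_itv.
apply: fin_bigcap_measurable => [|i _]; first exact: finite_finset.
rewrite -[X in measurable X]setTI; exact: measurable_rV_coord.
Qed.

Lemma lebesgue_rV_box (R : realType) (d : nat) (a b : 'rV[R]_d) :
  (forall i, a 0 i <= b 0 i) ->
  lebesgue_rV R d [set x | forall i, a 0 i <= x 0 i <= b 0 i] =
  (\prod_(i < d) (b 0 i - a 0 i))%:E.
Proof.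
elim: d a b => [|d IH] a b ab.
  rewrite big_ord0 /= diracE mem_set //= => -[] //.
pose a' : 'rV[R]_d := \row_j a 0 (lift ord0 j).
pose b' : 'rV[R]_d := \row_j b 0 (lift ord0 j).
have -> : lebesgue_rV R d.+1 [set x | forall i, a 0 i <= x 0 i <= b 0 i] =
    (lebesgue_rV R d \x (@lebesgue_measure R))%E
    ([set x : 'rV[R]_d | forall i, a' 0 i <= x 0 i <= b' 0 i] `*`
     `[a 0 ord0, b 0 ord0]%classic).
  rewrite /= /lebesgue_step /pushforward; congr product_measure1.
  apply/seteqP; split => -[x t] /= => [h|[h1 h2] i].
    split; last by have := h ord0; rewrite rV_cons0 in_itv.
    by move=> i; have := h (lift ord0 i); rewrite rV_consS !mxE.
  case: (unliftP ord0 i) => [j|] ->; last first.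
    by move: h2; rewrite rV_cons0 in_itv.
  by have := h1 j; rewrite rV_consS !mxE.
rewrite product_measure1E //; last exact: measurable_box.
rewrite IH; last by move=> i; rewrite !mxE.
rewrite /= lebesgue_measure_itv /= big_ord_recl.
have -> : (if ((a 0 ord0)%:E < (b 0 ord0)%:E)%E
    then (b 0 ord0)%:E - (a 0 ord0)%:E else 0)%E = (b 0 ord0 - a 0 ord0)%:E.
  rewrite lte_fin; case: ltP => // h.
  by have -> : b 0 ord0 = a 0 ord0 by [apply/eqP; rewrite eq_le h ab]; rewrite subrr.
rewrite -EFinM mulrC; congr (_ * _)%:E.
by apply: eq_bigr => i _; rewrite !mxE.
Qed.

(** * The domain, the density and the kernel *)

Definition lipschitz_in (R : realType) (d : nat) (A : set 'rV[R]_d)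
    (f : 'rV[R]_d -> R) : Prop :=
  exists L : R, forall x y, A x -> A y -> `|f x - f y| <= L * enorm (x - y).

(* Near each boundary point, in suitable orthonormal coordinates [y *m Q], the
   set is the strict epigraph of a Lipschitz function of the [d - 1] coordinates
   other than the [i]-th ([col' i] deletes the [i]-th one). *)
Definition lipschitz_boundary (R : realType) (d : nat) (A : set 'rV[R]_d) : Prop :=
  forall x0, (closure A `\` interior A) x0 ->
  exists (Q : 'M[R]_d) (i : 'I_d) (phi : 'rV[R]_d.-1 -> R) (rho : R),
    [/\ Q *m Q^T = 1%:M,
        lipschitz_in [set: 'rV[R]_d.-1] phi,
        0 < rho &
        forall y, enorm (y - x0) < rho ->
          (A y <-> phi (col' i (y *m Q)) < (y *m Q) 0 i)].

Definition assumption_domain (R : realType) (d : nat) (A : set 'rV[R]_d) : Prop :=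
  [/\ open A, connected A, bounded_set A & lipschitz_boundary A].

(* The density is only given on [A]; the distribution puts no mass elsewhere. *)
Definition has_density_on (R : realType) (d : nat) (G : probability 'rV[R]_d R)
    (A : set 'rV[R]_d) (g : 'rV[R]_d -> R) : Prop :=
  measurable_fun A g /\
  forall B, measurable B ->
    G B = (\int[lebesgue_rV R d]_(x in B `&` A) (g x)%:E)%E.

Definition assumption_density (R : realType) (d : nat) (A : set 'rV[R]_d)
    (g : 'rV[R]_d -> R) : Prop :=
  (exists gmin gmax : R,
     0 < gmin /\ forall x, A x -> gmin <= g x <= gmax) /\
  lipschitz_in A g.

(* The kernel is a function on [0, +oo[; nothing is asked of [eta] elsewhere. *)
Definition assumption_kernel (R : realType) (d : nat) (eta : R -> R) : Prop :=
  [/\ forall t : R, 0 <= t -> 0 <= eta t,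
      forall s t : R, 0 <= s -> s <= t -> eta t <= eta s,
      forall t, 1 < t -> eta t = 0,
      exists L : R, forall s t : R, 0 <= s <= 1 -> 0 <= t <= 1 ->
        `|eta s - eta t| <= L * `|s - t| &
      0 < eta (2^-1) /\
      (\int[lebesgue_rV R d]_x (eta (enorm x))%:E = 1%:E)%E].

Definition kernel_class (R : realType) (d : nat) (eta : R -> R) :
    set ('rV[R]_d -> R) :=
  [set k | exists (eps : R) (x : 'rV[R]_d),
     0 < eps /\ k = fun y => eta (enorm (x - y) / eps)].

Definition is_density_on (R : realType) (d : nat) (A : set 'rV[R]_d)
    (rho : 'rV[R]_d -> R) : Prop :=
  [/\ measurable_fun A rho,
      forall x, A x -> 0 <= rho x &
      (\int[lebesgue_rV R d]_(x in A) (rho x)%:E = 1%:E)%E].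

Definition L2norm (R : realType) (d : nat) (A : set 'rV[R]_d)
    (rho f : 'rV[R]_d -> R) : \bar R :=
  ((\int[lebesgue_rV R d]_(x in A) (f x ^+ 2 * rho x)%:E) `^ 2^-1)%E.

Definition in_L2 (R : realType) (d : nat) (A : set 'rV[R]_d)
    (rho f : 'rV[R]_d -> R) : Prop :=
  measurable_fun A f /\ (L2norm A rho f < +oo)%E.

Definition covered_by_balls (R : realType) (d : nat) (A : set 'rV[R]_d)
    (rho : 'rV[R]_d -> R) (K : set ('rV[R]_d -> R)) (zeta : R) (m : nat) : Prop :=
  exists c : 'I_m -> 'rV[R]_d -> R,
    (forall i, in_L2 A rho (c i)) /\
    forall k, K k -> exists i, (L2norm A rho (fun y => k y - c i y)%R < zeta%:E)%E.

(* Takes the value [+oo] when no finite number of balls suffices. *)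
Definition covering_number (R : realType) (d : nat) (A : set 'rV[R]_d)
    (rho : 'rV[R]_d -> R) (K : set ('rV[R]_d -> R)) (zeta : R) : \bar R :=
  ereal_inf [set m%:R%:E | m in [set m | covered_by_balls A rho K zeta m]].

Definition assumption_covering (R : realType) (d : nat) (A : set 'rV[R]_d)
    (eta : R -> R) : Prop :=
  exists a nu : R, [/\ 0 < a, 0 < nu &
    forall zeta : R, 0 < zeta < 1 ->
      (ereal_sup [set covering_number A rho (@kernel_class R d eta) zeta
                 | rho in @is_density_on R d A]
       <= ((a / zeta) `^ nu)%:E)%E].

(** * Samples *)

Definition iid_sample (R : realType) (d : nat) (G : probability 'rV[R]_d R)
    (disp : measure_display) (Omega : measurableType disp)
    (P : probability Omega R) (n : nat)
    (X : 'I_n -> {RV P >-> 'rV[R]_d}) : Prop :=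
  (forall i B, measurable B -> distribution P (X i) B = G B) /\
  (forall B : 'I_n -> set 'rV[R]_d, (forall i, measurable (B i)) ->
     P (\bigcap_(i in [set: 'I_n]) (X i @^-1` B i)) =
     (\prod_(i < n) P (X i @^-1` B i))%E).

(* The event is required to be measurable: a measure of the library is a total
   set function whose values on non-measurable sets mean nothing. *)
Definition prob_gt (R : realType) (disp : measure_display)
    (Omega : measurableType disp) (P : probability Omega R) (E : set Omega)
    (b : R) : Prop :=
  measurable E /\ (b%:E < P E)%E.

(** * The weighted graph Laplacian *)

Section graph_laplacian.
Context {R : realType} (d : nat) (eta : R -> R) (p q r : R).
Context (n : nat) (eps : R) (x : 'I_n -> 'rV[R]_d).

Definition pre_weight (i j : 'I_n) : R :=
  (n%:R * eps ^+ d)^-1 * eta (enorm (x i - x j) / eps).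

Definition pre_degree (i : 'I_n) : R := \sum_(j < n) pre_weight i j.

Definition weight (i j : 'I_n) : R :=
  pre_weight i j /
    (pre_degree i `^ (1 - q / 2) * pre_degree j `^ (1 - q / 2)).

Definition weight_mx : 'M[R]_n := \matrix_(i, j) weight i j.

Definition degree (i : 'I_n) : R := \sum_(j < n) weight i j.

Definition degree_mx : 'M[R]_n := diag_mx (\row_i degree i).

Definition degree_powR_mx (s : R) : 'M[R]_n := diag_mx (\row_i (degree i `^ s)).

Definition graph_laplacian : 'M[R]_n :=
  if q == 1 then eps ^- 2 *: (degree_mx - weight_mx)
  else eps ^- 2 *: (degree_powR_mx ((1 - p) / (q - 1))
                    *m (degree_mx - weight_mx)
                    *m degree_powR_mx (- (r / (q - 1)))).

End graph_laplacian.

(* The eigenvalues with multiplicity, in increasing order. They are specified as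
   the roots of the characteristic polynomial, so that they are unique and exist
   as soon as that polynomial splits over [R]; otherwise the list is empty. *)
Definition eigenvalues (R : realType) (n : nat) (M : 'M[R]_n) : seq R :=
  xget [::] [set s : seq R |
    sorted <=%R s /\ char_poly M = \prod_(a <- s) ('X - a%:P)].

(* Eigenvalues are numbered from 1. *)
Definition eigenvalue_nth (R : realType) (n : nat) (M : 'M[R]_n) (l : nat) : R :=
  (eigenvalues M)`_l.-1.

(* Main.v *)
(* R^d is cut into cubic cells of side [delta] proportional to [eps]. By
   exponential tail bounds and a union bound over the O(1 / delta^d) cells meeting
   [A], every cell inside [A] contains at least, and every cell at most, a constant
   times [n * delta^d] sample points, outside an event of probability at most
   K * n * exp(- c * n * eps^d). For such a sample the Laplacian is comparable
   with the Dirichlet energy of the graph, and its eigenvalues are estimated by the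
   min-max principle. Upper bound: about [l] tent functions with disjoint supports
   in a ball inside [A], or the trivial bound eps^-2. Lower bound: the Lipschitz
   boundary gives every sample point a cone in [A]; moving along it by a distance
   of order l^(-1/d) leads to cells grouped in fewer than [l] coarse cubes inside
   [A], and imposing mean zero on each of them gives the bound by the Poincare
   inequality on cubes. For small [l] the only constraint is mean zero on one ball,
   and the energy controls the whole domain by chaining overlapping balls. *)

Require Import Defs.
From mathcomp Require Import all_boot all_order all_algebra.
From mathcomp Require Import all_classical all_reals measurable_realfun all_analysis.
From mathcomp Require Import complex ring lra zify.

Set Implicit Arguments.
Unset Strict Implicit.
Unset Printing Implicit Defensive.

Import Order.TTheory GRing.Theory Num.Theory.
Import numFieldNormedType.Exports.

Local Open Scope classical_set_scope.
Local Open Scope ring_scope.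

(** * Spectra of weighted graph Laplacians *)

(** The Laplacian is not symmetric, but a diagonal conjugation makes it so. Since the degrees are
    bounded on both sides, the exponents built from [p], [q], [r] only change constants, and what
    remains is the Dirichlet form of the unnormalised weights. The scale [eps] is a fixed integer
    multiple of [delta], large enough that points of nearby cells are within [eps / 2], where the
    kernel is at least [eta (1/2)]. The obstacle is the boundary: a cell cut by it may be almost
    empty, so its average carries no information. Cones repair this at every scale: after [kap * b]
    steps, not only the cell reached but its whole coarse cube of side [b] lies in the domain. Each
    such cube holds a fixed share of the sample, so a suitable [b] leaves at most [l / 2] of them.
    The cone must have room of order [l^(-1/d)]; the boundedly many smaller [l] rely on a spectral
    gap independent of [n], because the minimum in the theorem is bounded for them. The logarithmic
    lower bound on [eps] serves to bound the number of cells by a multiple of [n]. *)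

Lemma char_poly_similar (F : comNzRingType) n (P A Q : 'M[F]_n) :
  P *m Q = 1%:M -> char_poly (P *m A *m Q) = char_poly A.
Proof.
move=> PQ1; rewrite /char_poly.
have -> : char_poly_mx (P *m A *m Q) =
    map_mx polyC P *m char_poly_mx A *m map_mx polyC Q.
  rewrite /char_poly_mx mulmxBr mulmxBl mul_mx_scalar -scalemxAl.
  by rewrite -!map_mxM PQ1 map_mx1 scalemx1.
rewrite !det_mulmx mulrC mulrA -det_mulmx -map_mxM.
by rewrite (mulmx1C PQ1) map_mx1 det1 mul1r.
Qed.

Lemma exists_kermx (F : fieldType) m k (M : 'M[F]_(m, k)) :
  (k < m)%N -> exists2 y : 'rV[F]_m, y != 0 & y *m M = 0.
Proof.
move=> km; have : kermx M != 0.
  rewrite -mxrank_eq0 mxrank_ker -lt0n subn_gt0.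
  exact: leq_ltn_trans (rank_leq_col _) km.
by move/rowV0Pn => [y /sub_kermxP yM y0]; exists y.
Qed.

Definition qform (R : realType) n (S : 'M[R]_n) (x : 'rV[R]_n) : R :=
  (x *m S *m x^T) 0 0.

Lemma qformE (R : realType) n (S : 'M[R]_n) (x : 'rV[R]_n) :
  qform S x = \sum_i \sum_j x 0 i * S i j * x 0 j.
Proof.
rewrite /qform mxE exchange_big; apply: eq_bigr => j _.
by rewrite !mxE mulr_suml; apply: eq_bigr.
Qed.

(** * Counting the eigenvalues of a real symmetric matrix below a level *)

Section spectral_real.
Variable R : realType.
Local Notation C := R[i].
Local Notation f := (real_complex R).

(** The complexification of [S] is hermitian, hence unitarily diagonalisable with a real diagonal.
    The eigenvectors in [P] remain complex, so the counting lemmas below test real and imaginary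
    parts separately. *)
Lemma symmetric_spectral n (S : 'M[R]_n) : S^T = S ->
  exists (P : 'M[C]_n) (r : 'rV[R]_n),
    [/\ P \is unitarymx,
        map_mx f S = invmx P *m diag_mx (map_mx f r) *m P &
        char_poly S = \prod_i ('X - (r 0 i)%:P)].
Proof.
move=> symS.
have hermS : map_mx f S \is hermsymmx.
  apply/is_hermitianmxP; rewrite expr0 scale1r; apply/matrixP => i j.
  by rewrite !mxE -[in LHS]symS mxE conj_Creal // complex_real.
have [P uP SE] : exists2 P, P \is unitarymx & map_mx f S =
    invmx P *m diag_mx (spectral_diag (map_mx f S)) *m P.
  exists (spectralmx (map_mx f S)); first exact: spectral_unitarymx.
  by apply/orthomx_spectralP/hermitian_normalmx.
have /mxOverP rS := hermitian_spectral_diag_real hermS.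
set D := spectral_diag _ in SE rS.
pose r := \row_i complex.Re (D 0 i).
have Dr : D = map_mx f r.
  apply/rowP => i; rewrite !mxE.
  by rewrite [LHS]/= (RRe_real (rS 0 i)).
rewrite Dr in SE; exists P, r; split; [exact: uP|exact: SE|].
apply: (@map_poly_inj _ _ f); rewrite map_char_poly SE.
rewrite char_poly_similar ?mulVmx ?unitarymx_unit//.
rewrite char_poly_trig ?diag_mx_is_trig// rmorph_prod; apply: eq_bigr => i _.
by rewrite !mxE eqxx mulr1n rmorphB /= map_polyX map_polyC.
Qed.

(** Mixed products of real and imaginary parts are purely imaginary; thus a bound on real vectors
    passes to complex ones. *)
Lemma qform_real_imag n (S : 'M[R]_n) (z : 'rV[C]_n) : S^T = S ->
  complex.Re ((z *m map_mx f S *m map_mx Num.conj z^T) 0 0) =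
  qform S (map_mx (@complex.Re R) z) + qform S (map_mx (@complex.Im R) z).
Proof.
move=> symS; rewrite !qformE -big_split /= mxE raddf_sum.
apply: eq_bigr => j _.
rewrite -big_split /= !mxE mulr_suml raddf_sum /=; apply: eq_bigr => i _.
have -> : S j i = S i j by rewrite -[in LHS]symS mxE.
rewrite !mxE.
by case: (z 0 i) (z 0 j) => [a b] [a' b']; rewrite /=; simpc => /=; ring.
Qed.

Lemma qform1 n (x : 'rV[R]_n) : qform 1%:M x = \sum_i x 0 i ^+ 2.
Proof.
by rewrite /qform mulmx1 mxE; apply: eq_bigr => i _; rewrite mxE.
Qed.

Definition sqnormc (a : C) : R := complex.Re a ^+ 2 + complex.Im a ^+ 2.

Lemma sqnormc_ge0 a : 0 <= sqnormc a.
Proof. by rewrite addr_ge0 ?sqr_ge0. Qed.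

Lemma sqnormc_gt0 a : a != 0 -> 0 < sqnormc a.
Proof.
rewrite lt_def sqnormc_ge0 andbT; case: a => a b.
by rewrite /sqnormc paddr_eq0 ?sqr_ge0// !sqrf_eq0 eq_complex.
Qed.

Lemma sum_sqnormc n (P : 'M[C]_n) (w : 'rV[C]_n) : P \is unitarymx ->
  let z := w *m P in
  \sum_i sqnormc (w 0 i) = \sum_i complex.Re (z 0 i) ^+ 2 + \sum_i complex.Im (z 0 i) ^+ 2.
Proof.
move=> uP z.
have := qform_real_imag z (trmx1 R n); rewrite !qform1.
under [X in _ = X + _]eq_bigr do rewrite mxE.
under [X in _ = _ + X]eq_bigr do rewrite mxE.
move=> <-; rewrite map_mx1 mulmx1 /z trmx_mul map_mxM -mulmxA.
rewrite [P *m _]mulmxA (unitarymxP uP) mul1mx mxE raddf_sum.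
by apply: eq_bigr => i _; rewrite !mxE; case: (w 0 i) => a b; rewrite /sqnormc /=; ring.
Qed.

Lemma sum_sqnormc_eig n (P : 'M[C]_n) (w : 'rV[C]_n) (S : 'M[R]_n) (r : 'rV[R]_n) :
  S^T = S -> P \is unitarymx ->
  map_mx f S = invmx P *m diag_mx (map_mx f r) *m P ->
  let z := w *m P in
  \sum_i r 0 i * sqnormc (w 0 i) =
  qform S (map_mx (@complex.Re R) z) + qform S (map_mx (@complex.Im R) z).
Proof.
move=> symS uP SE z; rewrite -qform_real_imag// SE invmx_unitary// /z trmx_mul map_mxM.
rewrite !mulmxA -[w *m P *m _]mulmxA (unitarymxP uP) mulmx1.
rewrite -[_ *m P *m _]mulmxA (unitarymxP uP) mulmx1 mxE raddf_sum.
apply: eq_bigr => i _; rewrite mul_mx_diag !mxE; case: (w 0 i) => a b; rewrite /sqnormc /=; ring.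
Qed.

(** Were there fewer than [l] eigenvalues at most [c], some nonzero vector of the complexified row
    space of [B] would be orthogonal to all their eigenvectors. The form at this vector exceeds [c]
    times its squared norm, against the hypothesis on its real and imaginary parts. *)
Lemma count_eig_le n (S : 'M[R]_n) P (r : 'rV[R]_n) c l (B : 'M[R]_(l, n)) :
  S^T = S -> P \is unitarymx ->
  map_mx f S = invmx P *m diag_mx (map_mx f r) *m P ->
  row_free B ->
  (forall y : 'rV[R]_l, qform S (y *m B) <= c * \sum_i (y *m B) 0 i ^+ 2) ->
  (l <= #|[pred i | (r 0 i <= c)%R]|)%N.
Proof.
move=> symS uP SE freeB hB; rewrite leqNgt; apply/negP.
set J := [pred i | _] => ltJ.
pose N := map_mx f B *m invmx P.
have [y y0 yN] := exists_kermx (colsub (@enum_val _ (mem J)) N) ltJ.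
pose w := y *m N.
have wJ i : i \in J -> w 0 i = 0.
  move=> iJ.
  have H : (y *m colsub (@enum_val _ (mem J)) N) 0 (enum_rank_in iJ i) = 0.
    by rewrite yN mxE.
  by rewrite -H !mxE; apply: eq_bigr => k _; rewrite [in RHS]mxE enum_rankK_in.
have w0 : w != 0.
  apply: contra y0 => /eqP yN0.
  have /row_freeP[B' BB'] := freeB.
  have := congr1 (fun M => M *m P *m map_mx f B') yN0.
  rewrite /w /N !mul0mx !mulmxA mulmxKV ?unitarymx_unit// -mulmxA -map_mxM BB' map_mx1 mulmx1.
  by move->.
have zE : w *m P = y *m map_mx f B by rewrite /w /N mulmxA mulmxKV ?unitarymx_unit.
have ReE : map_mx (@complex.Re R) (y *m map_mx f B) = map_mx (@complex.Re R) y *m B.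
  apply/rowP => i; rewrite !mxE raddf_sum; apply: eq_bigr => k _.
  by rewrite !mxE; case: (y 0 k) => a b /=; ring.
have ImE : map_mx (@complex.Im R) (y *m map_mx f B) = map_mx (@complex.Im R) y *m B.
  apply/rowP => i; rewrite !mxE raddf_sum; apply: eq_bigr => k _.
  by rewrite !mxE; case: (y 0 k) => a b /=; ring.
have := lerD (hB (map_mx (@complex.Re R) y)) (hB (map_mx (@complex.Im R) y)).
rewrite -ReE -ImE -zE -(sum_sqnormc_eig w symS uP SE) -mulrDr.
under [X in _ * (X + _)]eq_bigr do rewrite mxE.
under [X in _ * (_ + X)]eq_bigr do rewrite mxE.
rewrite -sum_sqnormc// mulr_sumr; apply/negP; rewrite -ltNge.
have [i wi] := rV0Pn _ w0.
have lt_c j : j \notin J -> c < r 0 j by rewrite inE -ltNge.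
have le_term j : c * sqnormc (w 0 j) <= r 0 j * sqnormc (w 0 j).
  case: (boolP (j \in J)) => [/wJ ->|/lt_c/ltW cr].
    by rewrite /sqnormc !expr0n addr0 !mulr0.
  by rewrite ler_wpM2r ?sqnormc_ge0.
rewrite (bigD1 i)//= [ltRHS](bigD1 i)//=; apply: ltr_leD; last exact: ler_sum.
by rewrite ltr_pM2r ?sqnormc_gt0// lt_c//; apply/negP => /wJ wi0; rewrite wi0 eqxx in wi.
Qed.

(** The dual count: more than [k] eigenvectors with eigenvalue below [c] span a space too large for
    the [k] constraints of [K] to exclude, and a nonzero vector of it that satisfies them violates
    the hypothesis. *)
Lemma count_eig_ge n (S : 'M[R]_n) P (r : 'rV[R]_n) c k (K : 'M[R]_(n, k)) :
  S^T = S -> P \is unitarymx ->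
  map_mx f S = invmx P *m diag_mx (map_mx f r) *m P ->
  (forall x : 'rV[R]_n, x *m K = 0 -> c * \sum_i x 0 i ^+ 2 <= qform S x) ->
  (#|[pred i | (r 0 i < c)%R]| <= k)%N.
Proof.
move=> symS uP SE hK; rewrite leqNgt; apply/negP.
set J := [pred i | _] => ltJ.
have [y y0 yN] := exists_kermx (rowsub (@enum_val _ (mem J)) P *m map_mx f K) ltJ.
pose w : 'rV[C]_n := y *m rowsub (@enum_val _ (mem J)) 1%:M.
have wE i : w 0 i = \sum_k y 0 k * (enum_val k == i)%:R.
  by rewrite mxE; apply: eq_bigr => j _; rewrite !mxE.
have wJ i : i \notin J -> w 0 i = 0.
  move=> iJ; rewrite wE big1// => j _; case: eqP => [ji|]; last by rewrite mulr0.
  by rewrite -ji enum_valP in iJ.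
have [j yj] := rV0Pn _ y0.
have wyj : w 0 (enum_val j) = y 0 j.
  rewrite wE (bigD1 j)//= eqxx mulr1 big1 ?addr0// => j' jj'.
  by rewrite (inj_eq enum_val_inj) (negbTE jj') mulr0.
have zE : w *m P = y *m rowsub (@enum_val _ (mem J)) P.
  by rewrite /w -mulmxA -rowsubE.
have zK : w *m P *m map_mx f K = 0 by rewrite zE -mulmxA yN.
have ReK : map_mx (@complex.Re R) (w *m P) *m K = 0.
  apply/rowP => i; rewrite [RHS]mxE mxE; have /rowP/(_ i) := zK.
  rewrite [RHS]mxE mxE => /(congr1 (@complex.Re R)); rewrite raddf_sum => /= H.
  apply: etrans H; apply: eq_bigr => a _; rewrite mxE [map_mx f K a i]mxE.
  by case: ((w *m P) 0 a) => u v /=; ring.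
have ImK : map_mx (@complex.Im R) (w *m P) *m K = 0.
  apply/rowP => i; rewrite [RHS]mxE mxE; have /rowP/(_ i) := zK.
  rewrite [RHS]mxE mxE => /(congr1 (@complex.Im R)); rewrite raddf_sum => /= H.
  apply: etrans H; apply: eq_bigr => a _; rewrite mxE [map_mx f K a i]mxE.
  by case: ((w *m P) 0 a) => u v /=; ring.
have := lerD (hK _ ReK) (hK _ ImK); rewrite -(sum_sqnormc_eig w symS uP SE) -mulrDr.
under [X in _ * (X + _)]eq_bigr do rewrite mxE.
under [X in _ * (_ + X)]eq_bigr do rewrite mxE.
rewrite -sum_sqnormc// mulr_sumr; apply/negP; rewrite -ltNge.
have lt_c i : i \in J -> r 0 i < c by rewrite inE.
have le_term i : r 0 i * sqnormc (w 0 i) <= c * sqnormc (w 0 i).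
  case: (boolP (i \in J)) => [/lt_c/ltW cr|/wJ ->].
    by rewrite ler_wpM2r ?sqnormc_ge0.
  by rewrite /sqnormc !expr0n addr0 !mulr0.
rewrite (bigD1 (enum_val j))//= [ltRHS](bigD1 (enum_val j))//=.
apply: ltr_leD; last exact: ler_sum.
by rewrite ltr_pM2r ?lt_c ?enum_valP// wyj sqnormc_gt0.
Qed.

End spectral_real.

(** The product determines the roots up to order and sortedness fixes the order, so the choice made
    by [xget] is forced; [s] itself rules out the default value. *)
Lemma eigenvaluesP (R : realType) n (M : 'M[R]_n) (s : seq R) :
  sorted <=%R s -> char_poly M = \prod_(a <- s) ('X - a%:P) -> eigenvalues M = s.
Proof.
move=> ss Ms; rewrite /eigenvalues; case: xgetP => [t _ [st Mt]|/(_ s)]; last by case.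
apply: (sorted_eq le_trans le_anti) => //; apply: prod_XsubC_eq.
by rewrite -Mt -Ms.
Qed.

Section courant_fischer.
Variables (R : realType) (n : nat) (M S : 'M[R]_n).
Hypothesis symS : S^T = S.
Hypothesis MS : char_poly M = char_poly S.

(** [M] only has to share its characteristic polynomial with the symmetric [S]: the graph Laplacian
    is similar to a symmetric matrix without being one, and [eigenvalues] sees nothing but that
    polynomial. *)
Let spectrum : exists (P : 'M[R[i]]_n) (r : 'rV[R]_n),
  [/\ P \is unitarymx,
      map_mx (real_complex R) S = invmx P *m diag_mx (map_mx (real_complex R) r) *m P,
      perm_eq (eigenvalues M) [seq r 0 i | i <- enum 'I_n],
      sorted <=%R (eigenvalues M) &
      char_poly M = \prod_(a <- eigenvalues M) ('X - a%:P)].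
Proof.
have [P [r [uP SE chS]]] := symmetric_spectral symS.
have E : eigenvalues M = sort <=%R [seq r 0 i | i <- enum 'I_n].
  apply: eigenvaluesP; first exact: sort_le_sorted.
  rewrite MS chS (perm_big _ (permEl (perm_sort _ _))) big_map big_enum //.
exists P, r; rewrite E; split => //.
- by rewrite perm_sort.
- exact: sort_le_sorted.
- by rewrite MS chS (perm_big _ (permEl (perm_sort _ _))) big_map big_enum.
Qed.

Lemma eigenvalues_sorted : sorted <=%R (eigenvalues M).
Proof. by have [P [r []]] := spectrum. Qed.

Lemma char_poly_eigenvalues : char_poly M = \prod_(a <- eigenvalues M) ('X - a%:P).
Proof. by have [P [r []]] := spectrum. Qed.

Lemma size_eigenvalues : size (eigenvalues M) = n.
Proof.
by have [P [r [_ _ /perm_size -> _ _]]] := spectrum; rewrite size_map size_enum_ord.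
Qed.

Let count_set (r : 'rV[R]_n) (p : pred R) :
  count p [seq r 0 i | i <- enum 'I_n] = #|[pred i | p (r 0 i)]|.
Proof.
by rewrite count_map cardE -size_filter enumT.
Qed.

Lemma eigenvalue_nth_le l c (B : 'M[R]_(l, n)) : (0 < l)%N -> row_free B ->
  (forall y : 'rV[R]_l, qform S (y *m B) <= c * \sum_i (y *m B) 0 i ^+ 2) ->
  eigenvalue_nth M l <= c.
Proof.
move=> l0 fB hB; have [P [r [uP SE pr so _]]] := spectrum.
apply: nth_count_le => //; rewrite prednK// (permP pr) count_set.
exact: count_eig_le uP SE fB hB.
Qed.

Lemma eigenvalue_nth_ge l c k (K : 'M[R]_(n, k)) : (k < l <= n)%N ->
  (forall x : 'rV[R]_n, x *m K = 0 -> c * \sum_i x 0 i ^+ 2 <= qform S x) ->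
  c <= eigenvalue_nth M l.
Proof.
move=> /andP[kl ln] hK; have [P [r [uP SE pr so _]]] := spectrum.
have l0 : (0 < l)%N by exact: leq_ltn_trans kl.
apply: nth_count_ge => //; rewrite size_eigenvalues prednK// ln andbT.
rewrite (permP pr) count_set; have := count_eig_ge symS uP SE hK.
by move=> /leq_trans; apply; rewrite -ltnS prednK.
Qed.

End courant_fischer.

(** * Dirichlet forms and diagonally scaled Laplacians *)

Lemma powR_bounds (R : realType) (al be s : R) : 0 < al ->
  exists m M : R, [/\ 0 < m, 0 < M & forall x, al <= x <= be -> m <= x `^ s <= M].
Proof.
move=> al0.
have [ba|ab] := ltP be al.
  by exists 1, 1; split => // x /andP[h1 h2]; have := le_lt_trans (le_trans h1 h2) ba; rewrite ltxx.
have be0 := lt_le_trans al0 ab.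
have [s0|s0] := leP 0 s.
  exists (al `^ s), (be `^ s); split; rewrite ?powR_gt0// => x /andP[h1 h2].
  by rewrite !ge0_ler_powR ?nnegrE//; lra.
exists (be `^ s), (al `^ s); split; rewrite ?powR_gt0// => x /andP[h1 h2].
have x0 := lt_le_trans al0 h1.
rewrite -[s]opprK !(powRN _ (- s)) !lef_pV2 ?posrE ?powR_gt0//.
by rewrite !ge0_ler_powR ?nnegrE//; lra.
Qed.

(** Every unordered pair is counted twice, whence the factor [2^-1] in [qform_scaled_laplacian]. *)
Definition dirichlet (R : realType) n (W : 'I_n -> 'I_n -> R) (u : 'I_n -> R) : R :=
  \sum_i \sum_j W i j * (u i - u j) ^+ 2.

Lemma dirichlet_le (R : realType) n (W W' : 'I_n -> 'I_n -> R) (a : R) u :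
  (forall i j, W i j <= a * W' i j) -> dirichlet W u <= a * dirichlet W' u.
Proof.
move=> h; rewrite /dirichlet mulr_sumr; apply: ler_sum => i _.
rewrite mulr_sumr; apply: ler_sum => j _.
by rewrite mulrA ler_wpM2r ?sqr_ge0.
Qed.

Definition laplacian (R : realType) n (W : 'I_n -> 'I_n -> R) : 'M[R]_n :=
  diag_mx (\row_i \sum_j W i j) - \matrix_(i, j) W i j.

(** Common shape of both cases of [graph_laplacian]; for [q = 1] the factors [a] and [b] are
    constantly 1. *)
Definition scaled_laplacian (R : realType) n (W : 'I_n -> 'I_n -> R) (e : R)
    (a b : 'I_n -> R) : 'M[R]_n :=
  e *: (diag_mx (\row_i a i) *m laplacian W *m diag_mx (\row_i b i)).

Section scaled_laplacian.
Variables (R : realType) (n : nat) (W : 'I_n -> 'I_n -> R) (e : R).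
Hypothesis WC : forall i j, W i j = W j i.
Implicit Types a b T : 'I_n -> R.

Lemma scaled_laplacianE a b i j : scaled_laplacian W e a b i j =
  e * (a i * ((\sum_k W i k) *+ (i == j) - W i j) * b j).
Proof. by rewrite mxE mul_mx_diag mxE mul_diag_mx !mxE. Qed.

Lemma scaled_laplacian_sym T :
  (scaled_laplacian W e T T)^T = scaled_laplacian W e T T.
Proof.
apply/matrixP => i j; rewrite mxE !scaled_laplacianE (WC i j) (eq_sym j i).
by case: (eqVneq i j) => [->|_]; rewrite ?mulr1n ?mulr0n //; ring.
Qed.

Lemma qform_scaled_laplacian T (v : 'rV[R]_n) :
  qform (scaled_laplacian W e T T) v =
  e * (2^-1 * dirichlet W (fun i => T i * v 0 i)).
Proof.
pose u i := T i * v 0 i; pose deg i := \sum_j W i j.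
have -> : qform (scaled_laplacian W e T T) v =
    e * (\sum_i (deg i * u i ^+ 2 - \sum_j W i j * u i * u j)).
  rewrite qformE mulr_sumr; apply: eq_bigr => i _.
  rewrite mulrBr.
  under eq_bigr => j _.
    rewrite scaled_laplacianE -/(deg i).
    have -> : v 0 i * (e * (T i * (deg i *+ (i == j) - W i j) * T j)) * v 0 j =
      (if j == i then e * (deg i * u i ^+ 2) else 0) - e * (W i j * u i * u j).
      by rewrite /u eq_sym; case: (eqVneq j i) => [->|_]; rewrite ?mulr1n ?mulr0n; ring.
    over.
  rewrite big_split /= -big_mkcond big_pred1_eq; congr (_ + _).
  by rewrite sumrN -mulr_sumr.
congr (_ * _); rewrite sumrB /dirichlet.
have -> : \sum_i \sum_j W i j * (T i * v 0 i - T j * v 0 j) ^+ 2 =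
   \sum_i \sum_j W i j * u i ^+ 2 + \sum_i \sum_j W i j * u j ^+ 2
   - 2 * \sum_i \sum_j W i j * u i * u j.
  rewrite mulr_sumr -!big_split /= -sumrB; apply: eq_bigr => i _.
  rewrite mulr_sumr -!big_split /= -sumrB; apply: eq_bigr => j _; rewrite /u; ring.
have -> : \sum_i \sum_j W i j * u j ^+ 2 = \sum_i \sum_j W i j * u i ^+ 2.
  rewrite exchange_big; apply: eq_bigr => i _; apply: eq_bigr => j _.
  by rewrite WC.
have -> : \sum_i \sum_j W i j * u i ^+ 2 = \sum_i deg i * u i ^+ 2.
  by apply: eq_bigr => i _; rewrite mulr_suml.
by field.
Qed.

(** Conjugating by the diagonal matrix of the [T i / a i] turns the factor [a i] on the left into
    [T i] and [b j] on the right into [a j * b j / T j = T j]. *)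
Lemma char_poly_scaled_laplacian (a b : 'I_n -> R) :
  (forall i, 0 < a i) -> (forall i, 0 < b i) ->
  let T i := Num.sqrt (a i * b i) in
  char_poly (scaled_laplacian W e a b) = char_poly (scaled_laplacian W e T T).
Proof.
move=> a0 b0 T.
have T2 i : T i * T i = a i * b i by rewrite -expr2 sqr_sqrtr// mulr_ge0 ?ltW.
have Ti0 i : T i != 0 by rewrite gt_eqF// sqrtr_gt0 mulr_gt0.
have ai0 i : a i != 0 by rewrite gt_eqF.
pose P := diag_mx (\row_i (T i / a i)); pose Q := diag_mx (\row_i (a i / T i)).
have PQ : P *m Q = 1%:M.
  apply/matrixP => i j; rewrite mul_diag_mx !mxE.
  case: (eqVneq i j) => [->|_]; rewrite ?mulr1n ?mulr0n ?mulr0//.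
  by field; rewrite Ti0 ai0.
rewrite -(char_poly_similar (scaled_laplacian W e a b) PQ); congr char_poly.
apply/matrixP => i j.
rewrite mul_mx_diag mxE mul_diag_mx mxE !scaled_laplacianE ![(\row_ _ _) _ _]mxE.
move: (_ - _) => D.
suff -> : b j = T j * T j / a j by field; rewrite ?Ti0 ?ai0.
by rewrite T2 mulrAC divff ?mul1r.
Qed.

End scaled_laplacian.

Lemma ge0_dirichlet (R : realType) n (W : 'I_n -> 'I_n -> R) u :
  (forall i j, 0 <= W i j) -> 0 <= dirichlet W u.
Proof.
move=> W0; apply: sumr_ge0 => i _; apply: sumr_ge0 => j _.
by rewrite mulr_ge0 ?sqr_ge0.
Qed.

Section comparison.
Variables (R : realType) (n : nat) (W0 : 'I_n -> 'I_n -> R) (e h1 h2 m M : R).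
Variables (h a b : 'I_n -> R).
Hypothesis W0C : forall i j, W0 i j = W0 j i.
Hypothesis W0_ge0 : forall i j, 0 <= W0 i j.
Hypothesis e0 : 0 < e.
Hypothesis h10 : 0 < h1.
Hypothesis h_ge : forall i, h1 <= h i.
Hypothesis h_le : forall i, h i <= h2.
Hypothesis m0 : 0 < m.
Hypothesis a_ge : forall i, m <= a i.
Hypothesis a_le : forall i, a i <= M.
Hypothesis b_ge : forall i, m <= b i.
Hypothesis b_le : forall i, b i <= M.

Let W i j := W0 i j / (h i * h j).
Let L := scaled_laplacian W e a b.
Let T i := Num.sqrt (a i * b i).

Let h_gt0 i : 0 < h i.
Proof. exact: lt_le_trans (h_ge i). Qed.
Let a_gt0 i : 0 < a i.
Proof. exact: lt_le_trans (a_ge i). Qed.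
Let b_gt0 i : 0 < b i.
Proof. exact: lt_le_trans (b_ge i). Qed.

Let T2 i : T i ^+ 2 = a i * b i.
Proof. by rewrite sqr_sqrtr// mulr_ge0 ?ltW. Qed.

Let T_gt0 i : 0 < T i.
Proof. by rewrite sqrtr_gt0 mulr_gt0. Qed.

Let T2_ge i : m ^+ 2 <= T i ^+ 2.
Proof. by rewrite T2 expr2; apply: ler_pM => //; exact: ltW. Qed.

Let T2_le i : T i ^+ 2 <= M ^+ 2.
Proof. by rewrite T2 expr2; apply: ler_pM => //; exact: ltW. 
Qed.

Let WC i j : W i j = W j i.
Proof. by rewrite /W W0C [h i * _]mulrC. Qed.

Let W_low i j : W0 i j <= h2 ^+ 2 * W i j.
Proof.
rewrite /W mulrCA ler_peMr// ler_pdivlMr ?mulr_gt0// mul1r.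
by rewrite expr2; apply: ler_pM => //; exact: ltW.
Qed.

Let W_high i j : W i j <= h1 ^- 2 * W0 i j.
Proof.
rewrite /W [leRHS]mulrC ler_wpM2l// lef_pV2 ?posrE ?exprn_gt0 ?mulr_gt0//.
by rewrite expr2; apply: ler_pM => //; exact: ltW.
Qed.

Lemma normalized_degree_bound i al be : al <= \sum_j W0 i j <= be ->
  h2 ^- 2 * al <= \sum_j W i j <= h1 ^- 2 * be.
Proof.
move=> /andP[d1 d2].
have h20 : 0 < h2 by apply: lt_le_trans (h_le i); exact: lt_le_trans (h_ge i).
apply/andP; split.
  rewrite ler_pdivrMl ?exprn_gt0// (le_trans d1)// mulr_sumr.
  by apply: ler_sum => j _; exact: W_low.
apply: (@le_trans _ _ (h1 ^- 2 * \sum_j W0 i j)).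
  by rewrite mulr_sumr; apply: ler_sum => j _; exact: W_high.
by rewrite ler_pM2l// invr_gt0 exprn_gt0.
Qed.

(** In the variable [u = T v] the symmetrised form is half the Dirichlet form of [W]. The
    constraints on [u] become constraints on [v], the norms compare through [m ^+ 2 <= T i ^+ 2],
    and the weights through [h2 ^+ 2]. The upper bound below makes the same change of variable on
    the test space. *)
Lemma scaled_laplacian_eig_ge l k (K : 'M[R]_(n, k)) t : 0 < h2 -> 
  (k < l <= n)%N -> 0 <= t ->
  (forall u : 'rV[R]_n, u *m K = 0 ->
     t * \sum_i u 0 i ^+ 2 <= dirichlet W0 (fun i => u 0 i)) ->
  m ^+ 2 / (2 * h2 ^+ 2) * e * t <= eigenvalue_nth L l.
Proof.
move=> h20 kl t0 hK.
have chS : char_poly L = char_poly (scaled_laplacian W e T T).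
  exact: char_poly_scaled_laplacian.
apply: (eigenvalue_nth_ge (scaled_laplacian_sym e WC T) chS (K := diag_mx (\row_i T i) *m K) kl) => v {chS}.
rewrite mulmxA => /hK; set u := v *m _ => hu.
have uE i : u 0 i = T i * v 0 i by rewrite /u mul_mx_diag !mxE mulrC.
move: u uE hu => u uE hu.
rewrite qform_scaled_laplacian; last exact: WC.
have -> : (fun i => T i * v 0 i) = (fun i => u 0 i) by apply/funext => i; rewrite uE.
set E := dirichlet W0 _ in hu.
have H1 : t * (m ^+ 2 * \sum_i v 0 i ^+ 2) <= E.
  apply: le_trans hu; rewrite ler_wpM2l// mulr_sumr; apply: ler_sum => i _.
  by rewrite uE exprMn ler_wpM2r ?sqr_ge0.
have := le_trans H1 (dirichlet_le (fun i => u 0 i) W_low).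
rewrite -(ler_pM2l e0) => H.
have -> : m ^+ 2 / (2 * h2 ^+ 2) * e * t * \sum_i v 0 i ^+ 2 =
    (2 * h2 ^+ 2)^-1 * (e * (t * (m ^+ 2 * \sum_i v 0 i ^+ 2))) by ring.
rewrite ler_pdivrMl ?mulr_gt0 ?exprn_gt0//.
apply: (le_trans H); rewrite le_eqVlt; apply/orP; left; apply/eqP.
by field.
Qed.

Lemma scaled_laplacian_eig_le l (B : 'M[R]_(l, n)) t : (0 < l)%N ->
  row_free B -> 0 <= t ->
  (forall y : 'rV[R]_l, dirichlet W0 (fun i => (y *m B) 0 i) <=
     t * \sum_i (y *m B) 0 i ^+ 2) ->
  eigenvalue_nth L l <= M ^+ 2 / (2 * h1 ^+ 2) * e * t.
Proof.
move=> l0 fB t0 hB.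
have fT : row_free (diag_mx (\row_i (T i)^-1)).
  apply/row_freeP; exists (diag_mx (\row_i T i)).
  apply/matrixP => i j; rewrite mul_diag_mx !mxE.
  case: (eqVneq i j) => [->|_]; rewrite ?mulr1n ?mulr0n ?mulr0//.
  by rewrite mulVf// gt_eqF.
have fBT : row_free (B *m diag_mx (\row_i (T i)^-1)).
  by rewrite /row_free mxrankMfree.
have chS : char_poly L = char_poly (scaled_laplacian W e T T).
  exact: char_poly_scaled_laplacian.
apply: (eigenvalue_nth_le (scaled_laplacian_sym e WC T) chS l0 fBT) => y {chS}; rewrite mulmxA; have := hB y; set u := y *m B => hu; set v := u *m _.
have uE i : u 0 i = T i * v 0 i.
  by rewrite /v mul_mx_diag mxE [X in _ * (_ * X)]mxE mulrCA mulfV ?mulr1 ?(gt_eqF (T_gt0 i)).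
move: u v uE hu => u v uE hu.
rewrite qform_scaled_laplacian; last exact: WC.
have -> : (fun i => T i * v 0 i) = (fun i => u 0 i) by apply/funext => i; rewrite uE.
set E := dirichlet W0 _ in hu.
have H1 : E <= t * (M ^+ 2 * \sum_i v 0 i ^+ 2).
  apply: (le_trans hu); rewrite ler_wpM2l// mulr_sumr; apply: ler_sum => i _.
  by rewrite uE exprMn ler_wpM2r ?sqr_ge0.
have h1V : 0 < h1 ^- 2 by rewrite invr_gt0 exprn_gt0.
have H2 := dirichlet_le (fun i => u 0 i) W_high.
rewrite -/E in H2.
have H3 := le_trans H2 (ler_wpM2l (ltW h1V) H1).
have -> : M ^+ 2 / (2 * h1 ^+ 2) * e * t * \sum_i v 0 i ^+ 2 =
    e * (2^-1 * (h1 ^- 2 * (t * (M ^+ 2 * \sum_i v 0 i ^+ 2)))).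
  by field; rewrite gt_eqF.
by rewrite ler_pM2l// ler_pM2l// invr_gt0.
Qed.

End comparison.

(** * Sums and energies over lattice cells *)

Section finite_sums.
Variable R : realType.

Lemma sumr_const_seq (I : Type) (s : seq I) (c : R) :
  \sum_(i <- s) c = (size s)%:R * c.
Proof. by rewrite big_const_seq count_predT iter_addr addr0 mulr_natl. Qed.

Lemma sum_sqrB (I J : Type) (s : seq I) (t : seq J) (a : I -> R) (b : J -> R) :
  \sum_(i <- s) \sum_(j <- t) (a i - b j) ^+ 2 =
  (size t)%:R * \sum_(i <- s) a i ^+ 2 + (size s)%:R * \sum_(j <- t) b j ^+ 2
  - 2 * (\sum_(i <- s) a i) * (\sum_(j <- t) b j).
Proof.
elim: s => [|i s IH]; first by rewrite !big_nil /=; ring.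
rewrite !big_cons IH /= -[in RHS]natr1.
have -> : \sum_(j <- t) (a i - b j) ^+ 2 =
   (size t)%:R * a i ^+ 2 + \sum_(j <- t) b j ^+ 2 - 2 * a i * \sum_(j <- t) b j.
  elim: t {IH} => [|j t IH]; first by rewrite !big_nil /=; ring.
  by rewrite !big_cons IH /= -natr1; ring.
ring.
Qed.

Lemma sqr_sum_le (I : Type) (s : seq I) (a : I -> R) :
  (\sum_(i <- s) a i) ^+ 2 <= (size s)%:R * \sum_(i <- s) a i ^+ 2.
Proof.
have : 0 <= \sum_(i <- s) \sum_(j <- s) (a i - a j) ^+ 2.
  by apply: sumr_ge0 => i _; apply: sumr_ge0 => j _; exact: sqr_ge0.
rewrite sum_sqrB; nra.
Qed.

Lemma sum_le_fiber (I J : eqType) (s : seq I) (t : seq J) (f : I -> J)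
    (F : J -> R) (K : R) :
  (forall j, 0 <= F j) -> (forall i, i \in s -> f i \in t) ->
  (forall j, j \in t -> (count (fun i => f i == j) s)%:R <= K) ->
  \sum_(i <- s) F (f i) <= K * \sum_(j <- t) F j.
Proof.
move=> F0 fst hK.
have -> : \sum_(i <- s) F (f i) = \sum_(i <- s | i \in s) F (f i) by rewrite big_seq.
apply: (@le_trans _ _ (\sum_(i <- s | i \in s) \sum_(j <- t | f i == j) F j)).
  apply: ler_sum => i /fst fi; rewrite (big_rem (f i))//= eqxx lerDl.
  by apply: sumr_ge0.
rewrite -big_seq (exchange_big_dep predT)//= mulr_sumr big_seq [leRHS]big_seq.
apply: ler_sum => j jt; rewrite big_const_seq iter_addr addr0 -mulr_natl.
by rewrite ler_wpM2r ?hK.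
Qed.

Lemma sum_le_inj (I J : eqType) (s : seq I) (t : seq J) (f : I -> J) (F : J -> R) :
  (forall j, 0 <= F j) -> (forall i, i \in s -> f i \in t) ->
  uniq s -> {in s &, injective f} ->
  \sum_(i <- s) F (f i) <= \sum_(j <- t) F j.
Proof.
move=> F0 fst us inj; rewrite -[leRHS]mul1r; apply: sum_le_fiber => // j _.
rewrite lern1 -(count_map f (pred1 j)) count_uniq_mem ?leq_b1//.
by rewrite map_inj_in_uniq.
Qed.

Lemma sum_le_subset (I : eqType) (s t : seq I) (F : I -> R) :
  (forall j, 0 <= F j) -> uniq s -> {subset s <= t} ->
  \sum_(i <- s) F i <= \sum_(j <- t) F j.
Proof. by move=> F0 us st; apply: (sum_le_inj (f := id)). Qed.

Lemma sum_fibers_le (I J : eqType) (s : seq I) (t : seq J) (k : I -> J) (F : I -> R) :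
  (forall i, 0 <= F i) -> uniq t ->
  \sum_(c <- t) \sum_(i <- s | k i == c) F i <= \sum_(i <- s) F i.
Proof.
move=> F0 ut; rewrite (exchange_big_dep predT)//=; apply: ler_sum => i _.
rewrite big_const_seq iter_addr addr0 -mulr_natr ler_piMr// lern1.
by rewrite (eq_count (a2 := pred1 (k i))) ?count_uniq_mem ?leq_b1// => c; rewrite /= eq_sym.
Qed.

Lemma sum_split_le (I J : eqType) (s : seq I) (t : seq J) (k : I -> J) (F : I -> R) :
  (forall i, 0 <= F i) -> (forall i, i \in s -> k i \in t) ->
  \sum_(i <- s) F i <= \sum_(c <- t) \sum_(i <- s | k i == c) F i.
Proof.
move=> F0 kst; rewrite (exchange_big_dep predT)//= big_seq [leRHS]big_seq.
apply: ler_sum => i /kst kt; rewrite (big_rem (k i))//= eqxx lerDl.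
exact: sumr_ge0.
Qed.

End finite_sums.

Section lattice.
Variables (R : realType) (d : nat).
Local Notation Zd := 'rV[int]_d.
Implicit Types (z w y h : Zd) (s : seq Zd) (U : Zd -> R).

Definition near_cells (M : nat) z w := [forall i, `|z 0 i - w 0 i| <= M%:Z].

Lemma near_cellsP M z w : reflect (forall i, `|z 0 i - w 0 i| <= M%:Z) (near_cells M z w).
Proof. exact: forallP. Qed.

Lemma near_cells_le M M' z w : (M <= M')%N -> near_cells M z w -> near_cells M' z w.
Proof.
move=> MM' /near_cellsP h; apply/near_cellsP => i; apply: le_trans (h i) _.
by rewrite lez_nat.
Qed.

Lemma near_cells_add M z w h : near_cells M (z + w) (z + h) = near_cells M w h.
Proof.
by apply/near_cellsP/near_cellsP => H i; have := H i; rewrite !mxE opprD addrACA subrr add0r.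
Qed.

Definition energy M s U : R :=
  \sum_(z <- s) \sum_(w <- s | near_cells M z w) (U z - U w) ^+ 2.

Lemma energy_ge0 M s U : 0 <= energy M s U.
Proof. by apply: sumr_ge0 => z _; apply: sumr_ge0 => w _; exact: sqr_ge0. Qed.

Lemma energy_le M M' s U : (M <= M')%N -> energy M s U <= energy M' s U.
Proof.
move=> MM'; apply: ler_sum => z _; rewrite big_mkcond [leRHS]big_mkcond.
apply: ler_sum => w _; case: ifPn => [/(near_cells_le MM') ->//|_].
by case: ifP => // _; exact: sqr_ge0.
Qed.

Lemma energy_subset M s t U : uniq s -> {subset s <= t} ->
  energy M s U <= energy M t U.
Proof.
move=> us st.
apply: (@le_trans _ _ (\sum_(z <- s) \sum_(w <- t | near_cells M z w) (U z - U w) ^+ 2)).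
  apply: ler_sum => z _; rewrite big_mkcond [leRHS]big_mkcond.
  by apply: sum_le_subset => // w; case: ifP => // _; exact: sqr_ge0.
by apply: sum_le_subset => // z; apply: sumr_ge0 => w _; exact: sqr_ge0.
Qed.

(** Translation by [w] is injective, so distinct [z] use distinct ordered pairs of the energy. *)
Lemma energy_step M s s1 U w h : uniq s1 -> near_cells M w h ->
  (forall z, z \in s1 -> z + w \in s /\ z + h \in s) ->
  \sum_(z <- s1) (U (z + w) - U (z + h)) ^+ 2 <= energy M s U.
Proof.
move=> us1 wh hs.
pose F y := \sum_(y' <- s | near_cells M y y') (U y - U y') ^+ 2.
apply: (@le_trans _ _ (\sum_(z <- s1) F (z + w))).
  rewrite big_seq [leRHS]big_seq; apply: ler_sum => z /hs[_ zh].
  rewrite /F (big_rem (z + h))//= near_cells_add wh lerDl.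
  by apply: sumr_ge0 => y _; exact: sqr_ge0.
apply: (sum_le_inj (f := fun z => z + w)) => // [y|z /hs[]//|y z _ _ /addIr //].
by apply: sumr_ge0 => y' _; exact: sqr_ge0.
Qed.

(** All cells follow the same path [f], so each single step costs at most one full energy. One
    factor [m] is the number of steps, the other comes from Cauchy-Schwarz on the telescoping
    sum. *)
Lemma energy_path M s s1 U (m : nat) (f : nat -> Zd) : uniq s1 ->
  (forall j, (j < m)%N -> near_cells M (f j.+1) (f j)) ->
  (forall z j, z \in s1 -> (j <= m)%N -> z + f j \in s) ->
  \sum_(z <- s1) (U (z + f m) - U (z + f 0%N)) ^+ 2 <= m%:R ^+ 2 * energy M s U.
Proof.
move=> us1 fstep fs.
apply: (@le_trans _ _ (\sum_(z <- s1) m%:R *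
    \sum_(j <- iota 0 m) (U (z + f j.+1) - U (z + f j)) ^+ 2)).
  apply: ler_sum => z _.
  have -> : U (z + f m) - U (z + f 0%N) =
      \sum_(j <- iota 0 m) (U (z + f j.+1) - U (z + f j)).
    by rewrite -(telescope_sumr (fun j => U (z + f j)) (leq0n m)) /index_iota subn0.
  by have := sqr_sum_le (iota 0 m) (fun j => U (z + f j.+1) - U (z + f j)); rewrite size_iota.
rewrite -mulr_sumr expr2 -mulrA ler_wpM2l// exchange_big /=.
apply: (@le_trans _ _ (\sum_(j <- iota 0 m) energy M s U)).
  rewrite big_seq [leRHS]big_seq; apply: ler_sum => j; rewrite mem_iota add0n => /= jm.
  by apply: energy_step => // [|z zs]; [exact: fstep|split; apply: fs => //; exact: ltnW].
by rewrite big_const_seq count_predT iter_addr addr0 size_iota mulr_natl.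
Qed.

Definition intbox (lo : Zd) (b : nat) : seq Zd :=
  [seq lo + \row_i (f i : nat)%:Z | f : {ffun 'I_d -> 'I_b}].

Lemma intbox_uniq lo b : uniq (intbox lo b).
Proof.
rewrite map_inj_uniq ?enum_uniq// => f g /addrI/rowP fg; apply/ffunP => i.
by have := fg i; rewrite !mxE => -[] /val_inj.
Qed.

Lemma size_intbox lo b : size (intbox lo b) = (b ^ d)%N.
Proof. by rewrite size_image card_ffun !card_ord. Qed.

Lemma mem_intbox lo b z :
  (z \in intbox lo b) = [forall i, (0 <= z 0 i - lo 0 i) && (z 0 i - lo 0 i < b%:Z)].
Proof.
apply/mapP/forallP => [[f _ -> i]|h].
  by rewrite !mxE addrAC subrr add0r ltz_nat ltn_ord lez_nat.
have hb i : (absz (z 0%R i - lo 0%R i)%R < b)%N.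
  by have /andP[h1 h2] := h i; rewrite -ltz_nat gez0_abs.
exists [ffun i => Ordinal (hb i)]; first by rewrite mem_enum.
apply/rowP => i; rewrite !mxE ffunE /=; have /andP[h1 _] := h i.
by rewrite gez0_abs// addrC subrK.
Qed.

Definition between z w y :=
  forall i, (z 0 i <= y 0 i <= w 0 i) || (w 0 i <= y 0 i <= z 0 i).

(** Convexity for the coordinatewise order: exactly what keeps the paths [king_path] inside [s]. *)
Definition convex_cells s := forall z w y, z \in s -> w \in s -> between z w y -> y \in s.

(* The path from [0] to [h] moving every unfinished coordinate by one unit at
   each step. *)
Definition king_path h (j : nat) : Zd :=
  \row_i (Num.sg (h 0 i) * Num.min j%:Z `|h 0 i|).

Lemma king_path0 h : king_path h 0 = 0.
Proof. by apply/rowP => i; rewrite !mxE min_l ?mulr0. Qed.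

Lemma king_path_end h b : (forall i, `|h 0 i| <= b%:Z) -> king_path h b = h.
Proof. by move=> hb; apply/rowP => i; rewrite !mxE min_r// -numEsg. Qed.

Lemma king_path_step h j : near_cells 1 (king_path h j.+1) (king_path h j).
Proof.
apply/near_cellsP => i; rewrite !mxE.
have : Num.min j.+1%:Z `|h 0 i| - Num.min j%:Z `|h 0 i| \in [:: 0; 1].
  by rewrite !inE; lia.
by rewrite -mulrBr !inE => /orP[] /eqP ->; case: sgrP => _; lia.
Qed.

Lemma king_path_between z h j : between z (z + h) (z + king_path h j).
Proof.
move=> i; rewrite !mxE.
move: (z 0 i) (h 0 i) => a b.
case: sgrP => hi; [rewrite hi mul0r|rewrite mul1r|rewrite mulN1r]; lia.
Qed.

(** The pairs are grouped by their difference [h], which takes at most [(2 * b + 1) ^ d] values; for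
    each of them all pairs are joined by translates of one path of [b] unit steps. *)
Lemma sum_convex_cells s b U : uniq s -> convex_cells s ->
  (forall z w, z \in s -> w \in s -> near_cells b z w) ->
  \sum_(z <- s) \sum_(w <- s) (U z - U w) ^+ 2 <=
  (2 * b + 1)%:R ^+ d * b%:R ^+ 2 * energy 1 s U.
Proof.
move=> us cvx diam.
pose H := intbox (\row_(i < d) (- b%:Z)) (2 * b + 1).
have memH h : (forall i, `|h 0 i| <= b%:Z) -> h \in H.
  move=> hb; rewrite mem_intbox; apply/forallP => i; have := hb i.
  by rewrite !mxE; lia.
apply: (@le_trans _ _ (\sum_(z <- s) \sum_(h <- H | z + h \in s) (U (z + h) - U z) ^+ 2)).
  rewrite big_seq [leRHS]big_seq; apply: ler_sum => z zs.
  rewrite [leRHS]big_mkcond big_seq.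
  pose F h := if z + h \in s then (U (z + h) - U z) ^+ 2 else 0.
  rewrite (_ : \sum_(i <- s | i \in s) _ = \sum_(w <- s | w \in s) F (w - z)); last first.
    by apply: eq_bigr => w ws; rewrite /F (addrC z (w - z)) subrK ws -[RHS]sqrrN opprB.
  rewrite -big_seq; apply: (sum_le_inj (f := fun w => w - z)) => //.
  - by move=> h; rewrite /F; case: ifP => // _; exact: sqr_ge0.
  - by move=> w ws; apply: memH => i; have /near_cellsP/(_ i) := diam _ _ ws zs; rewrite !mxE.
  - by move=> w y _ _ /addIr.
rewrite (exchange_big_dep predT)//=.
apply: (@le_trans _ _ (\sum_(h <- H) b%:R ^+ 2 * energy 1 s U)); last first.
  by rewrite sumr_const_seq size_intbox natrX mulrA.
rewrite big_seq [leRHS]big_seq; apply: ler_sum => h hH.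
have hb i : `|h 0 i| <= b%:Z.
  move: hH; rewrite mem_intbox => /forallP/(_ i); rewrite !mxE; move: (h 0 i) => a; lia.
rewrite -big_filter; set s1 := [seq z <- s | _].
have -> : \sum_(z <- s1) (U (z + h) - U z) ^+ 2 =
    \sum_(z <- s1) (U (z + king_path h b) - U (z + king_path h 0)) ^+ 2.
  by apply: eq_bigr => z _; rewrite king_path0 king_path_end// addr0.
apply: energy_path => [|j _|z j]; first exact: filter_uniq.
  exact: king_path_step.
rewrite mem_filter => /andP[zh zs] _; apply: cvx zs zh _.
exact: king_path_between.
Qed.

Lemma convex_cells_intbox lo b : convex_cells (intbox lo b).
Proof.
move=> z w y; rewrite !mem_intbox => /forallP hz /forallP hw hy.
by apply/forallP => i; have := hz i; have := hw i; have := hy i; lia.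
Qed.

Lemma near_cells_intbox lo b z w : z \in intbox lo b -> w \in intbox lo b -> near_cells b z w.
Proof.
rewrite !mem_intbox => /forallP hz /forallP hw; apply/near_cellsP => i.
by have := hz i; have := hw i; lia.
Qed.

Lemma size_near_cells s b : uniq s ->
  (forall z w, z \in s -> w \in s -> near_cells b z w) ->
  (size s <= (2 * b + 1) ^ d)%N.
Proof.
case: s => // z0 s us diam.
rewrite -(size_intbox (\row_i (z0 0 i - b%:Z)) (2 * b + 1)).
apply: uniq_leq_size => // z zs; rewrite mem_intbox; apply/forallP => i.
have /near_cellsP/(_ i) := diam _ _ zs (mem_head _ _).
by rewrite !mxE; move: (z 0 i) (z0 0 i) => x y; lia.
Qed.

(** With mean zero the double sum of squared differences is exactly [2 * size s] times the sum of
    squares. *)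
Lemma poincare_convex_cells s b U : uniq s -> convex_cells s ->
  (forall z w, z \in s -> w \in s -> near_cells b z w) -> \sum_(z <- s) U z = 0 ->
  2 * (size s)%:R * \sum_(z <- s) U z ^+ 2 <=
  (2 * b + 1)%:R ^+ d * b%:R ^+ 2 * energy 1 s U.
Proof.
move=> us cvx diam U0; apply: le_trans (sum_convex_cells U us cvx diam).
by rewrite sum_sqrB U0; lra.
Qed.

(** A substitute for mean zero: control on a part [s0] spreads to [s], on averaging
    [U w ^ 2 <= 2 U z ^ 2 + 2 (U z - U w) ^ 2] over [z] in [s0]. This carries estimates from one
    ball to an overlapping one. *)
Lemma sum_sqr_convex_cells s s0 b U : uniq s -> convex_cells s ->
  (forall z w, z \in s -> w \in s -> near_cells b z w) ->
  uniq s0 -> {subset s0 <= s} ->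
  (size s0)%:R * \sum_(z <- s) U z ^+ 2 <=
  2 * (size s)%:R * \sum_(z <- s0) U z ^+ 2
  + 2 * ((2 * b + 1)%:R ^+ d * b%:R ^+ 2 * energy 1 s U).
Proof.
move=> us cvx diam us0 s0s.
apply: (@le_trans _ _ (\sum_(z <- s0) \sum_(w <- s) (2 * U z ^+ 2 + 2 * (U z - U w) ^+ 2))).
  rewrite -sumr_const_seq; apply: ler_sum => z _; apply: ler_sum => w _.
  by have := sqr_ge0 (2 * U z - U w); nra.
have -> : \sum_(z <- s0) \sum_(w <- s) (2 * U z ^+ 2 + 2 * (U z - U w) ^+ 2) =
    2 * (size s)%:R * \sum_(z <- s0) U z ^+ 2
    + 2 * \sum_(z <- s0) \sum_(w <- s) (U z - U w) ^+ 2.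
  rewrite !mulr_sumr -big_split; apply: eq_bigr => z _ /=.
  rewrite big_split /= sumr_const_seq -mulr_sumr; ring.
rewrite lerD2l ler_pM2l//.
apply: le_trans (sum_convex_cells U us cvx diam).
apply: sum_le_subset => // z; apply: sumr_ge0 => w _; exact: sqr_ge0.
Qed.

(** For a positive divisor [divz] rounds down on negative integers too, so the coarse boxes tile the
    whole lattice. *)
Definition coarse (b : nat) z : Zd := \row_i divz (z 0 i) b%:Z.

Definition coarse_box b c : seq Zd := intbox (c *+ b) b.

Lemma mem_coarse_box b c z : (0 < b)%N -> (z \in coarse_box b c) = (coarse b z == c).
Proof.
move=> b0; rewrite mem_intbox; apply/forallP/eqP => [h|<- i].
  apply/rowP => i; rewrite mxE; have := h i; rewrite mulmxnE; move: (z 0 i) (c 0 i) => x y.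
  rewrite -mulr_natr natz => hx.
  have -> : x = y * b%:Z + (x - y * b%:Z) by ring.
  by rewrite divzMDl ?divz_small ?addr0//; lia.
rewrite mulmxnE mxE -mulr_natr natz; move: (z 0 i) => x.
have := divz_eq x b%:Z; have := modz_ge0 x (_ : b%:Z != 0); have := ltz_mod x (_ : b%:Z != 0).
have bn0 : b%:Z != 0 by lia.
move=> /(_ bn0) h1 /(_ bn0) h2 h3; rewrite {1 3}h3 addrAC subrr add0r h2 /=.
by rewrite (lt_le_trans h1)//; lia.
Qed.

(** The boxes are disjoint, so their energies add up to at most the total. In each box the factor
    [(2 * b + 1) ^ d <= 3 ^ d * b ^ d] is divided by the number [b ^ d] of cells, which leaves the
    expected scaling [b ^ 2]. *)
Lemma poincare_coarse M s b (C t : seq Zd) U : (0 < b)%N -> (0 < M)%N ->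
  uniq C -> (forall c, c \in C -> {subset coarse_box b c <= s}) ->
  (forall c, c \in C -> \sum_(z <- coarse_box b c) U z = 0) ->
  uniq t -> (forall w, w \in t -> coarse b w \in C) ->
  \sum_(w <- t) U w ^+ 2 <= 3 ^+ d * b%:R ^+ 2 * energy M s U.
Proof.
move=> b0 M0 uC Cs U0 ut tC.
apply: (@le_trans _ _ (\sum_(c <- C) \sum_(w <- coarse_box b c) U w ^+ 2)).
  apply: le_trans (sum_split_le (fun w => sqr_ge0 (U w)) tC) _.
  apply: ler_sum => c _; rewrite -big_filter; apply: sum_le_subset.
  - by move=> w; exact: sqr_ge0.
  - exact: filter_uniq.
  - by move=> w; rewrite mem_filter mem_coarse_box// => /andP[].
apply: (@le_trans _ _ (\sum_(c <- C) 3 ^+ d * b%:R ^+ 2 *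
     \sum_(z <- s | coarse b z == c) \sum_(w <- s | near_cells M z w) (U z - U w) ^+ 2)).
  rewrite big_seq [leRHS]big_seq; apply: ler_sum => c cC.
  have := poincare_convex_cells (intbox_uniq (c *+ b) b) (@convex_cells_intbox _ b)
    (@near_cells_intbox _ b) (U0 c cC).
  rewrite -/(coarse_box b c) size_intbox.
  have le_energy : energy 1 (coarse_box b c) U <=
      \sum_(z <- s | coarse b z == c) \sum_(w <- s | near_cells M z w) (U z - U w) ^+ 2.
    apply: le_trans (energy_le _ _ M0) _.
    apply: (@le_trans _ _ (\sum_(z <- coarse_box b c)
        \sum_(w <- s | near_cells M z w) (U z - U w) ^+ 2)).
      apply: ler_sum => z _; rewrite big_mkcond [leRHS]big_mkcond.
      apply: sum_le_subset; [|exact: intbox_uniq|exact: Cs].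
      by move=> w; case: ifP => // _; exact: sqr_ge0.
    rewrite -[leRHS]big_filter; apply: sum_le_subset => [z||z zc].
    - by apply: sumr_ge0 => w _; exact: sqr_ge0.
    - exact: intbox_uniq.
    - by rewrite mem_filter (Cs _ cC) // andbT -mem_coarse_box.
  set X := \sum_(z <- coarse_box b c) _; set E := energy _ _ _ in le_energy *.
  set Y := \sum_(z <- s | _) _ in le_energy *.
  move=> hX.
  have bR : 0 < (b%:R : R) ^+ d by rewrite exprn_gt0// ltr0n.
  have h3 : (2 * b + 1)%:R ^+ d <= 3 ^+ d * (b%:R : R) ^+ d.
    rewrite -exprMn lerXn2r ?nnegrE ?mulr_ge0// -natrM ler_nat; lia.
  have E0 : 0 <= E by exact: energy_ge0.
  have X0 : 0 <= X by apply: sumr_ge0 => w _; exact: sqr_ge0.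
  rewrite -(ler_pM2l bR); apply: (@le_trans _ _ (2 * (b ^ d)%:R * X)).
    by rewrite natrX -mulrA ler_peMl ?ler1n// mulr_ge0// ltW.
  apply: (le_trans hX).
  have -> : b%:R ^+ d * (3 ^+ d * b%:R ^+ 2 * Y) = (3 ^+ d * b%:R ^+ d) * b%:R ^+ 2 * Y.
    by move: (_ ^+ d) (_ ^+ d) => p q; ring.
  apply: ler_pM => //.
  by rewrite ler_wpM2r ?exprn_ge0.
rewrite -mulr_sumr ler_wpM2l ?mulr_ge0 ?exprn_ge0//.
apply: sum_fibers_le => // z; apply: sumr_ge0 => w _; exact: sqr_ge0.
Qed.

End lattice.

(** * From functions on the sample to averages over cells *)

Lemma sqr_avgB_le (R : realType) (I J : Type) (s : seq I) (t : seq J)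
    (a : I -> R) (b : J -> R) : (0 < size s)%N -> (0 < size t)%N ->
  (size s)%:R * (size t)%:R *
    ((\sum_(i <- s) a i) / (size s)%:R - (\sum_(j <- t) b j) / (size t)%:R) ^+ 2 <=
  \sum_(i <- s) \sum_(j <- t) (a i - b j) ^+ 2.
Proof.
move=> s0 t0; rewrite sum_sqrB.
have := sqr_sum_le s a; have := sqr_sum_le t b.
have : 0 < (size s)%:R :> R by rewrite ltr0n.
have : 0 < (size t)%:R :> R by rewrite ltr0n.
move: (size t)%:R (size s)%:R => m k.
move: (\sum_(i <- s) a i) (\sum_(j <- t) b j) (\sum_(i <- s) a i ^+ 2) (\sum_(j <- t) b j ^+ 2).
move=> A B A2 B2 m0 k0 hB hA.
have -> : k * m * (A / k - B / m) ^+ 2 = m * (A ^+ 2 / k) + k * (B ^+ 2 / m) - 2 * A * B.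
  by field; rewrite !gt_eqF.
rewrite lerD2r lerD// ler_pM2l//.
  by rewrite ler_pdivrMr// mulrC.
by rewrite ler_pdivrMr// mulrC.
Qed.

Section cell_averages.
Variables (R : realType) (d n : nat).
Local Notation Zd := 'rV[int]_d.
Variables (cell : 'I_n -> Zd) (s : seq Zd) (Kmin Kmax : R) (M : nat).
Implicit Types (z w : Zd) (u : 'I_n -> R).

Definition points z : seq 'I_n := [seq i <- index_enum 'I_n | cell i == z].

Definition cell_avg u z : R := (\sum_(i <- points z) u i) / (size (points z))%:R.

Definition close_energy u : R :=
  \sum_i \sum_(j | near_cells M (cell i) (cell j)) (u i - u j) ^+ 2.

Hypothesis us : uniq s.
Hypothesis Kmin0 : 0 < Kmin.
Hypothesis hmin : forall z, z \in s -> Kmin <= (size (points z))%:R.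
Hypothesis hmax : forall z, (size (points z))%:R <= Kmax.

Lemma close_energy_ge0 u : 0 <= close_energy u.
Proof. by apply: sumr_ge0 => i _; apply: sumr_ge0 => j _; exact: sqr_ge0. Qed.

Lemma points_gt0 z : z \in s -> (0 < size (points z))%N.
Proof. by move=> /hmin; rewrite -(ltr0n R); exact: lt_le_trans. Qed.

(** By Jensen, a squared difference of two averages is at most the mean over the pairs of points,
    and two cells of [s] offer at least [Kmin ^ 2] pairs. *)
Lemma energy_cell_avg u :
  energy M s (cell_avg u) <= Kmin ^- 2 * close_energy u.
Proof.
rewrite ler_pdivlMl ?exprn_gt0// /energy mulr_sumr.
apply: (@le_trans _ _ (\sum_(z <- s) \sum_(i | cell i == z)
   \sum_(w <- s) \sum_(j | cell j == w) (if near_cells M (cell i) (cell j) then (u i - u j) ^+ 2 else 0))).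
  rewrite big_seq [leRHS]big_seq; apply: ler_sum => z zs.
  rewrite exchange_big mulr_sumr big_mkcond big_seq [leRHS]big_seq /=.
  apply: ler_sum => w ws; case: ifPn => zw; last first.
    apply: sumr_ge0 => i _; apply: sumr_ge0 => j _; case: ifP => // _; exact: sqr_ge0.
  have -> : \sum_(i | cell i == z) \sum_(j | cell j == w)
      (if near_cells M (cell i) (cell j) then (u i - u j) ^+ 2 else 0) =
    \sum_(i <- points z) \sum_(j <- points w) (u i - u j) ^+ 2.
    rewrite [RHS]big_filter; apply: eq_bigr => i /eqP iz.
    by rewrite [RHS]big_filter; apply: eq_bigr => j /eqP jw; rewrite iz jw zw.
  apply: le_trans (sqr_avgB_le _ _ (points_gt0 zs) (points_gt0 ws)).
  by rewrite ler_wpM2r ?sqr_ge0// expr2; apply: ler_pM; rewrite ?hmin ?ltW.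
apply: (@le_trans _ _ (\sum_i \sum_(w <- s) \sum_(j | cell j == w)
    (if near_cells M (cell i) (cell j) then (u i - u j) ^+ 2 else 0))).
  apply: sum_fibers_le => // i; apply: sumr_ge0 => w _; apply: sumr_ge0 => j _.
  by case: ifP => // _; exact: sqr_ge0.
apply: ler_sum => i _; rewrite [leRHS]big_mkcond.
by apply: sum_fibers_le => // j; case: ifP => // _; exact: sqr_ge0.
Qed.

Lemma sqr_dist_cell_avg u (t : 'I_n -> Zd) :
  (forall i, t i \in s) -> (forall i, near_cells M (cell i) (t i)) ->
  \sum_i (u i - cell_avg u (t i)) ^+ 2 <= Kmin^-1 * close_energy u.
Proof.
move=> ts tM; rewrite ler_pdivlMl// mulr_sumr; apply: ler_sum => i _.
have := @sqr_avgB_le R _ _ [:: i] (points (t i)) u u isT (points_gt0 (ts i)).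
rewrite !big_seq1 divr1 mul1r -/(cell_avg u (t i)) => h.
apply: (@le_trans _ _ ((size (points (t i)))%:R * (u i - cell_avg u (t i)) ^+ 2)).
  by rewrite ler_wpM2r ?sqr_ge0// hmin.
apply: (le_trans h); rewrite big_filter big_mkcond [leRHS]big_mkcond.
apply: ler_sum => j _; case: eqP => [->|_]; first by rewrite tM.
by case: ifP => // _; exact: sqr_ge0.
Qed.

Lemma sum_cell_le (F : Zd -> R) (t : seq Zd) : (forall z, 0 <= F z) ->
  (forall i, cell i \in t) -> 
  \sum_i F (cell i) <= Kmax * \sum_(z <- t) F z.
Proof.
move=> F0 ct; apply: sum_le_fiber => // z _.
by rewrite -size_filter; exact: hmax.
Qed.

(* Each sample reaches the deep cell [cell i + m a] through the good cells
   [cell i + j a], where [a] is the cone direction attached to its cell. *)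
Lemma sum_sqr_le_close_energy (dir : Zd -> Zd) (dirs t : seq Zd) (j0 m : nat)
    (B : R) u :
  (forall i, dir (cell i) \in dirs) -> (j0 <= m)%N ->
  (forall i j, (j0 <= j <= m)%N -> cell i + dir (cell i) *+ j \in s) ->
  (forall a, a \in dirs -> near_cells M a 0) ->
  (forall i, near_cells M (cell i) (cell i + dir (cell i) *+ j0)) ->
  (forall i, cell i + dir (cell i) *+ m \in t) ->
  0 <= B -> uniq t ->
  \sum_(w <- t) cell_avg u w ^+ 2 <= B * energy M s (cell_avg u) ->
  \sum_i u i ^+ 2 <=
  3 * (Kmin^-1 + Kmax * (size dirs)%:R * (m%:R ^+ 2 + B) * Kmin ^- 2) * close_energy u.
Proof.
move=> cdirs j0m cs dM cM ct B0 ut hB.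
have Kmax0 : 0 <= Kmax by apply: le_trans (hmax 0).
pose U := cell_avg u; pose Z := undup [seq cell i | i : 'I_n].
have uZ : uniq Z by exact: undup_uniq.
have cZ i : cell i \in Z by rewrite mem_undup; apply/mapP; exists i; rewrite ?mem_enum.
have Zc z : z \in Z -> exists i, z = cell i.
  by rewrite mem_undup => /mapP[i _ ->]; exists i.
(* Let x and y be the averages at the cells reached after [j0] and [m] steps. Then [h1], [h2], [h3]
   bound the three terms of u = (u - x) + (x - y) + y, and the factor 3 comes from squaring this
   sum. *)
have h1 := sqr_dist_cell_avg u
  (fun i => cs i j0 (introT andP (conj (leqnn j0) j0m))) cM.
have h2 : \sum_i (U (cell i + dir (cell i) *+ j0) - U (cell i + dir (cell i) *+ m)) ^+ 2
    <= Kmax * ((size dirs)%:R * (m%:R ^+ 2 * energy M s U)).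
  pose F z := (U (z + dir z *+ j0) - U (z + dir z *+ m)) ^+ 2.
  apply: le_trans (sum_cell_le (F := F) (fun z => sqr_ge0 _) cZ) _.
  rewrite ler_wpM2l//.
  have dZ z : z \in Z -> dir z \in dirs by move=> /Zc[i ->].
  apply: le_trans (sum_split_le (fun z => sqr_ge0 _) dZ) _.
  (* Cells with the same direction move in parallel, as [energy_path] requires; summing over the
     directions costs [size dirs]. *)
  rewrite -sumr_const_seq big_seq [leRHS]big_seq; apply: ler_sum => a adirs.
  rewrite -big_filter.
  have -> : \sum_(z <- [seq z <- Z | dir z == a]) F z =
      \sum_(z <- [seq z <- Z | dir z == a]) (U (z + a *+ (j0 + (m - j0))) - U (z + a *+ (j0 + 0))) ^+ 2.
    rewrite big_filter [RHS]big_filter; apply: eq_bigr => z /eqP dz.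
    by rewrite /F dz subnKC// addn0 -[LHS]sqrrN opprB.
  apply: (@le_trans _ _ ((m - j0)%:R ^+ 2 * energy M s U)).
    apply: (@energy_path R d M s _ U (m - j0) (fun j => a *+ (j0 + j))).
    - exact: filter_uniq.
    - move=> j _; have := dM _ adirs; rewrite -(near_cells_add M (a *+ (j0 + j))) addr0.
      by rewrite addnS mulrSr.
    - move=> z j; rewrite mem_filter => /andP[/eqP <- /Zc[i ->]] jm.
      by apply: cs; rewrite leq_addr /= -leq_subRL.
  rewrite ler_wpM2r ?energy_ge0// lerXn2r ?nnegrE// ler_nat.
  exact: leq_subr.
have h3 : \sum_i U (cell i + dir (cell i) *+ m) ^+ 2
    <= Kmax * ((size dirs)%:R * (B * energy M s U)).
  pose F z := U (z + dir z *+ m) ^+ 2.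
  apply: le_trans (sum_cell_le (F := F) (fun z => sqr_ge0 _) cZ) _.
  rewrite ler_wpM2l//.
  have dZ z : z \in Z -> dir z \in dirs by move=> /Zc[i ->].
  apply: le_trans (sum_split_le (fun z => sqr_ge0 _) dZ) _.
  rewrite -sumr_const_seq big_seq [leRHS]big_seq; apply: ler_sum => a adirs.
  apply: le_trans hB.
  rewrite -big_filter.
  have -> : \sum_(z <- [seq z <- Z | dir z == a]) F z =
      \sum_(z <- [seq z <- Z | dir z == a]) U (z + a *+ m) ^+ 2.
    by rewrite big_filter [RHS]big_filter; apply: eq_bigr => z /eqP dz; rewrite /F dz.
  apply: (sum_le_inj (f := fun z => z + a *+ m) (F := fun z => U z ^+ 2)).
  - by move=> z; exact: sqr_ge0.
  - by move=> z; rewrite mem_filter => /andP[/eqP <- /Zc[i ->]].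
  - exact: filter_uniq.
  - by move=> z w _ _ /addIr.
have hE := energy_cell_avg u; rewrite -/U in hE.
set E := energy _ _ _ in h2 h3 hE; set F := close_energy u in h1 hE *.
have F0 : 0 <= F by exact: close_energy_ge0.
apply: (@le_trans _ _ (3 * (Kmin^-1 * F + Kmax * ((size dirs)%:R * (m%:R ^+ 2 * E)) +
    Kmax * ((size dirs)%:R * (B * E))))).
  apply: le_trans (_ : _ <= 3 * (\sum_i (u i - cell_avg u (cell i + dir (cell i) *+ j0)) ^+ 2
     + \sum_i (U (cell i + dir (cell i) *+ j0) - U (cell i + dir (cell i) *+ m)) ^+ 2
     + \sum_i U (cell i + dir (cell i) *+ m) ^+ 2)) _; last first.
    by rewrite ler_wpM2l// !lerD.
  rewrite -!big_split /= mulr_sumr; apply: ler_sum => i _.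
  rewrite -/U; move: (U (cell i + dir (cell i) *+ j0)) (U (cell i + dir (cell i) *+ m)) (u i) => x y v.
  have := sqr_ge0 (v - x - (x - y)); have := sqr_ge0 (v - x - y); have := sqr_ge0 (x - y - y).
  nra.
rewrite -[leRHS]mulrA ler_wpM2l//.
have -> : Kmin^-1 * F + Kmax * ((size dirs)%:R * (m%:R ^+ 2 * E)) + Kmax * ((size dirs)%:R * (B * E)) =
  Kmin^-1 * F + (Kmax * (size dirs)%:R * (m%:R ^+ 2 + B)) * E by ring.
rewrite mulrDl lerD2l -!mulrA.
rewrite ler_wpM2l// ler_wpM2l// ler_wpM2l// addr_ge0// exprn_ge0//.
Qed.

End cell_averages.

(** * Cells inside a connected Lipschitz domain *)

(** If [Q K] failed, the sets whose complement in [K] satisfies [Q] would form a proper filter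
    containing [K]; a neighbourhood satisfying [Q] of one of its cluster points gives the
    contradiction. *)
Lemma compact_local (T : topologicalType) (K : set T) (Q : set T -> Prop) :
  compact K -> Q set0 -> (forall V W, V `<=` W -> Q W -> Q V) ->
  (forall V W, Q V -> Q W -> Q (V `|` W)) ->
  (forall x, K x -> exists2 V, nbhs x V & Q V) -> Q K.
Proof.
move=> cK Q0 Qm QU Ql; apply: contrapT => nQK.
pose F : set_system T := [set X | Q (K `\` X)].
have PF : ProperFilter F.
  split; first by rewrite /F /= setD0.
  split; first by rewrite /F /= setDT.
    by move=> X Y FX FY; rewrite /F /= setDIr; exact: QU.
  by move=> X Y XY; apply: Qm => x [Kx nY]; split=> // /XY.
have FK : F K by rewrite /F /= setDv.
have [x [Kx clx]] := cK F PF FK.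
have [V xV QV] := Ql x Kx.
have FV : F (~` V) by apply: Qm QV => y [_ /contrapT].
by have [y [/= nVy Vy]] := clx _ _ FV xV.
Qed.

Section coordinates.
Variables (R : realType) (d : nat).
Implicit Types (x y : 'rV[R]_d) (e : R).

Definition sup_near e x y : Prop := forall i, `|x 0 i - y 0 i| <= e.

Lemma nbhs_sup_near x (V : set 'rV[R]_d) :
  nbhs x V <-> exists2 e, 0 < e & forall y, sup_near e x y -> V y.
Proof.
split=> [/nbhs_ballP[e /= e0 xV]|[e e0 xV]].
  exists (e / 2) => [|y xy]; first by rewrite divr_gt0.
  apply: xV; split=> // i j; rewrite (ord1 i); apply: le_lt_trans (xy j) _.
  by rewrite ltr_pdivrMr// ltr_pMr// ltrDl.
apply/nbhs_ballP; exists e => // y [_ xy]; apply: xV => i; exact: ltW (xy 0 i).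
Qed.

Lemma sup_near_sym e x y : sup_near e x y -> sup_near e y x.
Proof. by move=> h i; rewrite distrC. Qed.

Lemma sup_near_trans e e' x y z : sup_near e x y -> sup_near e' y z -> sup_near (e + e') x z.
Proof.
move=> h h' i; rewrite (le_trans (ler_distD (y 0 i) _ _))//; exact: lerD.
Qed.

Lemma sup_near_le e e' x y : e <= e' -> sup_near e x y -> sup_near e' x y.
Proof. by move=> ee' h i; exact: le_trans (h i) ee'. Qed.

(** The factor [d], in place of the sharp square root of [d], is an integer and can enter
    [cell_ratio]. *)
Lemma enorm_le e x : 0 <= e -> (forall i, `|x 0 i| <= e) -> enorm x <= d%:R * e.
Proof.
move=> e0 h; rewrite -[leRHS]ger0_norm ?mulr_ge0// -sqrtr_sqr ler_wsqrtr//.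
apply: (@le_trans _ _ (\sum_(i < d) e ^+ 2)).
  by apply: ler_sum => i _; rewrite -real_normK ?num_real// lerXn2r ?nnegrE.
rewrite sumr_const card_ord -[leLHS]mulr_natl exprMn ler_wpM2r ?exprn_ge0//.
by case: d => [|n]; rewrite ?expr0n// ler_eXnr// ler1n.
Qed.

Lemma coord_le_enorm x i : `|x 0 i| <= enorm x.
Proof.
rewrite -sqrtr_sqr ler_wsqrtr// (bigD1 i)//= lerDl; apply: sumr_ge0 => j _.
exact: sqr_ge0.
Qed.

Lemma compact_box e : compact [set x : 'rV[R]_d | sup_near e 0 x].
Proof.
have -> : [set x : 'rV[R]_d | sup_near e 0 x] =
    [set v | forall i : 'I_d, `[- e, e]%classic (v ord0 i)].
  by apply/seteqP; split=> x /= h i; have := h i; rewrite mxE add0r normrN in_itv /= ler_norml.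
exact: (@rV_compact R d (fun _ => `[- e, e]%classic) (fun _ => @segment_compact R _ _)).
Qed.

Lemma bounded_sup_near (A : set 'rV[R]_d) : bounded_set A ->
  exists2 e, 0 < e & forall x, A x -> sup_near e 0 x.
Proof.
move=> [M [_ hM]].
pose e := `|M| + 1.
exists e => [|x Ax i]; first by rewrite /e ltr_wpDl.
have Me : M < e by rewrite /e (le_lt_trans (ler_norm M))// ltrDl.
have /= := hM e Me x Ax; apply: le_trans; rewrite mxE add0r normrN.
have -> : `|x| = mx_norm x by [].
rewrite mx_normrE.
exact: (le_bigmax _ (fun j : 'I_1 * 'I_d => `|x j.1 j.2|) (0, i)).
Qed.

End coordinates.

(** * Interior cones of a Lipschitz domain *)

Section cone.
Variables (R : realType) (d : nat) (A : set 'rV[R]_d).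
Local Notation Zd := 'rV[int]_d.

Definition int_vec (a : Zd) : 'rV[R]_d := map_mx intr a.

(** A truncated cone with apex [x], axis [a] and opening [1 / kap]. The axis is an integer vector so
    that moving along it maps lattice cells to lattice cells. *)
Definition cone_at (a : Zd) (kap : nat) (t0 : R) (x : 'rV[R]_d) : Prop :=
  forall (t : R) (y : 'rV[R]_d), 0 < t <= t0 -> (forall i, `|y 0 i| * kap%:R <= 1) ->
    A (x + t *: (int_vec a + y)).

Lemma cone_at_le a kap kap' t0 t0' x : (kap <= kap')%N -> t0' <= t0 ->
  cone_at a kap t0 x -> cone_at a kap' t0' x.
Proof.
move=> kk tt h t y /andP[tp tl] hy; apply: h => [|i].
  by rewrite tp (le_trans tl).
by apply: le_trans (hy i); rewrite ler_wpM2l// ler_nat.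
Qed.

(** The axis is [T] times the vertical direction of the rotated frame, rounded down to integers. For
    large [T] the vertical gain beats the Lipschitz growth of [phi], even after the rounding and the
    perturbation [y]. *)
Lemma lipschitz_epigraph_cone (x0 : 'rV[R]_d) (Q : 'M[R]_d) (i : 'I_d)
    (phi : 'rV[R]_d.-1 -> R) (rho : R) :
  Q *m Q^T = 1%:M -> lipschitz_in [set: 'rV[R]_d.-1] phi -> 0 < rho ->
  (forall y, enorm (y - x0) < rho ->
     (A y <-> phi (col' i (y *m Q)) < (y *m Q) 0 i)) ->
  exists a t0 e, [/\ 0 < t0, 0 < e & forall x, sup_near e x0 x -> A x -> cone_at a 1 t0 x].
Proof.
move=> QQ [L phiL] rho0 hA.
pose sQ := \sum_k \sum_j `|Q k j|.
have sQ0 : 0 <= sQ by apply: sumr_ge0 => k _; apply: sumr_ge0.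
have Qcol k : \sum_j `|Q j k| <= sQ.
  apply: ler_sum => j _; rewrite (bigD1 k)//= lerDl; exact: sumr_ge0.
(* Rounding and [y] together displace each coordinate by at most 2, hence each rotated coordinate by
   at most [2 * sQ]. The vertical gain is therefore at least [T - 2 * sQ], while [phi] grows by at
   most [L d] times [2 * sQ]. *)
pose T := (Num.truncn (2 * sQ * (`|L| * d%:R + 1))).+1.
have hT : 2 * sQ * (`|L| * d%:R + 1) <= T%:R.
  have /truncn_itv/andP[_ /ltW//] : 0 <= 2 * sQ * (`|L| * d%:R + 1).
  by rewrite !mulr_ge0// addr_ge0// mulr_ge0.
pose a : Zd := \row_j Num.floor (T%:R * Q j i).
pose sA := \sum_j `|(a 0 j)%:~R : R|.
have sA0 : 0 <= sA by exact: sumr_ge0.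
(* Both [x] and the step along the cone deviate by at most [e] per coordinate, so the Euclidean
   distance to [x0] is at most [2 * d * e < rho] and the local chart applies. *)
pose e := rho / (2 * d%:R + 1).
have e0 : 0 < e by rewrite divr_gt0// ltr_wpDl// mulr_ge0.
pose t0 := e / (sA + 1).
have t00 : 0 < t0 by rewrite divr_gt0// ltr_wpDl.
exists a, t0, e; split=> // x x0x Ax t y /andP[tp tl] hy.
have near z : sup_near (2 * e) z x0 -> enorm (z - x0) < rho.
  move=> h; apply: (@le_lt_trans _ _ (d%:R * (2 * e))).
    apply: enorm_le => [|j]; first by rewrite mulr_ge0// ltW.
    by have := h j; rewrite !mxE.
  rewrite mulrA /e mulrA ltr_pdivrMr ?ltr_wpDl ?mulr_ge0//.
  by rewrite [ltLHS]mulrC ltr_pM2l// mulrC ltrDl.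
have e2e : e <= 2 * e by lra.
have /hA[/(_ Ax) hx _] := near x (sup_near_le e2e (sup_near_sym x0x)).
pose g j := y 0 j - (T%:R * Q j i - (a 0 j)%:~R).
pose h k := \sum_j g j * Q j k.
have hg j : `|g j| <= 2.
  have hyj : `|y 0 j| <= 1 by have := hy j; rewrite mulr1.
  apply: le_trans (ler_normB _ _) _; rewrite (_ : 2 = 1 + 1)// lerD// mxE.
  have /andP[] := floor_itv (T%:R * Q j i); rewrite intrD => h1 h2.
  by rewrite ger0_norm ?subr_ge0// lerBlDl ltW.
have hh k : `|h k| <= 2 * sQ.
  apply: le_trans (ler_norm_sum _ _ _) _.
  apply: (@le_trans _ _ (2 * \sum_j `|Q j k|)); last by rewrite ler_pM2l.
  by rewrite mulr_sumr; apply: ler_sum => j _; rewrite normrM ler_wpM2r.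
have uQ k : ((int_vec a + y) *m Q) 0 k = T%:R *+ (k == i) + h k.
  have -> : ((int_vec a + y) *m Q) 0 k = T%:R * (Q^T *m Q) i k + h k.
    rewrite mxE [(Q^T *m Q) i k]mxE mulr_sumr -big_split; apply: eq_bigr => j _ /=.
    rewrite [(int_vec a + y) 0 j]mxE [int_vec a 0 j]mxE [Q^T i j]mxE /g.
    by move: (Q j i) (Q j k) (y 0 j) ((a 0 j)%:~R : R) => *; ring.
  by rewrite (mulmx1C QQ) mxE eq_sym mulr_natr.
have zQ k : ((x + t *: (int_vec a + y)) *m Q) 0 k = (x *m Q) 0 k + t * (T%:R *+ (k == i) + h k).
  by rewrite mulmxDl -scalemxAl mxE; congr (_ + _); rewrite mxE uQ.
apply/hA.
  apply: near => j.
  have -> : (x + t *: (int_vec a + y)) 0 j - x0 0 j =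
      x 0 j - x0 0 j + t * ((a 0 j)%:~R + y 0 j).
    by rewrite !mxE addrAC.
  have := x0x j; rewrite distrC => hj.
  apply: le_trans (ler_normD _ _) _; rewrite mulr_natl mulr2n lerD//.
  have hyj : `|y 0 j| <= 1 by have := hy j; rewrite mulr1.
  have haj : `|(a 0 j)%:~R : R| <= sA by rewrite /sA (bigD1 j)//= lerDl sumr_ge0.
  rewrite normrM (gtr0_norm tp); apply: (@le_trans _ _ (t0 * (sA + 1))).
    apply: ler_pM => //; first exact: ltW.
    by apply: le_trans (ler_normD _ _) _; exact: lerD.
  by rewrite /t0 divfK// gt_eqF// ltr_wpDl.
set z := x + _ in zQ *.
have hphi : `|phi (col' i (z *m Q)) - phi (col' i (x *m Q))| <= `|L| * (d%:R * (t * (2 * sQ))).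
  apply: (le_trans (phiL _ _ I I)); apply: (@le_trans _ _ (`|L| * enorm (col' i (z *m Q) - col' i (x *m Q)))).
    by rewrite ler_wpM2r ?sqrtr_ge0// ler_norm.
  rewrite ler_wpM2l//; apply: (@le_trans _ _ (d.-1%:R * (t * (2 * sQ)))).
    apply: enorm_le => [|k]; first by rewrite !mulr_ge0// ltW.
    have -> : (col' i (z *m Q) - col' i (x *m Q)) 0 k = t * h (lift i k).
      transitivity ((z *m Q) 0 (lift i k) - (x *m Q) 0 (lift i k)).
        by move: (z *m Q) (x *m Q) => p q; rewrite !mxE.
      by rewrite zQ addrAC subrr add0r eq_sym (negbTE (neq_lift _ _)) mulr0n add0r.
    by rewrite normrM gtr0_norm// ler_pM2l.
  by apply: ler_wpM2r; rewrite ?ler_nat ?leq_pred// !mulr_ge0// ltW.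
have := ler_normlW hphi; rewrite lerBlDr => /le_lt_trans; apply.
rewrite zQ eqxx mulr1n addrC; apply: ltr_leD => //.
have := hh i; rewrite ler_norml => /andP[hi _].
have -> : `|L| * (d%:R * (t * (2 * sQ))) = t * (`|L| * d%:R * (2 * sQ)) by ring.
rewrite ler_pM2l//; move: hT hi; move: (T%:R) (h i) (`|L| * d%:R) => *; nra.
Qed.

Definition has_cones (dirs : seq Zd) (kap : nat) (t0 : R) (V : set 'rV[R]_d) : Prop :=
  [/\ (0 < kap)%N, 0 < t0 &
  forall x, V x -> A x -> exists2 a, a \in dirs & cone_at a kap t0 x].

(** The property passes to finite unions (join the directions, take the larger [kap] and the smaller
    [t0]), so compactness of a box containing [A] reduces it to a local one. Points of [A] use the
    axis 0, for which the cone is a cube; points off the closure need no direction. *)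
Lemma lipschitz_cones : open A -> bounded_set A -> lipschitz_boundary A ->
  exists dirs kap t0, has_cones dirs kap t0 setT.
Proof.
move=> oA bA lA; have [e e0 Ae] := bounded_sup_near bA.
suff [dirs [kap [t0 [k0 t00 h]]]] :
    exists dirs kap t0, has_cones dirs kap t0 [set x | sup_near e 0 x].
  by exists dirs, kap, t0; split=> // x _ Ax; apply: h => //; exact: Ae.
pose Q (V : set 'rV[R]_d) := exists dirs kap t0, has_cones dirs kap t0 V.
have := @compact_local _ _ Q (@compact_box R d e); apply.
- by exists [::], 1%N, 1; split.
- move=> V W VW [dirs [kap [t0 [k0 t00 h]]]]; exists dirs, kap, t0; split=> // x Vx.
  by apply: h; exact: VW.
- move=> V W [dirs [kap [t0 [k0 t00 h]]]] [dirs' [kap' [t0' [k0' t00' h']]]].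
  exists (dirs ++ dirs'), (maxn kap kap'), (Num.min t0 t0'); split.
  + by rewrite leq_max k0.
  + by rewrite lt_min t00.
  + move=> x [Vx|Wx] Ax.
      have [a ad ca] := h x Vx Ax; exists a; first by rewrite mem_cat ad.
      by apply: cone_at_le ca; rewrite ?leq_maxl// ge_min lexx.
    have [a ad ca] := h' x Wx Ax; exists a; first by rewrite mem_cat ad orbT.
    by apply: cone_at_le ca; rewrite ?leq_maxr// ge_min lexx orbT.
- move=> x0 _; have [Ax0|nAx0] := pselect (A x0).
    have /nbhs_sup_near[e1 e10 hA] : nbhs x0 A by exact: open_nbhs_nbhs.
    exists [set x | sup_near (e1 / 2) x0 x].
      by apply/nbhs_sup_near; exists (e1 / 2); rewrite ?divr_gt0.
    exists [:: 0], 1%N, (e1 / 2); split; rewrite ?divr_gt0// => x x0x Ax.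
    exists 0; rewrite ?mem_head// => t y /andP[t0 te] hy.
    apply: hA => i; have := x0x i; have := hy i; rewrite mulr1.
    rewrite !mxE mulr0z add0r opprD addrA => hyi hi.
    apply: le_trans (ler_normB _ _) _; rewrite [leRHS](splitr e1) lerD//.
    by rewrite normrM gtr0_norm// -[leRHS]mulr1; apply: ler_pM => //; exact: ltW.
  have [cx0|ncx0] := pselect (closure A x0); last first.
    have [B xB AB] : exists2 B, nbhs x0 B & A `&` B = set0.
      apply: contrapT => h; apply: ncx0 => B xB; apply/set0P/negP => /eqP AB.
      by apply: h; exists B.
    exists B => //; exists [::], 1%N, 1; split=> // x Bx Ax.
    by have : (A `&` B) x by []; rewrite AB.
  have [|S [i [phi [rho [QQ phiL rho0 hA]]]]] := lA x0.
    by split=> // ix0; apply: nAx0; exact: interior_subset ix0.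
  have [a [t0 [e1 [t00 e10 h]]]] := lipschitz_epigraph_cone QQ phiL rho0 hA.
  exists [set x | sup_near e1 x0 x]; first by apply/nbhs_sup_near; exists e1.
  exists [:: a], 1%N, t0; split=> // x x0x Ax.
  by exists a; rewrite ?mem_head//; exact: h.
Qed.

End cone.

(** * Lattice cells and balls inside the domain *)

Section good_cells.
Variables (R : realType) (d : nat) (A : set 'rV[R]_d).
Local Notation Zd := 'rV[int]_d.
Implicit Types (delta : R) (z w : Zd) (x y : 'rV[R]_d).

Definition corner delta z : 'rV[R]_d := delta *: int_vec R z.

Definition cube delta z : set 'rV[R]_d :=
  [set y | forall i, corner delta z 0 i <= y 0 i <= corner delta z 0 i + delta].

Definition cell_of delta x : Zd := \row_i Num.floor (x 0 i / delta).

Lemma cornerE delta z i : corner delta z 0 i = delta * (z 0 i)%:~R.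
Proof. by rewrite !mxE. Qed.

Lemma cell_ofP delta x i : 0 < delta ->
  corner delta (cell_of delta x) 0 i <= x 0 i < corner delta (cell_of delta x) 0 i + delta.
Proof.
move=> d0; rewrite cornerE mxE; have /andP[h1 h2] := floor_itv (x 0 i / delta).
move: h1 h2; rewrite ler_pdivlMr// ltr_pdivrMr// intrD => h1 h2.
by rewrite mulrC h1 (lt_le_trans h2)// mulrDl mul1r.
Qed.

Lemma cell_of_cube delta x : 0 < delta -> cube delta (cell_of delta x) x.
Proof. by move=> d0 i; have /andP[-> /ltW ->] := cell_ofP x i d0. Qed.

Lemma cell_of_near delta x y M : 0 < delta ->
  sup_near (M%:R * delta) x y -> near_cells M.+1 (cell_of delta x) (cell_of delta y).
Proof.
move=> d0 xy; apply/near_cellsP => i.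
have := cell_ofP x i d0; have := cell_ofP y i d0; rewrite !cornerE.
move: (cell_of delta x 0 i) (cell_of delta y 0 i) (xy i) => a b.
move: (x 0 i) (y 0 i) => u v; rewrite !ler_norml => h1 h2 h3.
have H1 : delta * a%:~R < delta * (b%:~R + M.+1%:R).
  rewrite mulrDr -natr1 mulrDr mulr1; lra.
have H2 : delta * b%:~R < delta * (a%:~R + M.+1%:R).
  rewrite mulrDr -natr1 mulrDr mulr1; lra.
rewrite !ltr_pM2l// in H1 H2.
have H1' : a < b + M.+1 by rewrite -(ltr_int R) intrD.
have H2' : b < a + M.+1 by rewrite -(ltr_int R) intrD.
lia.
Qed.

Lemma near_cells_sup_near delta x y M : 0 < delta ->
  near_cells M (cell_of delta x) (cell_of delta y) -> sup_near (M.+1%:R * delta) x y.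
Proof.
move=> d0 /near_cellsP h i; have := h i.
have := cell_ofP x i d0; have := cell_ofP y i d0; rewrite !cornerE.
move: (cell_of delta x 0 i) (cell_of delta y 0 i) => a b.
move: (x 0 i) (y 0 i) => u v h1 h2 h3.
have H1 : delta * a%:~R <= delta * (b%:~R + M%:R).
  rewrite ler_pM2l// -(intrD _ b M) ler_int; lia.
have H2 : delta * b%:~R <= delta * (a%:~R + M%:R).
  rewrite ler_pM2l// -(intrD _ a M) ler_int; lia.
rewrite ler_norml -natr1 mulrDl mul1r !(mulrDr delta) in H1 H2 *; lra.
Qed.

Definition good_cells delta (s : seq Zd) : Prop :=
  uniq s /\ forall z, (z \in s) <-> cube delta z `<=` A.

(** After [j] steps the cone has half-width [j * delta / kap]. A cell at offset [e] from its axis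
    stays within [|e i| + 1] sides of it, the extra side covering the position of [x] in its own
    cell and of the target point in its cell. *)
Lemma cone_cell delta x a kap t0 (j : nat) (e : Zd) : 0 < delta -> cone_at A a kap t0 x ->
  (0 < j)%N -> j%:R * delta <= t0 -> (forall i, (kap * (absz (e 0%R i)).+1 <= j)%N) ->
  cube delta (cell_of delta x + a *+ j + e) `<=` A.
Proof.
move=> d0 ca j0 jt he y hy.
have jd0 : 0 < j%:R * delta by rewrite mulr_gt0// ltr0n.
pose v : 'rV[R]_d := (j%:R * delta)^-1 *: (y - x) - int_vec R a.
have -> : y = x + (j%:R * delta) *: (int_vec R a + v).
  by rewrite /v addrCA subrr addr0 scalerA mulfV ?gt_eqF// scale1r addrCA subrr addr0.
apply: ca => [|i]; first by rewrite jd0.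
have -> : v 0 i = (j%:R * delta)^-1 * (y 0 i - x 0 i - j%:R * delta * (a 0 i)%:~R).
  by rewrite !mxE [RHS]mulrBr [in RHS]mulrA mulVf ?gt_eqF// mul1r.
rewrite normrM gtr0_norm ?invr_gt0// [leLHS]mulrC mulrCA ler_pdivrMl// mulr1.
have := hy i; have := cell_ofP x i d0; rewrite !cornerE.
have -> : (cell_of delta x + a *+ j + e) 0 i = cell_of delta x 0 i + a 0 i * j%:Z + e 0 i.
  by rewrite mxE [(cell_of _ _ + _) 0 i]mxE mulmxnE -mulr_natr natz.
rewrite !intrD intrM; move: (cell_of delta x 0 i) => c h1 h2.
have H : `|y 0 i - x 0 i - j%:R * delta * (a 0 i)%:~R| <= delta * (absz (e 0%R i)).+1%:R.
  have he1 : (e 0 i)%:~R <= (absz (e 0%R i))%:R :> R.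
    by rewrite -[leRHS]/((absz (e 0%R i))%:Z%:~R) ler_int; lia.
  have he2 : - (absz (e 0%R i))%:R <= (e 0 i)%:~R :> R.
    by rewrite -[in leLHS]/((absz (e 0%R i))%:Z%:~R) -mulrNz ler_int; lia.
  rewrite -(ler_pM2l d0) in he1; rewrite -(ler_pM2l d0) in he2.
  move: h1 h2; rewrite ler_norml -natr1.
  have -> : (j%:Z)%:~R = j%:R :> R by [].
  move: (c%:~R) ((absz (e 0%R i))%:R) ((e 0 i)%:~R) ((a 0 i)%:~R) (j%:R) he1 he2.
  move=> c' p q a' j' he1 he2 h1 h2; move: (y 0 i) (x 0 i) h1 h2 => u w h1 h2.
  have E1 : delta * (c' + a' * j' + q) = delta * c' + j' * delta * a' + delta * q by ring.
  rewrite E1 in h2; rewrite mulrDr mulr1; lra.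
apply: (@le_trans _ _ (kap%:R * (delta * (absz (e 0%R i)).+1%:R))).
  by rewrite ler_wpM2l.
by rewrite mulrCA mulrC ler_pM2r// -natrM ler_nat.
Qed.

(** Nearness is tested at the corner and a cube may stick out by [delta], hence the room [r + delta]
    asked for below. *)
Definition cells_near delta (s : seq Zd) x r : seq Zd :=
  [seq z <- s | `[<sup_near r x (corner delta z)>]].

Lemma mem_cells_near delta s x r z :
  reflect (z \in s /\ sup_near r x (corner delta z)) (z \in cells_near delta s x r).
Proof.
by rewrite mem_filter andbC; apply: (iffP andP) => -[h /asboolP].
Qed.

Lemma cells_near_uniq delta s x r : uniq s -> uniq (cells_near delta s x r).
Proof. exact: filter_uniq. Qed.

Lemma cube_sub_near delta z x r : 0 < delta ->
  (forall y, sup_near (r + delta) x y -> A y) -> sup_near r x (corner delta z) ->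
  cube delta z `<=` A.
Proof.
move=> d0 hA xz y hy; apply: hA; apply: (sup_near_trans xz) => i.
have /andP[h1 h2] := hy i; rewrite distrC ger0_norm ?subr_ge0//; lra.
Qed.

Section inner_ball.
Variables (delta : R) (s : seq Zd) (x : 'rV[R]_d) (r : R).
Hypothesis d0 : 0 < delta.
Hypothesis gs : good_cells delta s.
Hypothesis hA : forall y, sup_near (r + delta) x y -> A y.

Lemma cells_near_good z :
  (z \in cells_near delta s x r) = `[<sup_near r x (corner delta z)>].
Proof.
apply/mem_cells_near/asboolP => [[]//|xz]; split=> //.
by apply/(proj2 gs); exact: cube_sub_near xz.
Qed.

Lemma cells_near_convex : convex_cells (cells_near delta s x r).
Proof.
move=> z w y; rewrite !cells_near_good => /asboolP hz /asboolP hw zwy.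
apply/asboolP => i; have := hz i; have := hw i; have := zwy i; rewrite !cornerE.
move: (z 0 i) (w 0 i) (y 0 i) (x 0 i) => a b c u.
have dle (p q : int) : p <= q -> delta * p%:~R <= delta * q%:~R.
  by rewrite ler_pM2l// ler_int.
by rewrite !ler_norml => /orP[]/andP[/dle + /dle]; lra.
Qed.

Lemma cells_near_diam b : 2 * r < b.+1%:R * delta ->
  forall z w, z \in cells_near delta s x r -> w \in cells_near delta s x r ->
  near_cells b z w.
Proof.
move=> hb z w; rewrite !cells_near_good => /asboolP hz /asboolP hw.
apply/near_cellsP => i; have := hz i; have := hw i; rewrite !cornerE.
move: (z 0 i) (w 0 i) (x 0 i) => a c u; rewrite !ler_norml => h1 h2.
have H1 : delta * a%:~R < delta * (c%:~R + b.+1%:R) by rewrite mulrDr; lra.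
have H2 : delta * c%:~R < delta * (a%:~R + b.+1%:R) by rewrite mulrDr; lra.
rewrite !ltr_pM2l// in H1 H2.
have H1' : a < c + b.+1 by rewrite -(ltr_int R) intrD.
have H2' : c < a + b.+1 by rewrite -(ltr_int R) intrD.
lia.
Qed.

Lemma size_cells_near_ge m : (0 < m)%N -> m%:R * delta <= r ->
  (m ^ d <= size (cells_near delta s x r))%N.
Proof.
move=> m0 mr; rewrite -(size_intbox (cell_of delta x) m); apply: uniq_leq_size.
  exact: intbox_uniq.
move=> z; rewrite mem_intbox cells_near_good => /forallP h.
apply/asboolP => i; have := h i; have := cell_ofP x i d0; rewrite !cornerE.
have mr1 : delta <= m%:R * delta by rewrite ler_peMl ?(ltW d0) ?ler1n.
move: (z 0 i) (cell_of delta x 0 i) (x 0 i) => a c u h1 /andP[h2 h3].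
have H2 : delta * c%:~R <= delta * a%:~R by rewrite ler_pM2l// ler_int; lia.
have H3 : delta * a%:~R + delta <= delta * c%:~R + m%:R * delta.
  have : a + 1 <= c + m%:Z by lia.
  by rewrite -(ler_int R) !intrD -(ler_pM2l d0) !mulrDr mulr1 (mulrC delta m%:~R).
rewrite ler_norml; lra.
Qed.

End inner_ball.

Lemma truncn_ratio (t : R) : 1 <= t -> t / 2 <= (Num.truncn t)%:R.
Proof.
move=> t1; have t0 : 0 <= t by lra.
have /andP[_] := truncn_itv t0; rewrite -natr1.
have : (1 <= Num.truncn t)%N by rewrite truncn_gt0.
rewrite -(ler_nat R); lra.
Qed.

Section ball_control.
Variables (delta : R) (s : seq Zd) (U : Zd -> R) (y : 'rV[R]_d) (R1 : R).
Hypothesis d0 : 0 < delta.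
Hypothesis gs : good_cells delta s.
Hypothesis hA : forall u, sup_near (R1 + delta) y u -> A u.
Hypothesis dR : delta <= R1.

Let b := Num.truncn (2 * R1 / delta).

Let t0 : 0 <= 2 * R1 / delta.
Proof. by rewrite divr_ge0 ?mulr_ge0 ?ltW// (lt_le_trans d0 dR). Qed.

Let hb : 2 * R1 < b.+1%:R * delta.
Proof. by have /andP[_] := truncn_itv t0; rewrite ltr_pdivrMr. Qed.

Let hb2 : b%:R ^+ 2 <= 4 * R1 ^+ 2 * delta ^- 2 :> R.
Proof.
have /andP[h _] := truncn_itv t0.
have -> : 4 * R1 ^+ 2 * delta ^- 2 = (2 * R1 / delta) ^+ 2.
  by field; rewrite gt_eqF.
by rewrite lerXn2r ?nnegrE.
Qed.

(** Comparison of cell counts in two balls: [2 * b + 1 <= 5 R1 / delta] and [m >= r / (2 delta)],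
    whence the 10. *)
Let hb1 m (r : R) : delta <= r -> m = Num.truncn (r / delta) ->
  (2 * b + 1)%:R ^+ d <= (10 * R1 / r) ^+ d * (m ^ d)%:R.
Proof.
move=> dr ->; have r0 : 0 < r by exact: lt_le_trans dr.
rewrite natrX -exprMn lerXn2r ?nnegrE//.
  by rewrite !mulr_ge0 ?invr_ge0// ltW// (lt_le_trans d0 dR).
have /andP[h _] := truncn_itv t0.
have h1 : r / delta / 2 <= (Num.truncn (r / delta))%:R.
  by apply: truncn_ratio; rewrite ler_pdivlMr// mul1r.
apply: (@le_trans _ _ (10 * R1 / r * (r / delta / 2))); last first.
  by rewrite ler_wpM2l// !mulr_ge0 ?invr_ge0 ?ltW// (lt_le_trans d0 dR).
have -> : 10 * R1 / r * (r / delta / 2) = 2 * (2 * R1 / delta) + R1 / delta.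
  by field; rewrite !gt_eqF.
have : 1 <= R1 / delta by rewrite ler_pdivlMr// mul1r.
rewrite natrD natrM; move: h; rewrite -/b; lra.
Qed.

(** With the energy scaled by [delta ^- 2] the constants depend on [d], [R1] and [r] but not on
    [delta], so the step can be iterated along a fixed chain of balls. *)
Lemma ball_control x r : delta <= r -> (forall u, sup_near r x u -> sup_near R1 y u) ->
  \sum_(z <- cells_near delta s y R1) U z ^+ 2 <=
  2 * (10 * R1 / r) ^+ d * (\sum_(z <- cells_near delta s x r) U z ^+ 2
     + 4 * R1 ^+ 2 * (delta ^- 2 * energy 1 s U)).
Proof.
move=> dr xy; pose m := Num.truncn (r / delta).
have r0 : 0 < r by exact: lt_le_trans dr.
have R10 : 0 < R1 by exact: lt_le_trans dR.
have m0 : (0 < m)%N by rewrite truncn_gt0 ler_pdivlMr// mul1r.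
have mr : m%:R * delta <= r.
  have /andP[+ _] := truncn_itv (divr_ge0 (ltW r0) (ltW d0)).
  by rewrite ler_pdivlMr.
have cvx := cells_near_convex d0 gs hA.
have diam := cells_near_diam d0 gs hA hb.
have uN v e := cells_near_uniq delta v e (proj1 gs).
(* Contracting [u] towards [x] by the ratio [r / (r + delta)] lands in the small ball, hence in the
   large one, and [u] is within [delta] of the contracted point. *)
have xA u : sup_near (r + delta) x u -> A u.
  move=> hu; apply: hA.
  pose u' : 'rV[R]_d := \row_i (x 0 i + (u 0 i - x 0 i) * (r / (r + delta))).
  have k0 : 0 < r + delta by rewrite addr_gt0.
  have hu' : sup_near r x u'.
    move=> i; rewrite mxE opprD addrA subrr sub0r normrN normrM.
    rewrite (@ger0_norm _ (r / _)) ?divr_ge0 ?(ltW r0) ?(ltW k0)//.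
    rewrite -ler_pdivlMr ?divr_gt0// distrC.
    have -> : r / (r / (r + delta)) = r + delta by field; rewrite !gt_eqF.
    exact: hu.
  apply: (sup_near_trans (xy _ hu')) => i; rewrite mxE.
  have -> : x 0 i + (u 0 i - x 0 i) * (r / (r + delta)) - u 0 i =
     - ((u 0 i - x 0 i) * (delta / (r + delta))) by field; rewrite gt_eqF.
  rewrite normrN normrM (@ger0_norm _ (delta / _)) ?divr_ge0 ?(ltW d0) ?(ltW k0)//.
  rewrite -ler_pdivlMr ?divr_gt0// distrC.
  have -> : delta / (delta / (r + delta)) = r + delta by field; rewrite !gt_eqF.
  exact: hu.
have sub : {subset cells_near delta s x r <= cells_near delta s y R1}.
  by move=> z /mem_cells_near[zs /xy h]; apply/mem_cells_near.
have sz := size_cells_near_ge d0 gs xA m0 mr.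
have := sum_sqr_convex_cells U (uN _ _) cvx diam (uN _ _) sub.
have szy := size_near_cells (uN _ _) diam.
have hE : energy 1 (cells_near delta s y R1) U <= energy 1 s U.
  by apply: energy_subset => // z /mem_cells_near[].
set X := \sum_(z <- cells_near delta s y R1) _; set Y := \sum_(z <- cells_near delta s x r) _.
set E := energy _ _ _ in hE *; set E' := energy 1 s U in hE *.
have Y0 : 0 <= Y by apply: sumr_ge0 => z _; exact: sqr_ge0.
have X0 : 0 <= X by apply: sumr_ge0 => z _; exact: sqr_ge0.
have E0 : 0 <= E by exact: energy_ge0.
set N := size _ in sz *; set N' := size _ in szy *.
move=> H.
have h1 := hb1 dr erefl; rewrite -/m in h1.
set P := (2 * b + 1)%:R ^+ d in h1 H *.
have szy' : N'%:R <= P by rewrite /P -natrX ler_nat.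
set K := (10 * R1 / r) ^+ d in h1 *.
have md0 : 0 < (m ^ d)%:R :> R by rewrite ltr0n expn_gt0 m0.
rewrite -(ler_pM2l md0).
apply: (@le_trans _ _ (N%:R * X)); first by rewrite ler_wpM2r// ler_nat.
apply: (le_trans H).
apply: (@le_trans _ _ (2 * P * (Y + b%:R ^+ 2 * E))).
  have -> : 2 * P * (Y + b%:R ^+ 2 * E) = 2 * P * Y + 2 * (P * b%:R ^+ 2 * E) by ring.
  by rewrite lerD2r ler_wpM2r// ler_pM2l.
apply: (@le_trans _ _ (2 * (K * (m ^ d)%:R) * (Y + 4 * R1 ^+ 2 * (delta ^- 2 * E')))).
  have P0 : 0 <= P by rewrite /P exprn_ge0.
  apply: ler_pM; first by rewrite mulr_ge0.
  - by rewrite addr_ge0 ?mulr_ge0 ?exprn_ge0.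
  - by rewrite ler_pM2l.
  - by rewrite lerD2l mulrA; apply: ler_pM => //; rewrite exprn_ge0.
by rewrite le_eqVlt; apply/orP; left; apply/eqP; ring.
Qed.

Lemma ball_poincare : \sum_(z <- cells_near delta s y R1) U z = 0 ->
  \sum_(z <- cells_near delta s y R1) U z ^+ 2 <=
  10 ^+ d * (4 * R1 ^+ 2) * (delta ^- 2 * energy 1 s U).
Proof.
move=> U0; pose m := Num.truncn (R1 / delta).
have R10 : 0 < R1 by exact: lt_le_trans dR.
have m0 : (0 < m)%N by rewrite truncn_gt0 ler_pdivlMr// mul1r.
have mr : m%:R * delta <= R1.
  have /andP[+ _] := truncn_itv (divr_ge0 (ltW R10) (ltW d0)).
  by rewrite ler_pdivlMr.
have cvx := cells_near_convex d0 gs hA.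
have diam := cells_near_diam d0 gs hA hb.
have uN v e := cells_near_uniq delta v e (proj1 gs).
have sz := size_cells_near_ge d0 gs hA m0 mr.
have := poincare_convex_cells (uN _ _) cvx diam U0.
have hE : energy 1 (cells_near delta s y R1) U <= energy 1 s U.
  by apply: energy_subset => // z /mem_cells_near[].
set X := \sum_(z <- cells_near delta s y R1) _ ^+ 2.
set E := energy _ _ _ in hE *; set E' := energy 1 s U in hE *.
have X0 : 0 <= X by apply: sumr_ge0 => z _; exact: sqr_ge0.
have E0 : 0 <= E by exact: energy_ge0.
set N := size _ in sz *.
move=> H; have h1 := hb1 dR erefl; rewrite -/m mulfK ?gt_eqF// in h1.
have md0 : 0 < (m ^ d)%:R :> R by rewrite ltr0n expn_gt0 m0.
rewrite -(ler_pM2l md0).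
apply: (@le_trans _ _ (2 * N%:R * X)).
  rewrite ler_wpM2r//; apply: (@le_trans _ _ N%:R); first by rewrite ler_nat.
  by rewrite ler_peMl// ler1n.
apply: (le_trans H).
have -> : (m ^ d)%:R * (10 ^+ d * (4 * R1 ^+ 2) * (delta ^- 2 * E')) =
  (10 ^+ d * (m ^ d)%:R) * ((4 * R1 ^+ 2 * delta ^- 2) * E').
  by move: (10 ^+ d) => *; ring.
rewrite -mulrA; apply: ler_pM => //; first by rewrite mulr_ge0.
by apply: ler_pM.
Qed.

End ball_control.

End good_cells.

(** * A Poincare inequality on the whole domain by chaining balls *)

Section connectivity.
Variables (R : realType) (d : nat) (A : set 'rV[R]_d).
Local Notation Zd := 'rV[int]_d.
Hypothesis oA : open A.
Hypothesis cA : connected A.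
Hypothesis bA : bounded_set A.
Variable x0 : 'rV[R]_d.
Hypothesis Ax0 : A x0.

Lemma open_sup_near x : A x -> exists2 rho, 0 < rho & forall u, sup_near rho x u -> A u.
Proof.
by move=> Ax; apply/(nbhs_sup_near x A); exact: open_nbhs_nbhs.
Qed.

Section base.
Variable r0 : R.

(** The three constants come before [delta], [s] and [U]: the estimate is uniform in the lattice. *)
Definition linked_to_base (r C delta0 : R) (x : 'rV[R]_d) : Prop :=
  [/\ 0 < r, 0 <= C, 0 < delta0 & forall delta (s : seq Zd) (U : Zd -> R),
    0 < delta <= delta0 -> good_cells A delta s ->
    \sum_(z <- cells_near delta s x0 r0) U z = 0 ->
    \sum_(z <- cells_near delta s x r) U z ^+ 2 <= C * (delta ^- 2 * energy 1 s U)].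

(* In the connected set [A] the linked points are open and closed, by
   [linked_step], and the base point is linked, so that every point is. *)
Definition linked x := exists r C delta0, linked_to_base r C delta0 x.

(** The ball of radius [2 * rho] around [y] contains small balls around both points: [ball_control]
    spreads the bound from the one at [x], and restriction gives it at [x']. As [delta <= rho], the
    radius [4 * rho] leaves enough room. *)
Lemma linked_step rho y x x' : 0 < rho -> (forall u, sup_near (4 * rho) y u -> A u) ->
  sup_near rho y x -> sup_near rho y x' -> linked x -> linked x'.
Proof.
move=> rho0 hA yx yx' [r [C [delta1 [r_gt0 C0 d10 h]]]].
pose r' := Num.min r rho.
have r'0 : 0 < r' by rewrite lt_min r_gt0.
have r'r : r' <= r by rewrite ge_min lexx.
have r'rho : r' <= rho by rewrite ge_min lexx orbT.
pose K : R := 2 * (10 * (2 * rho) / r') ^+ d.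
have K0 : 0 <= K by rewrite mulr_ge0// exprn_ge0// divr_ge0 ?mulr_ge0// ltW.
exists rho, (K * (C + 4 * (2 * rho) ^+ 2)), (Num.min delta1 r'); split=> //.
- by rewrite mulr_ge0// addr_ge0// mulr_ge0// exprn_ge0// mulr_ge0// ltW.
- by rewrite lt_min d10.
move=> delta s U /andP[d0]; rewrite le_min => /andP[dd1 dr'] gs U0.
have hA2 u : sup_near (2 * rho + delta) y u -> A u.
  by move=> yu; apply: hA; apply: sup_near_le yu; lra.
have dR : delta <= 2 * rho by lra.
have sub u : sup_near r' x u -> sup_near (2 * rho) y u.
  by move=> xu; apply: sup_near_le (sup_near_trans yx xu); lra.
have us := proj1 gs.
apply: (@le_trans _ _ (\sum_(z <- cells_near delta s y (2 * rho)) U z ^+ 2)).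
  apply: sum_le_subset; [by move=> z; exact: sqr_ge0|exact: cells_near_uniq|].
  move=> z /mem_cells_near[zs xz]; apply/mem_cells_near; split=> //.
  by apply: sup_near_le (sup_near_trans yx' xz); lra.
apply: le_trans (ball_control U d0 gs hA2 dR dr' sub) _.
rewrite -/K -[leRHS]mulrA; apply: ler_wpM2l => //; rewrite [leRHS]mulrDl lerD2r.
apply: le_trans (h delta s U _ gs U0); last by rewrite d0 dd1.
apply: sum_le_subset; [by move=> z; exact: sqr_ge0|exact: cells_near_uniq|].
move=> z /mem_cells_near[zs xz]; apply/mem_cells_near; split=> //.
exact: sup_near_le xz.
Qed.

Hypothesis r00 : 0 < r0.
Hypothesis Ar0 : forall u, sup_near (2 * r0) x0 u -> A u.

Lemma linked_base : linked x0.
Proof.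
exists r0, (10 ^+ d * (4 * r0 ^+ 2)), r0; split=> //.
  by rewrite !mulr_ge0 ?exprn_ge0// ltW.
move=> delta s U /andP[d0 dr] gs U0; apply: (@ball_poincare R d A) => // u hu.
by apply: Ar0; apply: sup_near_le hu; lra.
Qed.

Lemma linkedP x : A x -> linked x.
Proof.
have near y : A y -> exists2 rho, 0 < rho &
    forall x x', sup_near rho y x -> sup_near rho y x' -> linked x -> linked x'.
  move=> /open_sup_near[e e0 hA]; exists (e / 4); first by rewrite divr_gt0.
  move=> u u'; apply: linked_step; rewrite ?divr_gt0// => v hv; apply: hA.
  by apply: sup_near_le hv; lra.
have refl e (y : 'rV[R]_d) : 0 < e -> sup_near e y y.
  by move=> e0 i; rewrite subrr normr0 ltW.
pose L := [set x | A x /\ linked x].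
suff LA : L = A by move=> Ax; have [] : L x by rewrite LA.
apply: cA.
- by exists x0; split=> //; exact: linked_base.
- exists (interior L); first exact: open_interior.
  apply/seteqP; split=> [y Ly|y [_ /interior_subset//]].
  split; first by case: Ly.
  have [Ay ly] := Ly; have [e e0 he] := near y Ay.
  have [e' e'0 he'] := open_sup_near Ay.
  apply/(nbhs_sup_near y L); exists (Num.min e e'); first by rewrite lt_min e0.
  move=> u hu; split.
    by apply: he'; apply: sup_near_le hu; rewrite ge_min lexx orbT.
  apply: (he y u) => //; first exact: refl.
  by apply: sup_near_le hu; rewrite ge_min lexx.
- exists (closure L); first exact: closed_closure.
  apply/seteqP; split=> [y Ly|y [Ay cy]].
    by split; [case: Ly|exact: subset_closure].
  split=> //; have [e e0 he] := near y Ay.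
  have [|u [[_ lu] yu]] := cy [set u | sup_near e y u].
    by apply/(nbhs_sup_near y); exists e.
  by apply: (he u y) => //; exact: refl.
Qed.

(** The radius and constant of [linked] vary with the point, without uniformity near the boundary.
    Keeping the cells of [t] at depth [rho] lets compactness select finitely many of them. *)
Lemma connected_poincare rho : 0 < rho -> exists C delta0, [/\ 0 <= C, 0 < delta0 &
  forall delta (s t : seq Zd) (U : Zd -> R), 0 < delta <= delta0 -> good_cells A delta s ->
    \sum_(z <- cells_near delta s x0 r0) U z = 0 ->
    uniq t -> (forall w, w \in t -> w \in s) ->
    (forall w (u : 'rV[R]_d), w \in t -> sup_near rho (corner delta w) u -> A u) ->
    \sum_(w <- t) U w ^+ 2 <= C * (delta ^- 2 * energy 1 s U)].
Proof.
move=> rho0; have [e e0 Ae] := bounded_sup_near bA.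
pose Q (V : set 'rV[R]_d) := exists C delta0, [/\ 0 <= C, 0 < delta0 &
  forall delta (s t : seq Zd) (U : Zd -> R), 0 < delta <= delta0 -> good_cells A delta s ->
    \sum_(z <- cells_near delta s x0 r0) U z = 0 ->
    uniq t -> (forall w, w \in t -> w \in s /\ V (corner delta w)) ->
    (forall w (u : 'rV[R]_d), w \in t -> sup_near rho (corner delta w) u -> A u) ->
    \sum_(w <- t) U w ^+ 2 <= C * (delta ^- 2 * energy 1 s U)].
have [C [delta0 [C0 d00 h]]] : Q [set x | sup_near e 0 x]; last first.
  exists C, delta0; split=> // delta s t U hd gs U0 ut ts ht.
  apply: h => // w wt; split; first exact: ts.
  by apply: Ae; apply: ht wt _ => i; rewrite subrr normr0 ltW.
apply: (@compact_local _ _ Q (@compact_box R d e)).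
- exists 0, 1; split=> // delta s t U _ _ _ _ ts _.
  by case: t ts => [|w t] ts; [rewrite big_nil mul0r|have [] := ts w (mem_head _ _)].
- move=> V W VW [C [delta0 [C0 d00 h]]]; exists C, delta0; split=> //.
  move=> delta s t U hd gs U0 ut ts ht; apply: h => // w /ts[ws Vw]; split=> //.
  exact: VW.
- move=> V W [C [delta0 [C0 d00 h]]] [C' [delta0' [C0' d00' h']]].
  exists (C + C'), (Num.min delta0 delta0'); split; first exact: addr_ge0.
    by rewrite lt_min d00.
  move=> delta s t U /andP[d0]; rewrite le_min => /andP[dd dd'] gs U0 ut ts ht.
  rewrite (bigID (fun w => `[< V (corner delta w) >])) /= mulrDl; apply: lerD.
    rewrite -big_filter; apply: h => //; first by rewrite d0.
    - exact: filter_uniq.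
    - by move=> w; rewrite mem_filter => /andP[/asboolP Vw /ts[]].
    - by move=> w u; rewrite mem_filter => /andP[_]; exact: ht.
  rewrite -big_filter; apply: h' => //; first by rewrite d0.
  - exact: filter_uniq.
  - by move=> w; rewrite mem_filter => /andP[/asboolP nVw /ts[ws [/nVw|]]].
  - by move=> w u; rewrite mem_filter => /andP[_]; exact: ht.
- move=> x _; have [Ax|nAx] := pselect (A x); last first.
    (* A corner this close to a point outside [A] contradicts the depth [rho], so [t] is empty. *)
    exists [set u | sup_near rho x u]; first by apply/(nbhs_sup_near x); exists rho.
    exists 0, 1; split=> // delta s t U _ _ _ _ ts ht.
    case: t ts ht => [|w t] ts ht; first by rewrite big_nil mul0r.
    exfalso; apply: nAx; apply: (ht w) (mem_head _ _) _; apply: sup_near_sym.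
    by have [] := ts w (mem_head _ _).
  have [r [C [delta0 [r_gt0 C0 d00 h]]]] := linkedP Ax.
  exists [set u | sup_near r x u]; first by apply/(nbhs_sup_near x); exists r.
  exists C, delta0; split=> // delta s t U hd gs U0 ut ts ht.
  apply: le_trans (h delta s U hd gs U0); apply: sum_le_subset => //.
    by move=> z; exact: sqr_ge0.
  by move=> w /ts[ws wx]; apply/mem_cells_near.
Qed.

End base.
End connectivity.

(** * Tent functions and their Dirichlet energy *)

Section tents.
Variables (R : realType) (d : nat).
Local Notation Zd := 'rV[int]_d.
Implicit Types (c z w : Zd).

Definition sup_dist z w : nat := \max_(i < d) absz (z 0%R i - w 0%R i)%R.

Lemma sup_dist_le z w m :
  (sup_dist z w <= m)%N = [forall i, (absz (z 0%R i - w 0%R i)%R <= m)%N].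
Proof.
by apply/bigmax_leqP/forallP => [h i|h i _]; exact: h.
Qed.

Lemma le_sup_dist z w i : (absz (z 0%R i - w 0%R i)%R <= sup_dist z w)%N.
Proof. by have := leqnn (sup_dist z w); rewrite {1}sup_dist_le => /forallP. Qed.

(** The truncated subtraction is a positive part. The peak sits at the centre of the coarse box [c]
    of side [2 * h], which contains the support. *)
Definition tent (h : nat) c z : nat := (h - sup_dist z (c *+ (2 * h) + const_mx h%:Z))%N.

Lemma tent_near h c z w M : near_cells M z w -> (tent h c z <= tent h c w + M)%N.
Proof.
move=> /near_cellsP zw; set ctr : Zd := c *+ (2 * h) + const_mx h%:Z.
have : (sup_dist w ctr <= sup_dist z ctr + M)%N.
  rewrite sup_dist_le; apply/forallP => i; have := zw i.
  have := le_sup_dist z ctr i.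
  move: (sup_dist _ _) (z 0 i) (w 0 i) (ctr 0 i) => *; lia.
rewrite /tent -/ctr; lia.
Qed.

Lemma tent_support h c z : (0 < h)%N -> (0 < tent h c z)%N -> coarse (2 * h) z = c.
Proof.
move=> h0; rewrite subn_gt0 => hz; apply/eqP; rewrite -mem_coarse_box ?muln_gt0//.
rewrite mem_intbox; apply/forallP => i.
have : (absz (z 0%R i - (c *+ (2 * h) + const_mx h%:Z) 0%R i)%R < h)%N.
  exact: leq_ltn_trans (le_sup_dist _ _ _) hz.
rewrite mxE [const_mx _ _ _]mxE; move: (z 0 i) ((c *+ (2 * h)) 0 i) => *; lia.
Qed.

Lemma tent_center h c z : z \in intbox (c *+ (2 * h) + const_mx h%:Z) (uphalf h) ->
  (uphalf h <= tent h c z)%N.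
Proof.
rewrite mem_intbox => /forallP hz; rewrite /tent.
case: (posnP h) => [->//|h0].
have : (sup_dist z (c *+ (2 * h) + const_mx h%:Z) <= (uphalf h).-1)%N.
  rewrite sup_dist_le; apply/forallP => i; have := hz i.
  move: (z 0 i) ((c *+ (2 * h) + const_mx h%:Z) 0 i) => *; lia.
have : (0 < uphalf h)%N by lia.
move: (sup_dist _ _) => *; lia.
Qed.

Lemma center_coarse_box h c z : (0 < h)%N ->
  z \in intbox (c *+ (2 * h) + const_mx h%:Z) (uphalf h) -> z \in coarse_box (2 * h) c.
Proof.
move=> h0 /tent_center; rewrite mem_coarse_box ?muln_gt0// => ht.
by apply/eqP; apply: tent_support => //; apply: leq_trans ht; lia.
Qed.

End tents.

(** At most two terms are nonzero. For an edge of the graph these are the tents living at its two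
    ends, which gives a factor 2 in place of the number of tents. *)
Lemma sqr_sum_le2 (R : realType) (I : finType) (t : I -> R) (P Q : pred I) :
  (#|P| <= 1)%N -> (#|Q| <= 1)%N -> (forall k, t k != 0 -> P k || Q k) ->
  (\sum_k t k) ^+ 2 <= 2 * \sum_k t k ^+ 2.
Proof.
move=> P1 Q1 tPQ.
pose s := [seq k <- index_enum I | t k != 0].
have sE (F : I -> R) : (forall k, t k = 0 -> F k = 0) -> \sum_k F k = \sum_(k <- s) F k.
  move=> F0; rewrite big_filter [RHS]big_mkcond; apply: eq_bigr => k _.
  by case: eqP => // /F0.
rewrite (sE t)// (sE (fun k => t k ^+ 2)); last by move=> k ->; rewrite expr0n.
apply: le_trans (sqr_sum_le _ _) _; rewrite ler_wpM2r//.
  by apply: sumr_ge0 => k _; exact: sqr_ge0.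
rewrite ler_nat; apply: (@leq_trans (count (predU P Q) (index_enum I))).
  rewrite size_filter; apply: sub_count => k /tPQ //.
have cE (S : pred I) : count S (index_enum I) = #|S| by rewrite -sum1_count sum1_card.
have := count_predUI P Q (index_enum I); rewrite !(cE P) (cE Q); lia.
Qed.

Section upper_bound.
Variables (R : realType) (d n : nat).
Local Notation Zd := 'rV[int]_d.
Variables (cell : 'I_n -> Zd) (W : 'I_n -> 'I_n -> R) (s : seq Zd).
Variables (Kmin Kmax be : R) (M h l : nat) (c : 'I_l -> Zd).
Hypothesis WC : forall i j, W i j = W j i.
Hypothesis W0 : forall i j, 0 <= W i j.
Hypothesis be0 : 0 <= be.
Hypothesis Wbe : forall i, \sum_j W i j <= be.
Hypothesis WM : forall i j, W i j != 0 -> near_cells M (cell i) (cell j).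
Hypothesis Kmin0 : 0 < Kmin.
Hypothesis hmin : forall z, z \in s -> Kmin <= (size (points cell z))%:R.
Hypothesis hmax : forall z, (size (points cell z))%:R <= Kmax.
Hypothesis h0 : (0 < h)%N.
Hypothesis c_inj : injective c.
Hypothesis cs : forall k z, z \in coarse_box (2 * h) (c k) -> z \in s.

Definition tent_mx : 'M[R]_(l, n) := \matrix_(k, i) (tent h (c k) (cell i))%:R.

Let phi k i : R := (tent h (c k) (cell i))%:R.

Let phi_support k i : phi k i != 0 -> coarse (2 * h) (cell i) = c k.
Proof. by rewrite pnatr_eq0 -lt0n; exact: tent_support. Qed.

Let tent_mx_rowE (y : 'rV[R]_l) i : (y *m tent_mx) 0 i = \sum_k y 0 k * phi k i.
Proof. by rewrite mxE; apply: eq_bigr => k _; rewrite mxE. Qed.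

Let card_support i : (#|[pred k | phi k i != 0%R]| <= 1)%N.
Proof.
apply/card_le1_eqP => k k'; rewrite !inE => /phi_support ki /phi_support k'i.
by apply: c_inj; rewrite -ki.
Qed.

(** Disjoint supports make the tents orthogonal. Each is at least [uphalf h] on [(uphalf h) ^ d]
    cells with at least [Kmin] points each, whence the exponent [d + 2]. *)
Lemma tent_norm_ge (y : 'rV[R]_l) :
  (\sum_k y 0 k ^+ 2) * (Kmin * (uphalf h)%:R ^+ d.+2) <=
  \sum_i (y *m tent_mx) 0 i ^+ 2.
Proof.
have -> : \sum_i (y *m tent_mx) 0 i ^+ 2 = \sum_k y 0 k ^+ 2 * \sum_i phi k i ^+ 2.
  under [RHS]eq_bigr do rewrite mulr_sumr.
  rewrite exchange_big; apply: eq_bigr => i _ /=; rewrite tent_mx_rowE.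
  have [/existsP[k ki]|/existsPn nk] := boolP [exists k, phi k i != 0].
    have k'0 k' : k' != k -> phi k' i = 0.
      move=> k'k; apply/eqP; apply: contraNT k'k => k'i.
      by have /card_le1_eqP/(_ k k') -> := card_support i; rewrite ?inE.
    rewrite (bigD1 k)//= big1 ?addr0 => [|k' /k'0 ->]; last by rewrite mulr0.
    rewrite (bigD1 k)//= big1 ?addr0 => [|k' /k'0 ->]; last by rewrite expr0n mulr0.
    by rewrite exprMn.
  have k0 k : phi k i = 0 by apply/eqP; have := nk k; rewrite negbK.
  by rewrite !big1 ?expr0n// => k _; rewrite k0 ?expr0n mulr0.
rewrite mulr_suml; apply: ler_sum => k _; rewrite ler_wpM2l ?sqr_ge0//.
pose S := intbox (c k *+ (2 * h) + const_mx h%:Z) (uphalf h).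
pose F z (_ : 'I_n) : R := ((tent h (c k) z)%:R) ^+ 2.
apply: (@le_trans _ _ (\sum_(z <- S) \sum_(i | cell i == z) phi k i ^+ 2)); last first.
  by apply: sum_fibers_le => [i|]; [exact: sqr_ge0|exact: intbox_uniq].
apply: (@le_trans _ _ (\sum_(z <- S) Kmin * (uphalf h)%:R ^+ 2)).
  rewrite sumr_const_seq size_intbox natrX -[d.+2]addn2 exprD.
  by rewrite le_eqVlt; apply/orP; left; apply/eqP; move: (_ ^+ d) (_ ^+ 2) => *; ring.
rewrite big_seq [leRHS]big_seq; apply: ler_sum => z zS.
have zs : z \in s by apply: (cs (k := k)); exact: center_coarse_box.
apply: (@le_trans _ _ (\sum_(i | cell i == z) (uphalf h)%:R ^+ 2)).
  rewrite -big_filter sumr_const_seq ler_wpM2r ?exprn_ge0//; exact: hmin.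
apply: ler_sum => i /eqP iz; rewrite /phi iz lerXn2r ?nnegrE// ler_nat.
exact: tent_center.
Qed.

Lemma row_free_tent_mx : row_free tent_mx.
Proof.
rewrite -kermx_eq0; apply/eqP/row_matrixP => j; rewrite row0.
set y := row j _; have yB : y *m tent_mx = 0 by rewrite -row_mul mulmx_ker row0.
have := tent_norm_ge y; rewrite yB [X in _ <= X]big1 => [|i _]; last by rewrite mxE expr0n.
have k0 : 0 < Kmin * (uphalf h)%:R ^+ d.+2.
  by rewrite mulr_gt0// exprn_gt0// ltr0n; lia.
rewrite pmulr_lle0// => hy.
have /eqP : \sum_k y 0 k ^+ 2 = 0.
  by apply/eqP; rewrite eq_le hy; apply: sumr_ge0 => k _; exact: sqr_ge0.
rewrite psumr_eq0 => [/allP h1|k _]; last exact: sqr_ge0.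
apply/rowP => k; have := h1 k (mem_index_enum k); rewrite sqrf_eq0 mxE => /eqP ->.
by rewrite mxE.
Qed.

(** Along an edge a tent varies by at most [M]. The weight of the edges meeting its support is at
    most [be] times the number of points there, itself at most [Kmax * (2 * h) ^ d]. The 4 is 2 for
    two tents per edge times 2 for the two ends. *)
Lemma dirichlet_tent_le (y : 'rV[R]_l) :
  dirichlet W (fun i => (y *m tent_mx) 0 i) <=
  4 * M%:R ^+ 2 * be * Kmax * (2 * h)%:R ^+ d * \sum_k y 0 k ^+ 2.
Proof.
pose D k i j := W i j * (phi k i - phi k j) ^+ 2.
have h1 : dirichlet W (fun i => (y *m tent_mx) 0 i) <=
    2 * \sum_k y 0 k ^+ 2 * \sum_i \sum_j D k i j.
  have -> : 2 * \sum_k y 0 k ^+ 2 * \sum_i \sum_j D k i j =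
      \sum_i \sum_j W i j * (2 * \sum_k (y 0 k * (phi k i - phi k j)) ^+ 2).
    rewrite mulr_sumr; under eq_bigr do rewrite !mulr_sumr.
    rewrite exchange_big; apply: eq_bigr => i _ /=.
    under eq_bigr do rewrite !mulr_sumr.
    rewrite exchange_big; apply: eq_bigr => j _ /=.
    rewrite !mulr_sumr; apply: eq_bigr => k _; rewrite /D exprMn.
    by move: (W i j) (phi k i) (phi k j) (y 0 k) => *; ring.
  apply: ler_sum => i _; apply: ler_sum => j _; rewrite ler_wpM2l//.
  rewrite !tent_mx_rowE -sumrB; under eq_bigr do rewrite -mulrBr.
  apply: (sqr_sum_le2 (card_support i) (card_support j)) => k /=.
  rewrite -negb_and; apply: contra => /andP[/eqP -> /eqP ->].
  by rewrite subrr mulr0.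
have h2 k : \sum_i \sum_j D k i j <= 2 * M%:R ^+ 2 * be * Kmax * (2 * h)%:R ^+ d.
  pose Z i : R := if coarse (2 * h) (cell i) == c k then 1 else 0.
  have Z0 i : 0 <= Z i by rewrite /Z; case: ifP.
  have D1 i j : D k i j <= M%:R ^+ 2 * (Z i * W i j + Z j * W i j).
    have rhs0 : 0 <= M%:R ^+ 2 * (Z i * W i j + Z j * W i j).
      by rewrite mulr_ge0 ?exprn_ge0// addr_ge0// mulr_ge0.
    have [W_0|Wij] := eqVneq (W i j) 0; first by rewrite /D {1}W_0 mul0r.
    have nij := WM Wij; have Wji := Wij; rewrite WC in Wji; have nji := WM Wji.
    have dM : (phi k i - phi k j) ^+ 2 <= M%:R ^+ 2.
      have t1 := tent_near h (c k) nij; have t2 := tent_near h (c k) nji.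
      rewrite -(ler_nat R) natrD in t1; rewrite -(ler_nat R) natrD in t2.
      rewrite -[leLHS]real_normK ?num_real// lerXn2r ?nnegrE//.
      by rewrite /phi ler_norml; lra.
    have [i0|i0] := eqVneq (phi k i) 0; last first.
      have Zi : Z i = 1 by rewrite /Z (phi_support i0) eqxx.
      rewrite /D [leLHS]mulrC; apply: (@le_trans _ _ (M%:R ^+ 2 * W i j)).
        by rewrite ler_wpM2r.
      by rewrite ler_wpM2l ?exprn_ge0// Zi mul1r lerDl mulr_ge0.
    have [j0|j0] := eqVneq (phi k j) 0; last first.
      have Zj : Z j = 1 by rewrite /Z (phi_support j0) eqxx.
      rewrite /D [leLHS]mulrC; apply: (@le_trans _ _ (M%:R ^+ 2 * W i j)).
        by rewrite ler_wpM2r.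
      by rewrite ler_wpM2l ?exprn_ge0// Zj mul1r lerDr mulr_ge0.
    by rewrite /D i0 j0 subrr expr0n mulr0.
  apply: (@le_trans _ _ (\sum_i \sum_j M%:R ^+ 2 * (Z i * W i j + Z j * W i j))).
    by apply: ler_sum => i _; apply: ler_sum => j _.
  have -> : \sum_i \sum_j M%:R ^+ 2 * (Z i * W i j + Z j * W i j) =
      2 * M%:R ^+ 2 * \sum_i Z i * \sum_j W i j.
    under eq_bigr do rewrite -mulr_sumr big_split /=.
    rewrite -mulr_sumr big_split /= [X in _ * (_ + X)]exchange_big /=.
    under [X in _ * (X + _)]eq_bigr do rewrite -mulr_sumr.
    have -> : \sum_j \sum_i Z j * W i j = \sum_i Z i * \sum_j W i j.
      apply: eq_bigr => i _; rewrite mulr_sumr; apply: eq_bigr => j _.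
      by rewrite WC.
    ring.
  have Zcount : \sum_i Z i <= Kmax * (2 * h)%:R ^+ d.
    have ut := intbox_uniq (c k *+ (2 * h)) (2 * h).
    rewrite -natrX -(size_intbox (c k *+ (2 * h)) (2 * h)) mulrC -sumr_const_seq.
    apply: (@le_trans _ _ (\sum_(z <- intbox (c k *+ (2 * h)) (2 * h)) (size (points cell z))%:R)).
      apply: (@le_trans _ _ (\sum_(z <- intbox (c k *+ (2 * h)) (2 * h)) \sum_(i | cell i == z) Z i)).
        rewrite (exchange_big_dep predT)//=; apply: ler_sum => i _.
        rewrite /Z; case: ifPn => [/eqP ci|_]; last first.
          by apply: sumr_ge0.
        rewrite (big_rem (cell i))//=; last by rewrite -/(coarse_box _ _) mem_coarse_box ?muln_gt0// ci.
        by rewrite eqxx lerDl; apply: sumr_ge0.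
      apply: ler_sum => z _; rewrite -big_filter -/(points cell z) -[leRHS]mulr1 -sumr_const_seq.
      by apply: ler_sum => i _; rewrite /Z; case: ifP.
    by apply: ler_sum.
  have -> : 2 * M%:R ^+ 2 * be * Kmax * (2 * h)%:R ^+ d =
      2 * M%:R ^+ 2 * (be * (Kmax * (2 * h)%:R ^+ d)) by move: (_ ^+ d) => *; ring.
  rewrite ler_wpM2l ?mulr_ge0 ?exprn_ge0//.
  apply: (@le_trans _ _ (be * \sum_i Z i)); last by rewrite ler_wpM2l.
  by rewrite mulr_sumr; apply: ler_sum => i _; rewrite mulrC ler_wpM2r.
apply: (le_trans h1); rewrite mulr_sumr mulr_sumr; apply: ler_sum => k _.
apply: (@le_trans _ _ (2 * (y 0 k ^+ 2 * (2 * M%:R ^+ 2 * be * Kmax * (2 * h)%:R ^+ d)))).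
  by rewrite ler_pM2l// ler_wpM2l ?sqr_ge0.
by rewrite le_eqVlt; apply/orP; left; apply/eqP; move: (_ ^+ d) => *; ring.
Qed.

End upper_bound.

(** * The spectrum of a sample with regular cell counts *)

Lemma graph_laplacianE (R : realType) d (eta : R -> R) (p q r : R) n (eps : R)
    (x : 'I_n -> 'rV[R]_d) :
  let h i := pre_degree eta eps x i `^ (1 - q / 2) in
  let W i j := pre_weight eta eps x i j / (h i * h j) in
  let a i := if q == 1 then 1 else (\sum_j W i j) `^ ((1 - p) / (q - 1)) in
  let b i := if q == 1 then 1 else (\sum_j W i j) `^ (- (r / (q - 1))) in
  graph_laplacian eta p q r eps x = scaled_laplacian W (eps ^- 2) a b.
Proof.
rewrite /= /graph_laplacian /scaled_laplacian; case: ifP => _; last by [].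
have -> : diag_mx (\row_i 1) = 1%:M :> 'M[R]_n.
  by apply/matrixP => i j; rewrite !mxE.
by rewrite mul1mx mulmx1.
Qed.

Lemma enormB (R : realType) d (u v : 'rV[R]_d) : enorm (u - v) = enorm (v - u).
Proof. by congr Num.sqrt; apply: eq_bigr => i _; rewrite -opprB mxE sqrrN. Qed.

Lemma pre_weightC (R : realType) d (eta : R -> R) n (eps : R) (x : 'I_n -> 'rV[R]_d) i j :
  pre_weight eta eps x i j = pre_weight eta eps x j i.
Proof. by rewrite /pre_weight enormB. Qed.

Lemma pre_weight_ge0 (R : realType) d (eta : R -> R) n (eps : R) (x : 'I_n -> 'rV[R]_d) i j :
  0 < eps -> (forall t, 0 <= t -> 0 <= eta t) -> 0 <= pre_weight eta eps x i j.
Proof.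
move=> e0 eta0; apply: mulr_ge0.
  by rewrite invr_ge0 mulr_ge0 ?exprn_ge0 ?(ltW e0).
by rewrite eta0// divr_ge0 ?(ltW e0)// sqrtr_ge0.
Qed.

(** The constants depend on [p], [q], [r] and the bounds on the degrees alone, so estimates of the
    unnormalised Dirichlet form suffice from here on. *)
Lemma laplacian_spectrum (R : realType) (p q r al be : R) : 0 < al ->
  exists c C : R, [/\ 0 < c, 0 < C &
  forall d (eta : R -> R) n (eps : R) (x : 'I_n -> 'rV[R]_d),
    0 < eps -> (forall t, 0 <= t -> 0 <= eta t) ->
    (forall i, al <= pre_degree eta eps x i <= be) -> (0 < n)%N ->
    let L := graph_laplacian eta p q r eps x in
    let E (u : 'rV[R]_n) := dirichlet (pre_weight eta eps x) (fun i => u 0 i) in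
    (forall l k (K : 'M[R]_(n, k)) t, (k < l <= n)%N -> 0 <= t ->
       (forall u, u *m K = 0 -> t * \sum_i u 0 i ^+ 2 <= E u) ->
       c * eps ^- 2 * t <= eigenvalue_nth L l) /\
    (forall l (B : 'M[R]_(l, n)) t, (0 < l)%N -> row_free B -> 0 <= t ->
       (forall y : 'rV[R]_l, E (y *m B) <= t * \sum_i (y *m B) 0 i ^+ 2) ->
       eigenvalue_nth L l <= C * eps ^- 2 * t)].
Proof.
move=> al0.
have [h1 [h2 [h10 h20 bh]]] := powR_bounds be (1 - q / 2) al0.
have al'0 : 0 < h2 ^- 2 * al by rewrite mulr_gt0// invr_gt0 exprn_gt0.
have [m1 [M1 [m10 M10 b1]]] := powR_bounds (h1 ^- 2 * be) ((1 - p) / (q - 1)) al'0.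
have [m2 [M2 [m20 M20 b2]]] := powR_bounds (h1 ^- 2 * be) (- (r / (q - 1))) al'0.
(* The 1 accounts for the case [q = 1], where both diagonal factors are 1. *)
pose m := Num.min 1 (Num.min m1 m2); pose M := Num.max 1 (Num.max M1 M2).
have m0 : 0 < m by rewrite !lt_min ltr01 m10.
have M0 : 0 < M by rewrite !lt_max ltr01.
exists (m ^+ 2 / (2 * h2 ^+ 2)), (M ^+ 2 / (2 * h1 ^+ 2)).
split; [by rewrite divr_gt0 ?mulr_gt0 ?exprn_gt0..|].
move=> d eta n eps x eps0 eta0 hd n0.
pose h i := pre_degree eta eps x i `^ (1 - q / 2).
pose W i j := pre_weight eta eps x i j / (h i * h j).
pose a i := if q == 1 then 1 else (\sum_j W i j) `^ ((1 - p) / (q - 1)).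
pose b i := if q == 1 then 1 else (\sum_j W i j) `^ (- (r / (q - 1))).
have e0 : 0 < eps ^- 2 by rewrite invr_gt0 exprn_gt0.
have pw0 i j := pre_weight_ge0 x i j eps0 eta0.
have h_ge i : h1 <= h i by have /andP[] := bh _ (hd i).
have h_le i : h i <= h2 by have /andP[] := bh _ (hd i).
have hW i := normalized_degree_bound pw0 h10 h_ge h_le (hd i).
have a_b i : [/\ m <= a i, a i <= M, m <= b i & b i <= M].
  rewrite /a /b; case: ifP => _; rewrite /m /M !ge_min !le_max ?lexx ?orbT//.
  have /andP[u1 u2] := b1 _ (hW i); have /andP[u3 u4] := b2 _ (hW i).
  by rewrite u1 u2 u3 u4 !orbT.
have a_ge i : m <= a i by have [] := a_b i.
have a_le i : a i <= M by have [] := a_b i.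
have b_ge i : m <= b i by have [] := a_b i.
have b_le i : b i <= M by have [] := a_b i.
have pwC := @pre_weightC R d eta n eps x.
have LE : graph_laplacian eta p q r eps x = scaled_laplacian W (eps ^- 2) a b.
  exact: graph_laplacianE.
rewrite LE; split=> [l k K t kl t0 hK|l B t l0 fB t0 hB].
- exact: (scaled_laplacian_eig_ge pwC pw0 e0 h10 h_ge h_le m0 a_ge b_ge h20 kl t0 hK).
- exact: (scaled_laplacian_eig_le pwC pw0 e0 h10 h_ge m0 a_ge a_le b_ge b_le l0 fB t0 hB).
Qed.

Section sample_graph.
Variables (R : realType) (d n M : nat) (eta : R -> R) (delta : R).
Local Notation Zd := 'rV[int]_d.
Variables (x : 'I_n -> 'rV[R]_d) (s : seq Zd) (k1 k2 : R).
Hypothesis eta_ge0 : forall t : R, 0 <= t -> 0 <= eta t.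
Hypothesis eta_noninc : forall u v : R, 0 <= u -> u <= v -> eta v <= eta u.
Hypothesis eta_supp : forall t, 1 < t -> eta t = 0.
Hypothesis eta_half : 0 < eta (2^-1).
Hypothesis d0 : (0 < d)%N.
Hypothesis n0 : (0 < n)%N.
Hypothesis delta0 : 0 < delta.

(** Points of [M]-near cells differ by at most [M.+1 * delta] in each coordinate, so their Euclidean
    distance is at most [d * M.+1 * delta], that is half of [graph_scale]. *)
Definition cell_ratio : nat := (2 * d * M.+1)%N.
Definition graph_scale : R := cell_ratio%:R * delta.

Local Notation eps := graph_scale.
Local Notation pw := (pre_weight eta eps x).
Local Notation cell := (fun i => cell_of delta (x i)).

(** The lower bound is restricted to [s] because a cell cut by the boundary may contain no point at
    all. *)
Definition regular_counts : Prop :=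
  (forall z, z \in s -> k1 * (n%:R * delta ^+ d) <= (size (points cell z))%:R) /\
  (forall z, (size (points cell z))%:R <= k2 * (n%:R * delta ^+ d)).

Lemma cell_ratio_gt0 : 0 < cell_ratio%:R :> R.
Proof. by rewrite ltr0n !muln_gt0 d0. Qed.

Lemma graph_scale_gt0 : 0 < eps.
Proof. by rewrite mulr_gt0// cell_ratio_gt0. Qed.

Let vol0 : 0 < n%:R * delta ^+ d.
Proof. by rewrite mulr_gt0 ?exprn_gt0// ltr0n. Qed.

Let volE : (n%:R * eps ^+ d)^-1 = cell_ratio%:R ^- d * (n%:R * delta ^+ d)^-1.
Proof. by rewrite exprMn mulrCA invfM. Qed.

Lemma pre_weight_ge i j : near_cells M (cell i) (cell j) ->
  (n%:R * eps ^+ d)^-1 * eta (2^-1) <= pw i j.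
Proof.
move=> ij; rewrite ler_wpM2l ?invr_ge0 ?mulr_ge0 ?exprn_ge0 ?(ltW graph_scale_gt0)//.
apply: eta_noninc; first by rewrite divr_ge0 ?sqrtr_ge0 ?(ltW graph_scale_gt0).
rewrite ler_pdivrMr ?graph_scale_gt0//.
apply: (@le_trans _ _ (d%:R * (M.+1%:R * delta))).
  apply: enorm_le => [|k]; first by rewrite mulr_ge0// ltW.
  by have := near_cells_sup_near delta0 ij k; rewrite !mxE.
by rewrite /graph_scale /cell_ratio !natrM le_eqVlt; apply/orP; left; apply/eqP; field.
Qed.

Lemma pre_weight_le i j : pw i j <= (n%:R * eps ^+ d)^-1 * eta 0.
Proof.
rewrite ler_wpM2l ?invr_ge0 ?mulr_ge0 ?exprn_ge0 ?(ltW graph_scale_gt0)//.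
by apply: eta_noninc => //; rewrite divr_ge0 ?sqrtr_ge0 ?(ltW graph_scale_gt0).
Qed.

Lemma pre_weight_near i j : pw i j != 0 -> near_cells cell_ratio.+1 (cell i) (cell j).
Proof.
move=> pij; apply: cell_of_near => // k; rewrite -/graph_scale.
have : enorm (x i - x j) <= eps.
  rewrite leNgt; apply: contra_neqN pij => h.
  by rewrite /pre_weight eta_supp ?mulr0// ltr_pdivlMr ?graph_scale_gt0// mul1r.
by apply: le_trans; have := coord_le_enorm (x i - x j) k; rewrite !mxE.
Qed.

Lemma close_energy_le_dirichlet u :
  close_energy cell M u <= n%:R * eps ^+ d / eta (2^-1) * dirichlet pw u.
Proof.
have ne0 : 0 < n%:R * eps ^+ d by rewrite mulr_gt0 ?exprn_gt0 ?graph_scale_gt0// ltr0n.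
rewrite /dirichlet mulr_sumr; apply: ler_sum => i _.
rewrite mulr_sumr big_mkcond; apply: ler_sum => j _.
have pw0 := pre_weight_ge0 x i j graph_scale_gt0 eta_ge0.
case: ifPn => [/pre_weight_ge ij|_]; last first.
  apply: mulr_ge0; first by rewrite divr_ge0 ?(ltW ne0) ?(ltW eta_half).
  by rewrite mulr_ge0 ?sqr_ge0.
rewrite mulrA ler_peMl ?sqr_ge0//.
move: ij; rewrite ler_pdivrMl// => ij.
by rewrite mulrAC ler_pdivlMr// mul1r.
Qed.

Hypothesis k10 : 0 < k1.
Hypothesis counts : regular_counts.

(** A single good cell near the point already supplies enough neighbours. The point itself may lie
    in a cell cut by the boundary; its cone provides [t]. *)
Lemma pre_degree_ge i t : t \in s -> near_cells M (cell i) t ->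
  cell_ratio%:R ^- d * eta (2^-1) * k1 <= pre_degree eta eps x i.
Proof.
move=> ts it; have h := (proj1 counts) _ ts.
apply: (@le_trans _ _ (\sum_(j | cell j == t) pw i j)); last first.
  rewrite big_mkcond; apply: ler_sum => j _; case: ifP => // _.
  exact: pre_weight_ge0 graph_scale_gt0 eta_ge0.
apply: (@le_trans _ _ (\sum_(j <- points cell t) (n%:R * eps ^+ d)^-1 * eta (2^-1))).
  rewrite sumr_const_seq volE.
  apply: (@le_trans _ _ (k1 * (n%:R * delta ^+ d) * (cell_ratio%:R ^- d * (n%:R * delta ^+ d)^-1 * eta (2^-1)))).
    rewrite le_eqVlt; apply/orP; left; apply/eqP.
    have vn := gt_eqF vol0; move: (n%:R * delta ^+ d) (cell_ratio%:R ^- d) (eta _) vn => v w e vn.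
    by field; rewrite vn.
  rewrite ler_wpM2r// !mulr_ge0 ?invr_ge0 ?exprn_ge0 ?(ltW vol0) ?(ltW eta_half)//.
rewrite big_filter; apply: ler_sum => j /eqP jt; apply: pre_weight_ge.
by rewrite jt.
Qed.

Lemma pre_degree_le i :
  pre_degree eta eps x i <= cell_ratio%:R ^- d * eta 0 * ((2 * cell_ratio.+1 + 1)%:R ^+ d * k2).
Proof.
pose B := intbox (cell i - const_mx cell_ratio.+1%:Z) (2 * cell_ratio.+1 + 1).
have e0 : 0 <= eta 0 by exact: eta_ge0.
have c0 : 0 <= (n%:R * eps ^+ d)^-1 * eta 0.
  by rewrite !mulr_ge0 ?invr_ge0 ?mulr_ge0 ?exprn_ge0 ?(ltW graph_scale_gt0).
apply: (@le_trans _ _ (\sum_(z <- B) \sum_(j | cell j == z) (n%:R * eps ^+ d)^-1 * eta 0)).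
  rewrite (exchange_big_dep predT)//=; apply: ler_sum => j _.
  have [->|pij] := eqVneq (pw i j) 0; first by apply: sumr_ge0.
  rewrite (big_rem (cell j)) /=.
    rewrite eqxx; apply: (le_trans (pre_weight_le i j)); rewrite lerDl.
    by apply: sumr_ge0.
  have := pre_weight_near pij; rewrite /B /=.
  move: (cell_of delta (x i)) (cell_of delta (x j)) => ci cj /near_cellsP h.
  rewrite mem_intbox; apply/forallP => k; have := h k; rewrite !mxE.
  move: (ci 0 k) (cj 0 k) => a b; lia.
apply: (@le_trans _ _ (\sum_(z <- B) k2 * (n%:R * delta ^+ d) * ((n%:R * eps ^+ d)^-1 * eta 0))).
  apply: ler_sum => z _; rewrite -big_filter sumr_const_seq ler_wpM2r//.
  exact: (proj2 counts).
rewrite sumr_const_seq size_intbox natrX volE le_eqVlt; apply/orP; left; apply/eqP.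
have vn := gt_eqF vol0; set v := n%:R * delta ^+ d in vn *; set X := _ ^+ d in vn *; move: v X (cell_ratio%:R ^- d) (eta 0) vn => v X w e vn.
by field; rewrite vn.
Qed.

End sample_graph.

Definition avg_constraint_mx (R : realType) d n (cell : 'I_n -> 'rV[int]_d) k
    (T : 'I_k -> seq 'rV[int]_d) : 'M[R]_(n, k) :=
  \matrix_(i, c) \sum_(z <- T c) (cell i == z)%:R / (size (points cell z))%:R.

Lemma avg_constraint_mxE (R : realType) d n (cell : 'I_n -> 'rV[int]_d) k
    (T : 'I_k -> seq 'rV[int]_d) (u : 'rV[R]_n) c :
  (u *m avg_constraint_mx R cell T) 0 c =
  \sum_(z <- T c) cell_avg cell (fun i => u 0 i) z.
Proof.
rewrite mxE; under eq_bigr do rewrite mxE mulr_sumr.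
rewrite exchange_big; apply: eq_bigr => z _ /=.
rewrite /cell_avg big_filter mulr_suml [RHS]big_mkcond; apply: eq_bigr => i _.
by case: eqP => _; rewrite ?mul1r ?mul0r ?mulr0.
Qed.

(** * Bounding the norm by the Dirichlet energy of a sample *)

Section lower_bound.
Variables (R : realType) (d n M kap : nat) (eta : R -> R) (delta t0 : R).
Local Notation Zd := 'rV[int]_d.
Variables (A : set 'rV[R]_d) (dirs : seq Zd).
Variables (x : 'I_n -> 'rV[R]_d) (s : seq Zd) (k1 k2 : R).
Hypothesis eta_ge0 : forall t : R, 0 <= t -> 0 <= eta t.
Hypothesis eta_noninc : forall u v : R, 0 <= u -> u <= v -> eta v <= eta u.
Hypothesis eta_half : 0 < eta (2^-1).
Hypothesis d0 : (0 < d)%N.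
Hypothesis n0 : (0 < n)%N.
Hypothesis delta0 : 0 < delta.
Hypothesis k10 : 0 < k1.
Hypothesis k20 : 0 < k2.
Hypothesis kap0 : (0 < kap)%N.
Hypothesis cones : forall y, A y -> exists2 a, a \in dirs & cone_at A a kap t0 y.
Hypothesis dirsM : forall a, a \in dirs -> near_cells M a 0 /\ near_cells M (a *+ kap) 0.
Hypothesis M0 : (0 < M)%N.
Hypothesis xA : forall i, A (x i).
Hypothesis gs : good_cells A delta s.
Hypothesis counts : regular_counts delta x s k1 k2.

Local Notation cell := (fun i => cell_of delta (x i)).
Local Notation eps := (graph_scale d M delta).
Local Notation pw := (pre_weight eta eps x).

(** The lattice trace of a cone, phrased with cells only: points of one cell may have different
    cones, whereas the grouping by cells needs one direction per cell. *)
Definition escapes (z a : Zd) : Prop := forall j (e : Zd), (0 < j)%N ->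
  j%:R * delta <= t0 -> (forall i, (kap * (absz (e 0%R i)).+1 <= j)%N) ->
  z + a *+ j + e \in s.

Definition direction (z : Zd) : Zd := xget 0 [set a | a \in dirs /\ escapes z a].

Lemma directionP i : direction (cell i) \in dirs /\ escapes (cell i) (direction (cell i)).
Proof.
rewrite /direction; case: xgetP => [a _ //|none].
have [a ad ca] := cones (xA i); case: (none a); split=> // j e j0 jt he.
by apply/(proj2 gs); exact: cone_cell ca j0 jt he.
Qed.

Lemma direction_path i j : (kap <= j)%N -> j%:R * delta <= t0 ->
  cell i + direction (cell i) *+ j \in s.
Proof.
move=> kj jt; have [_ esc] := directionP i.
rewrite -[_ + _]addr0; apply: esc => // [|k]; first exact: leq_trans kj.
by rewrite mxE absz0 muln1.
Qed.

Definition lower_const (B : R) : R :=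
  3 * (k1^-1 + k2 * (size dirs)%:R * (1 + B) * k1 ^- 2) * ((cell_ratio d M)%:R ^+ d / eta (2^-1)).

Lemma lower_const_gt0 B : 0 <= B -> 0 < lower_const B.
Proof.
move=> B0; apply: mulr_gt0; last by rewrite divr_gt0// exprn_gt0// cell_ratio_gt0.
rewrite mulr_gt0// ltr_pwDl ?invr_gt0// !mulr_ge0 ?addr_ge0 ?(ltW k20)//.
by rewrite invr_ge0 exprn_ge0 ?(ltW k10).
Qed.

Lemma sum_sqr_le_dirichlet (m : nat) (t : seq Zd) (B : R) (u : 'I_n -> R) :
  (kap <= m)%N -> m%:R * delta <= t0 -> uniq t ->
  (forall i, cell i + direction (cell i) *+ m \in t) -> 0 <= B ->
  \sum_(w <- t) cell_avg cell u w ^+ 2 <=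
     B * m%:R ^+ 2 * energy M s (cell_avg cell u) ->
  \sum_i u i ^+ 2 <= lower_const B * m%:R ^+ 2 * dirichlet pw u.
Proof.
move=> km mt ut ct B0 hB.
have v0 : 0 < n%:R * delta ^+ d :> R by rewrite mulr_gt0 ?exprn_gt0// ltr0n.
set v := n%:R * delta ^+ d in v0.
have m0 : (0 < m)%N by exact: leq_trans km.
have Bm0 : 0 <= B * m%:R ^+ 2 by rewrite mulr_ge0 ?exprn_ge0.
have Kmin0 : 0 < k1 * v by rewrite mulr_gt0.
have cdirs i : direction (cell i) \in dirs by have [] := directionP i.
have path i j : (kap <= j <= m)%N -> cell i + direction (cell i) *+ j \in s.
  move=> /andP[kj jm]; apply: direction_path => //.
  by apply: le_trans mt; rewrite ler_pM2r// ler_nat.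
have dM a : a \in dirs -> near_cells M a 0 by move=> /dirsM[].
have cM i : near_cells M (cell i) (cell i + direction (cell i) *+ kap).
  have [_] := dirsM (cdirs i); rewrite -(near_cells_add M (cell i)) addr0.
  by move=> /near_cellsP h; apply/near_cellsP => k; rewrite distrC.
have := sum_sqr_le_close_energy (proj1 gs) Kmin0 (proj1 counts) (proj2 counts)
  cdirs km path dM cM ct Bm0 ut hB.
rewrite -/v => /le_trans; apply.
have hF := close_energy_le_dirichlet M x eta_ge0 eta_noninc eta_half d0 n0 delta0 u.
have D0 : 0 <= dirichlet pw u.
  by apply: ge0_dirichlet => i j; apply: pre_weight_ge0 => //; exact: graph_scale_gt0.
set X := 3 * _; have X0 : 0 <= X.
  rewrite /X; apply: mulr_ge0 => //; apply: addr_ge0; first by rewrite invr_ge0 ltW.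
  apply: mulr_ge0; last by rewrite invr_ge0 exprn_ge0// ltW.
  apply: mulr_ge0; last by rewrite addr_ge0 ?exprn_ge0.
  by apply: mulr_ge0 => //; apply: mulr_ge0; exact: ltW.
apply: (le_trans (ler_wpM2l X0 hF)); rewrite mulrA ler_wpM2r//.
have -> : n%:R * eps ^+ d / eta (2^-1) = v * ((cell_ratio d M)%:R ^+ d / eta (2^-1)).
  by rewrite /graph_scale exprMn /v; move: (_ ^+ d) (_ ^+ d) => p q; ring.
rewrite mulrA /lower_const [leRHS]mulrAC; apply: ler_wpM2r.
  by rewrite divr_ge0 ?exprn_ge0 ?(ltW eta_half).
(* Both count bounds are multiples of [v], and [X] is homogeneous of degree -1 in it. The
   normalisation of the weights brings in one [v], so [n] and [delta] disappear from the
   constant. *)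
have -> : X * v = 3 * (k1^-1 + k2 * (size dirs)%:R * (m%:R ^+ 2 + B * m%:R ^+ 2) * k1 ^- 2).
  have E (w : R) : w != 0 -> 3 * ((k1 * w)^-1 + k2 * w * (size dirs)%:R *
      (m%:R ^+ 2 + B * m%:R ^+ 2) * (k1 * w) ^- 2) * w =
      3 * (k1^-1 + k2 * (size dirs)%:R * (m%:R ^+ 2 + B * m%:R ^+ 2) * k1 ^- 2).
    by move=> w0; field; rewrite w0 gt_eqF.
  by apply: E; rewrite gt_eqF.
rewrite -[leRHS]mulrA ler_pM2l// [leRHS]mulrDl; apply: lerD.
  by rewrite ler_peMr ?invr_ge0 ?(ltW k10)// exprn_ege1// ler1n.
by rewrite le_eqVlt; apply/orP; left; apply/eqP; move: (k1 ^- 2) => *; ring.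
Qed.

(** The constraints are zero sums over the coarse boxes made of good cells. Each such box holds at
    least [k1 * n * (delta * b) ^ d] of the [n] points, which bounds their number [k]. *)
Lemma lower_coarse (b : nat) : (0 < b)%N -> (kap * b)%:R * delta <= t0 ->
  exists k (K : 'M[R]_(n, k)),
    k%:R * (k1 * (delta * b%:R) ^+ d) <= 1 /\
    forall u : 'rV[R]_n, u *m K = 0 ->
    \sum_i u 0 i ^+ 2 <=
      lower_const (3 ^+ d) * (kap * b)%:R ^+ 2 * dirichlet pw (fun i => u 0 i).
Proof.
move=> b0 mt.
pose C := [seq c <- undup [seq coarse b z | z <- s] | all (mem s) (coarse_box b c)].
have uC : uniq C by rewrite filter_uniq// undup_uniq.
have Cs c : c \in C -> {subset coarse_box b c <= s}.
  by rewrite mem_filter => /andP[/allP].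
pose T (c : 'I_(size C)) := coarse_box b (tnth (in_tuple C) c).
exists (size C), (avg_constraint_mx R cell T); split.
  have v0 : 0 < n%:R :> R by rewrite ltr0n.
  rewrite -(ler_pM2l v0) mulr1.
  apply: (@le_trans _ _ (\sum_(z <- s) \sum_(i | cell i == z) (1 : R))); last first.
    apply: (@le_trans _ _ (\sum_(i : 'I_n) (1 : R))); last by rewrite sumr_const card_ord.
    by apply: sum_fibers_le => //; exact: (proj1 gs).
  have -> : n%:R * ((size C)%:R * (k1 * (delta * b%:R) ^+ d)) =
      \sum_(c <- C) \sum_(z <- coarse_box b c) k1 * (n%:R * delta ^+ d).
    under eq_bigr do rewrite sumr_const_seq size_intbox.
    by rewrite sumr_const_seq exprMn natrX; move: (_ ^+ d) (_ ^+ d) => *; ring.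
  apply: (@le_trans _ _ (\sum_(c <- C) \sum_(z <- s | coarse b z == c) \sum_(i | cell i == z) (1 : R))).
    rewrite big_seq [leRHS]big_seq; apply: ler_sum => c cC; rewrite -[leRHS]big_filter.
    apply: (@le_trans _ _ (\sum_(z <- coarse_box b c) \sum_(i | cell i == z) (1 : R))).
      rewrite big_seq [leRHS]big_seq; apply: ler_sum => z /(Cs _ cC) zs.
      by rewrite -big_filter sumr_const_seq mulr1; exact: (proj1 counts).
    apply: sum_le_subset; [by move=> z; exact: sumr_ge0|exact: intbox_uniq|].
    move=> z zc; rewrite mem_filter (Cs _ cC) // andbT -mem_coarse_box//.
  by apply: sum_fibers_le => // z; exact: sumr_ge0.
move=> u uK.
pose t := undup [seq cell i + direction (cell i) *+ (kap * b) | i : 'I_n].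
apply: (@sum_sqr_le_dirichlet (kap * b) t) => //.
- by rewrite leq_pmulr.
- exact: undup_uniq.
- by move=> i; rewrite mem_undup; apply/mapP; exists i => //; rewrite mem_enum.
apply: (@le_trans _ _ (3 ^+ d * b%:R ^+ 2 * energy M s (cell_avg cell (fun i => u 0 i)))); last first.
  rewrite ler_wpM2r ?energy_ge0// ler_wpM2l ?exprn_ge0// lerXn2r ?nnegrE// ler_nat.
  by rewrite leq_pmull.
apply: (poincare_coarse b0 M0 uC Cs) => [c cC||w].
- have := congr1 (fun v : 'rV[R]__ => v 0 (Ordinal (etrans (index_mem c C) cC))) uK.
  rewrite avg_constraint_mxE /T (tnth_nth 0) /= nth_index// => ->.
  by rewrite mxE.
- exact: undup_uniq.
rewrite mem_undup => /mapP[i _ ->].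
have [_ esc] := directionP i; set w0 := _ + _.
(* Two cells of one coarse box differ by at most [b - 1] in each coordinate, so [kap * b] steps
   satisfy the width condition of [escapes], and the whole box of [w0] is good. *)
have bs z : z \in coarse_box b (coarse b w0) -> z \in s.
  rewrite mem_coarse_box// => /eqP zw.
  have -> : z = w0 + (z - w0) by rewrite addrC subrK.
  apply: esc => //; first by rewrite muln_gt0 kap0.
  move=> k; rewrite leq_pmul2l//.
  have hz : z \in coarse_box b (coarse b w0) by rewrite mem_coarse_box// zw.
  have hw : w0 \in coarse_box b (coarse b w0) by rewrite mem_coarse_box.
  move: hz hw; rewrite !mem_intbox => /forallP/(_ k) + /forallP/(_ k).
  rewrite [(z - w0) 0 k]mxE [(- w0) 0 k]mxE.
  move: (z 0 k) (w0 0 k) ((coarse b w0 *+ b) 0 k) => *; lia.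
rewrite mem_filter mem_undup map_f ?andbT; last by apply: bs; rewrite mem_coarse_box.
by apply/allP.
Qed.

End lower_bound.

Lemma dirichlet_le_degree (R : realType) n (W : 'I_n -> 'I_n -> R) (be : R) u :
  (forall i j, W i j = W j i) -> (forall i j, 0 <= W i j) ->
  (forall i, \sum_j W i j <= be) -> dirichlet W u <= 4 * be * \sum_i u i ^+ 2.
Proof.
move=> WC W0 Wbe.
apply: (@le_trans _ _ (\sum_i \sum_j (2 * (W i j * u i ^+ 2) + 2 * (W i j * u j ^+ 2)))).
  apply: ler_sum => i _; apply: ler_sum => j _; rewrite !(mulrCA 2) -mulrDr ler_wpM2l//.
  by have := sqr_ge0 (u i + u j); nra.
have -> : \sum_i \sum_j (2 * (W i j * u i ^+ 2) + 2 * (W i j * u j ^+ 2)) =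
    4 * \sum_i u i ^+ 2 * \sum_j W i j.
  have E : \sum_i \sum_j 2 * (W i j * u i ^+ 2) = 2 * \sum_i u i ^+ 2 * \sum_j W i j.
    rewrite mulr_sumr; apply: eq_bigr => i _; rewrite -mulr_sumr; congr (_ * _).
    by rewrite mulr_sumr; apply: eq_bigr => j _; rewrite mulrC.
  under eq_bigr do rewrite big_split /=.
  rewrite big_split /= E [X in _ + X]exchange_big /=.
  have -> : \sum_j \sum_i 2 * (W i j * u j ^+ 2) = \sum_i \sum_j 2 * (W i j * u i ^+ 2).
    by apply: eq_bigr => i _; apply: eq_bigr => j _; rewrite WC.
  by rewrite E -mulrDl; congr (_ * _); rewrite -natrD.
rewrite -mulrA ler_pM2l// mulr_sumr; apply: ler_sum => i _.
by rewrite mulrC ler_wpM2r ?sqr_ge0.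
Qed.

Lemma row_free_pid_mx (R : realType) l n : (l <= n)%N ->
  row_free (pid_mx l : 'M[R]_(l, n)).
Proof. by move=> ln; rewrite /row_free rank_pid_mx. Qed.

(* A block of [N ^ d] coarse boxes of [(2 * h) ^ d] cells each fits in the ball
   of radius [r0] around [x0]. *)
Lemma tents_in_ball (R : realType) d (A : set 'rV[R]_d) (r0 delta : R) (x0 : 'rV[R]_d)
    (s : seq 'rV[int]_d) (h N : nat) :
  (forall u, sup_near (2 * r0) x0 u -> A u) -> 0 < delta -> delta <= r0 ->
  good_cells A delta s -> (0 < h)%N -> (0 < N)%N ->
  (2 * h * N + 1)%:R * delta <= r0 -> forall f,
  f \in intbox (coarse (2 * h) (cell_of delta x0)) N ->
  forall z, z \in coarse_box (2 * h) f -> z \in s.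
Proof.
move=> Ar0 delta0 delta_r0 gs h0 N0 hN f hf z hz; apply/(proj2 gs).
apply: (@cube_sub_near R d A delta z x0 r0) => // [u hu|i].
  by apply: Ar0; apply: sup_near_le hu; rewrite mulr_natl mulr2n lerD2l.
have : cell_of delta x0 \in coarse_box (2 * h) (coarse (2 * h) (cell_of delta x0)).
  by rewrite mem_coarse_box ?muln_gt0.
move: hz hf; rewrite !mem_intbox => /forallP/(_ i) + /forallP/(_ i) + /forallP/(_ i).
have E (a : int) : a *+ (2 * h) = a * (2 * h)%:Z by rewrite -mulr_natr natz.
have := cell_ofP x0 i delta0; rewrite !cornerE !mulmxnE !E {E}.
move: (z 0 i) (f 0 i) (cell_of delta x0 0 i) (coarse (2 * h) (cell_of delta x0) 0 i) (x0 0 i).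
move=> a b c e y hy h1 h2 h3.
have h6 : (b + 1) * (2 * h)%:Z <= (e + N%:Z) * (2 * h)%:Z by rewrite ler_wpM2r//; lia.
have h7 : e * (2 * h)%:Z <= b * (2 * h)%:Z by rewrite ler_wpM2r//; lia.
rewrite !mulrDl -PoszM mul1r in h6.
have h8 : (2 * h <= 2 * h * N)%N by rewrite leq_pmulr.
have h4 : a < c + (2 * h * N)%:Z by move: h1 h3 h6; rewrite (mulnC N); lia.
have h5 : c < a + (2 * h * N)%:Z by move: h1 h3 h7; lia.
have lt_real (u v : int) : u < v + (2 * h * N)%:Z -> delta * u%:~R <= delta * v%:~R + (2 * h * N)%:R * delta.
  by move=> uv; rewrite [X in _ <= _ + X]mulrC -mulrDr ler_pM2l// -(intrD _ v (2 * h * N)%:Z) ler_int ltW.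
have := lt_real _ _ h4; have := lt_real _ _ h5; move: hN; rewrite natrD mulrDl mul1r.
move: ((2 * h * N)%:R * delta) => w; rewrite ler_norml; lra.
Qed.

Section two_sided.
Variables (R : realType) (d M : nat) (eta : R -> R).
Local Notation Zd := 'rV[int]_d.
Variables (A : set 'rV[R]_d) (k1 k2 r0 : R) (x0 : 'rV[R]_d).
Hypothesis eta_ge0 : forall t : R, 0 <= t -> 0 <= eta t.
Hypothesis eta_noninc : forall u v : R, 0 <= u -> u <= v -> eta v <= eta u.
Hypothesis eta_supp : forall t, 1 < t -> eta t = 0.
Hypothesis eta_half : 0 < eta (2^-1).
Hypothesis d0 : (0 < d)%N.
Hypothesis k10 : 0 < k1.
Hypothesis k20 : 0 < k2.
Hypothesis r00 : 0 < r0.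
Hypothesis Ar0 : forall u, sup_near (2 * r0) x0 u -> A u.

Let rho := (cell_ratio d M)%:R : R.
Let rho0 : 0 < rho. Proof. exact: cell_ratio_gt0. Qed.

Definition degree_bound : R :=
  rho ^- d * eta 0 * ((2 * (cell_ratio d M).+1 + 1)%:R ^+ d * k2).

Let be := degree_bound.

Lemma degree_bound_ge0 : 0 <= be.
Proof.
rewrite /be /degree_bound; apply: mulr_ge0; apply: mulr_ge0; rewrite ?exprn_ge0 ?eta_ge0 ?(ltW k20)//.
by rewrite invr_ge0 exprn_ge0 ?(ltW rho0).
Qed.

(** The quotient of [dirichlet_tent_le] by [tent_norm_ge], without its factor [1 / h ^ 2]: since
    [uphalf h >= h / 2], one has [(2 h) ^ d / (h / 2) ^ (d + 2) = 4 ^ d * 4 / h ^ 2]. *)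
Definition tent_const : R :=
  4 * (cell_ratio d M).+1%:R ^+ 2 * be * (k2 / k1) * (4 ^+ d * 4).

Lemma tent_const_ge0 : 0 <= tent_const.
Proof.
apply: mulr_ge0; last by rewrite mulr_ge0 ?exprn_ge0.
apply: mulr_ge0; last by rewrite divr_ge0 ?(ltW k20) ?(ltW k10).
by apply: mulr_ge0; rewrite ?degree_bound_ge0// mulr_ge0 ?exprn_ge0.
Qed.

Section sample.
Variables (n : nat) (delta : R) (x : 'I_n -> 'rV[R]_d) (s : seq Zd).
Hypothesis n0 : (0 < n)%N.
Hypothesis delta0 : 0 < delta.
Hypothesis delta_r0 : delta <= r0.
Hypothesis gs : good_cells A delta s.
Hypothesis counts : regular_counts delta x s k1 k2.

Local Notation cell := (fun i => cell_of delta (x i)).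
Local Notation eps := (graph_scale d M delta).
Local Notation pw := (pre_weight eta eps x).

Lemma dirichlet_tent_ratio (h l : nat) (c : 'I_l -> Zd) (y : 'rV[R]_l) : (0 < h)%N ->
  injective c -> (forall k z, z \in coarse_box (2 * h) (c k) -> z \in s) ->
  dirichlet pw (fun i => (y *m tent_mx R cell h c) 0 i) <=
    tent_const / h%:R ^+ 2 * \sum_i (y *m tent_mx R cell h c) 0 i ^+ 2.
Proof.
move=> h0 ci cs; set B := tent_mx _ _ _ _.
have hR : 0 < h%:R :> R by rewrite ltr0n.
have u2 : h%:R / 2 <= (uphalf h)%:R :> R.
  have : (h <= uphalf h * 2)%N by lia.
  by rewrite -(ler_nat R) natrM ler_pdivrMr.
have u2d : (h%:R / 2) ^+ d.+2 <= (uphalf h)%:R ^+ d.+2 :> R.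
  have hA : h%:R / 2 \is @Num.nneg R by rewrite nnegrE divr_ge0 ?ler0n.
  have hB : (uphalf h)%:R \is @Num.nneg R by rewrite nnegrE ler0n.
  exact: lerXn2r hA hB u2.
have v0 : 0 < n%:R * delta ^+ d :> R by rewrite mulr_gt0 ?exprn_gt0// ltr0n.
have pwC i j : pw i j = pw j i by exact: pre_weightC.
have pw0 i j : 0 <= pw i j by apply: pre_weight_ge0 => //; exact: graph_scale_gt0.
have pwbe i : \sum_j pw i j <= be by exact: (pre_degree_le M eta_ge0 eta_noninc eta_supp eta_half d0 n0 delta0 k10 counts).
have pwM i j : pw i j != 0 -> near_cells (cell_ratio d M).+1 (cell i) (cell j).
  exact: pre_weight_near.
have Kmin0 : 0 < k1 * (n%:R * delta ^+ d) by rewrite mulr_gt0.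
have H1 := dirichlet_tent_le pwC pw0 degree_bound_ge0 pwbe pwM (proj2 counts) h0 ci y.
have H2 := tent_norm_ge (proj1 counts) h0 ci cs y.
apply: (le_trans H1).
rewrite -/B in H2 *; set S := \sum_(i < n) (y *m B) 0 i ^+ 2 in H2 *.
set Y := \sum_(k < l) y 0 k ^+ 2 in H2 *.
have Y0 : 0 <= Y by apply: sumr_ge0 => k _; exact: sqr_ge0.
set v := n%:R * delta ^+ d in v0 H2 *.
have H3 : Y * (k1 * v * (h%:R / 2) ^+ d.+2) <= S.
  apply: le_trans H2; rewrite ler_wpM2l// ler_wpM2l ?(ltW Kmin0)//.
set m2 := (_.+1%:R : R) ^+ 2.
have m20 : 0 <= m2 by rewrite exprn_ge0.
have K0 : 0 <= tent_const / h%:R ^+ 2.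
  by rewrite divr_ge0 ?tent_const_ge0// exprn_ge0.
apply: le_trans (ler_wpM2l K0 H3).
rewrite le_eqVlt; apply/orP; left; apply/eqP.
rewrite /tent_const -/m2 natrM -[d.+2]addn2 exprD !exprMn.
have -> : (4 : R) ^+ d = 2 ^+ d * 2 ^+ d by rewrite -exprMn -natrM.
have E (m2' b v' t hd hh Y' : R) : k1 != 0 -> t != 0 -> hh != 0 ->
    4 * m2' * b * (k2 * v') * (t * hd) * Y' =
    4 * m2' * b * (k2 / k1) * (t * t * 4) / hh ^+ 2 *
    (Y' * (k1 * v' * (hd * t^-1 * (hh ^+ 2 * 2^-1 ^+ 2)))).
  by move=> k1n tn hn; field; rewrite k1n tn hn.
by rewrite exprVn; apply: E; rewrite ?expf_neq0 ?gt_eqF.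
Qed.

End sample.
End two_sided.

Section root.
Variables (R : realType) (d : nat).
Hypothesis d0 : (0 < d)%N.

Definition nat_root (l : nat) : R := l%:R `^ (d%:R^-1).

Lemma nat_root_expd l : nat_root l ^+ d = l%:R.
Proof.
rewrite /nat_root -powR_mulrn ?powR_ge0// -powRrM mulVf ?powRr1//.
by rewrite pnatr_eq0 -lt0n.
Qed.

Lemma nat_root_sqr l : l%:R `^ (2 / d%:R) = nat_root l ^+ 2.
Proof. by rewrite /nat_root -powR_mulrn ?powR_ge0// -powRrM mulrC. Qed.

Lemma nat_root_ge1 l : (0 < l)%N -> 1 <= nat_root l.
Proof.
move=> l0; have {1}-> : 1 = 1 `^ (d%:R^-1) :> R by rewrite powR1.
by rewrite ge0_ler_powR ?nnegrE ?invr_ge0// ler1n.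
Qed.

End root.

(** * The upper bound on the eigenvalues *)

Section eigenvalue_upper.
Variables (R : realType) (d M : nat) (eta : R -> R).
Local Notation Zd := 'rV[int]_d.
Variables (A : set 'rV[R]_d) (k1 k2 r0 : R) (x0 : 'rV[R]_d).
Hypothesis eta_ge0 : forall t : R, 0 <= t -> 0 <= eta t.
Hypothesis eta_noninc : forall u v : R, 0 <= u -> u <= v -> eta v <= eta u.
Hypothesis eta_supp : forall t, 1 < t -> eta t = 0.
Hypothesis eta_half : 0 < eta (2^-1).
Hypothesis d0 : (0 < d)%N.
Hypothesis k10 : 0 < k1.
Hypothesis k20 : 0 < k2.
Hypothesis r00 : 0 < r0.
Hypothesis Ar0 : forall u, sup_near (2 * r0) x0 u -> A u.
Variables (n : nat) (delta : R) (x : 'I_n -> 'rV[R]_d) (s : seq Zd).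
Hypothesis n0 : (0 < n)%N.
Hypothesis delta0 : 0 < delta.
Hypothesis delta_r0 : delta <= r0.
Hypothesis gs : good_cells A delta s.
Hypothesis counts : regular_counts delta x s k1 k2.
Variables (lam Cu : R) (l : nat).
Local Notation eps := (graph_scale d M delta).
Local Notation pw := (pre_weight eta eps x).
Hypothesis Cu0 : 0 < Cu.
Hypothesis l0 : (0 < l)%N.
Hypothesis ln : (l <= n)%N.
Hypothesis lam_le : forall (B : 'M[R]_(l, n)) t, row_free B -> 0 <= t ->
  (forall y : 'rV[R]_l, dirichlet pw (fun i => (y *m B) 0 i) <=
    t * \sum_i (y *m B) 0 i ^+ 2) -> lam <= Cu * eps ^- 2 * t.

Let tau := nat_root R d l.
Let be := degree_bound d M eta k2.
Let K := tent_const d M eta k1 k2.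

Lemma eigenvalue_le_trivial : lam <= Cu * eps ^- 2 * (4 * be).
Proof.
have be_ge0 : 0 <= be.
  by apply: degree_bound_ge0.
apply: (lam_le (row_free_pid_mx R ln)); first by rewrite mulr_ge0.
move=> y; apply: dirichlet_le_degree => [i j|i j|i].
- exact: pre_weightC.
- by apply: pre_weight_ge0 => //; exact: graph_scale_gt0.
- exact: (pre_degree_le M eta_ge0 eta_noninc eta_supp eta_half d0 n0 delta0 k10 counts).
Qed.

Lemma eigenvalue_le_tents (h N : nat) : (0 < h)%N -> (l <= N ^ d)%N ->
  (2 * h * N + 1)%:R * delta <= r0 -> lam <= Cu * eps ^- 2 * (K / h%:R ^+ 2).
Proof.
move=> h0 lN hN.
have N0 : (0 < N)%N.
  by case: N lN {hN} => //; rewrite exp0n// leqn0 => /eqP l00; move: l0; rewrite l00.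
pose L : seq Zd := intbox (coarse (2 * h) (cell_of delta x0)) N.
have sL : (l <= size L)%N by rewrite size_intbox.
pose c (k : 'I_l) := nth 0 L k.
have cL k : c k \in L by rewrite mem_nth// (leq_trans (ltn_ord k)).
have ci : injective c.
  move=> k k' /eqP; rewrite nth_uniq ?intbox_uniq ?(leq_trans (ltn_ord _))//.
  by move=> /eqP/val_inj.
have cs k z : z \in coarse_box (2 * h) (c k) -> z \in s.
  by apply: (tents_in_ball Ar0 delta0 delta_r0 gs h0 N0 hN); exact: cL.
have Kmin0 : 0 < k1 * (n%:R * delta ^+ d).
  by rewrite !mulr_gt0 ?exprn_gt0// ltr0n.
have be_ge0 : 0 <= be by exact: degree_bound_ge0.
apply: (lam_le (B := tent_mx R (fun i => cell_of delta (x i)) h c)).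
- exact: (row_free_tent_mx be_ge0 Kmin0 (proj1 counts)).
- by apply: divr_ge0; rewrite ?exprn_ge0//; exact: tent_const_ge0.
- move=> y; exact: (dirichlet_tent_ratio M eta_ge0 eta_noninc eta_supp eta_half d0 k10 k20 r00 n0 delta0 delta_r0 counts y h0 ci cs).
Qed.

(** One summand per regime of [eigenvalue_upper]: the trivial bound when [eps ^- 2] is the minimum,
    tents of size [q / 2] or more (the 32), and [tau] so large that [1 / delta <= 16 tau / r0] (the
    16). Division by [cell_ratio ^ 2] converts [delta] into [eps]. *)
Definition upper_const : R :=
  Cu * (4 * be) + (Cu * K * (32 / r0) ^+ 2 + Cu * (4 * be) * (16 / r0) ^+ 2)
    / (cell_ratio d M)%:R ^+ 2.

Lemma upper_const_ge0 : 0 <= upper_const.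
Proof.
have be_ge0 : 0 <= be by exact: degree_bound_ge0.
have K0 : 0 <= K by exact: tent_const_ge0.
have C0 := ltW Cu0.
have T0 : 0 <= Cu * (4 * be) by apply: mulr_ge0 => //; apply: mulr_ge0.
apply: addr_ge0 => //; apply: divr_ge0; last by rewrite exprn_ge0.
by apply: addr_ge0; apply: mulr_ge0; rewrite ?exprn_even_ge0//; apply: mulr_ge0.
Qed.

Lemma eigenvalue_upper : lam <= upper_const * Num.min (tau ^+ 2) (eps ^- 2).
Proof.
have be_ge0 : 0 <= be by exact: degree_bound_ge0.
have K0 : 0 <= K by exact: tent_const_ge0.
have C0 := ltW Cu0.
have T0 : 0 <= Cu * (4 * be) by apply: mulr_ge0 => //; apply: mulr_ge0.
have rho0 : 0 < (cell_ratio d M)%:R :> R by exact: cell_ratio_gt0.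
have tau1 : 1 <= tau by exact: nat_root_ge1.
have tau0 : 0 < tau by exact: lt_le_trans tau1.
have eps0 : 0 < eps by exact: graph_scale_gt0.
have epsE : eps = (cell_ratio d M)%:R * delta by [].
have up1 : Cu * (4 * be) <= upper_const.
  rewrite /upper_const lerDl; apply: divr_ge0; last by rewrite exprn_ge0.
  by apply: addr_ge0; apply: mulr_ge0; rewrite ?exprn_even_ge0//; apply: mulr_ge0.
have triv := eigenvalue_le_trivial.
rewrite minEle; case: ifP => _; last first.
  apply: le_trans triv _; rewrite mulrAC; apply: ler_wpM2r => //.
  by rewrite invr_ge0 exprn_ge0// ltW.
have up2 : (Cu * K * (32 / r0) ^+ 2 + Cu * (4 * be) * (16 / r0) ^+ 2)
    / (cell_ratio d M)%:R ^+ 2 <= upper_const by rewrite /upper_const lerDr.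
have tau2 : 0 <= tau ^+ 2 by rewrite exprn_ge0 ?(ltW tau0).
apply: le_trans (ler_wpM2r tau2 up2).
have A0 : 0 <= Cu * K * (32 / r0) ^+ 2.
  by apply: mulr_ge0; [exact: mulr_ge0|rewrite exprn_even_ge0].
have A1 : 0 <= Cu * (4 * be) * (16 / r0) ^+ 2.
  by apply: mulr_ge0 => //; rewrite exprn_even_ge0.
(* With [h <= q] and [N <= 2 tau], the block of boxes has side [2 h N delta <= r0 / 4], and the
   extra [delta] is at most [r0 / 16], so it fits in the ball. *)
pose q := r0 / (16 * tau * delta).
have den0 : 0 < 16 * tau * delta by rewrite !mulr_gt0.
have [q1|q1] := leP 1 q.
  pose h := Num.truncn q; pose N := (Num.truncn tau).+1.
  have h0 : (0 < h)%N by rewrite truncn_gt0.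
  have hq : h%:R <= q by have /andP[] := truncn_itv (le_trans ler01 q1).
  have hq2 := truncn_ratio q1; rewrite -/h in hq2.
  have Ntau : N%:R <= 2 * tau.
    have /andP[h1 _] := truncn_itv (le_trans ler01 tau1).
    by rewrite /N -natr1; lra.
  have lN : (l <= N ^ d)%N.
    rewrite -(ler_nat R) natrX -(nat_root_expd R d0 l) lerXn2r ?nnegrE ?ltW//.
    by have /andP[_] := truncn_itv (le_trans ler01 tau1).
  have hN : (2 * h * N + 1)%:R * delta <= r0.
    rewrite natrD !natrM mulrDl mul1r.
    have h1 : 1 <= h%:R :> R by rewrite ler1n.
    have hd : h%:R * (16 * tau * delta) <= r0 by rewrite -ler_pdivlMr.
    have e1 : 2 * h%:R * N%:R * delta <= 2 * h%:R * (2 * tau) * delta.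
      by rewrite ler_pM2r// ler_wpM2l// mulr_ge0.
    have e2 : 1 * delta <= h%:R * tau * delta.
      by rewrite ler_pM2r// -[leLHS]mulr1 ler_pM.
    rewrite mul1r in e2.
    have e3 : 2 * h%:R * (2 * tau) * delta = 4 * (h%:R * tau * delta) by ring.
    have e4 : h%:R * (16 * tau * delta) = 16 * (h%:R * tau * delta) by ring.
    rewrite e3 in e1; rewrite e4 in hd.
    have := ltW delta0; move: (2 * h%:R * N%:R * delta) (h%:R * tau * delta) e1 hd e2.
    by move=> u v; lra.
  apply: le_trans (eigenvalue_le_tents h0 lN hN) _.
  have h2 : h%:R ^- 2 <= (q / 2) ^- 2.
    have q20 : 0 < q / 2 by rewrite divr_gt0// (lt_le_trans ltr01).
    rewrite lef_pV2 ?posrE ?exprn_gt0 ?ltr0n// lerXn2r ?nnegrE//; exact: ltW.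
  apply: (@le_trans _ _ (Cu * eps ^- 2 * (K * (q / 2) ^- 2))).
    apply: ler_wpM2l; first by rewrite mulr_ge0// invr_ge0 exprn_ge0// ltW.
    by rewrite ler_wpM2l.
  have -> : Cu * eps ^- 2 * (K * (q / 2) ^- 2) =
      Cu * K * (32 / r0) ^+ 2 / (cell_ratio d M)%:R ^+ 2 * tau ^+ 2.
    have E (a b c e f g : R) : e != 0 -> f != 0 -> g != 0 -> c != 0 ->
      a * (f * e) ^- 2 * (b * (g / (16 * c * e) / 2) ^- 2) = a * b * (32 / g) ^+ 2 / f ^+ 2 * c ^+ 2.
      by move=> en fn gn cn; field; rewrite en fn gn cn.
    by rewrite /q epsE; apply: E; rewrite gt_eqF.
  rewrite ler_wpM2r ?exprn_ge0 ?(ltW tau0)// ler_wpM2r ?invr_ge0 ?exprn_ge0//.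
  by rewrite lerDl.
(* Here [q < 1]: no tent fits, but [delta] is at least of order [1 / tau], so [eps ^- 2] is itself
   at most a constant times [tau ^ 2]. *)
apply: (le_trans triv).
have hd : delta^-1 <= 16 * tau / r0.
  move: q1; rewrite /q ltr_pdivrMr// mul1r => q1.
  by rewrite -(ler_pM2l delta0) divff ?gt_eqF// mulrA ler_pdivlMr// mul1r mulrC ltW.
have hd2 : delta ^- 2 <= (16 * tau / r0) ^+ 2.
  by rewrite -exprVn lerXn2r ?nnegrE ?invr_ge0 ?divr_ge0 ?mulr_ge0 ?(ltW delta0) ?(ltW tau0) ?(ltW r00).
apply: (@le_trans _ _ (Cu * (4 * be) * (16 / r0) ^+ 2 / (cell_ratio d M)%:R ^+ 2 * tau ^+ 2)); last first.
  rewrite ler_wpM2r ?exprn_ge0 ?(ltW tau0)// ler_wpM2r ?invr_ge0 ?exprn_ge0//.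
  by rewrite lerDr.
have -> : Cu * (4 * be) * (16 / r0) ^+ 2 / (cell_ratio d M)%:R ^+ 2 * tau ^+ 2 =
    Cu * (4 * be) * ((cell_ratio d M)%:R ^- 2 * (16 * tau / r0) ^+ 2).
  by move: (Cu * (4 * be)) => w; rewrite !exprMn; ring.
rewrite mulrAC ler_wpM2l// epsE exprMn invfM ler_wpM2l// invr_ge0 exprn_ge0//.
Qed.

End eigenvalue_upper.

(** * The lower bound on the eigenvalues, for large and for small index *)

Section eigenvalue_lower.
Variables (R : realType) (d M kap : nat) (eta : R -> R) (t0 : R).
Local Notation Zd := 'rV[int]_d.
Variables (A : set 'rV[R]_d) (dirs : seq Zd) (k1 k2 : R).
Hypothesis eta_ge0 : forall t : R, 0 <= t -> 0 <= eta t.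
Hypothesis eta_noninc : forall u v : R, 0 <= u -> u <= v -> eta v <= eta u.
Hypothesis eta_half : 0 < eta (2^-1).
Hypothesis d0 : (0 < d)%N.
Hypothesis k10 : 0 < k1.
Hypothesis k20 : 0 < k2.
Hypothesis kap0 : (0 < kap)%N.
Hypothesis t00 : 0 < t0.
Hypothesis cones : forall y, A y -> exists2 a, a \in dirs & cone_at A a kap t0 y.
Hypothesis dirsM : forall a, a \in dirs -> near_cells M a 0 /\ near_cells M (a *+ kap) 0.
Hypothesis M0 : (0 < M)%N.
Variables (n : nat) (delta : R) (x : 'I_n -> 'rV[R]_d) (s : seq Zd).
Hypothesis n0 : (0 < n)%N.
Hypothesis delta0 : 0 < delta.
Hypothesis delta_t0 : 8 * kap%:R * delta <= t0.
Hypothesis xA : forall i, A (x i).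
Hypothesis gs : good_cells A delta s.
Hypothesis counts : regular_counts delta x s k1 k2.
Variables (lam Cl : R) (l : nat).
Local Notation eps := (graph_scale d M delta).
Local Notation pw := (pre_weight eta eps x).
Local Notation cell := (fun i => cell_of delta (x i)).
Hypothesis Cl0 : 0 < Cl.
Hypothesis l2 : (1 < l)%N.
Hypothesis lam_ge : forall k (K : 'M[R]_(n, k)) t, (k < l)%N -> 0 <= t ->
  (forall u : 'rV[R]_n, u *m K = 0 ->
     t * \sum_i u 0 i ^+ 2 <= dirichlet pw (fun i => u 0 i)) ->
  Cl * eps ^- 2 * t <= lam.

Let tau := nat_root R d l.
Let rho := (cell_ratio d M)%:R : R.
Let kapR : 0 < kap%:R :> R. Proof. by rewrite ltr0n. Qed.

Lemma eigenvalue_ge_of_sum_sqr k (K : 'M[R]_(n, k)) (c : R) (m : nat) : (k < l)%N ->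
  0 < c -> (0 < m)%N ->
  (forall u : 'rV[R]_n, u *m K = 0 ->
    \sum_i u 0 i ^+ 2 <= c * m%:R ^+ 2 * dirichlet pw (fun i => u 0 i)) ->
  Cl * c^-1 * (eps * m%:R) ^- 2 <= lam.
Proof.
move=> kl c0 m0 h.
have c1 : 0 < c * m%:R ^+ 2 by rewrite mulr_gt0// exprn_gt0// ltr0n.
have -> : Cl * c^-1 * (eps * m%:R) ^- 2 = Cl * eps ^- 2 * (c * m%:R ^+ 2)^-1.
  by rewrite exprMn !invfM; ring.
apply: (lam_ge kl); first by rewrite invr_ge0 ltW.
by move=> u /h; rewrite ler_pdivrMl.
Qed.

Definition coarse_const (g : R) : R :=
  Cl / lower_const M eta dirs k1 k2 (3 ^+ d) / (rho ^+ 2 * kap%:R ^+ 2 * (2 * g ^+ 2 + 2)).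

(** Coarse boxes of physical side about [g / tau]. The second condition leaves at most [l / 2] of
    them; the last one keeps the displacement along the cone below [t0]. *)
Lemma eigenvalue_lower_coarse (g : R) : 1 <= g -> 2 <= k1 * g ->
  kap%:R * (g / tau) <= t0 / 2 ->
  coarse_const g * Num.min (tau ^+ 2) (eps ^- 2) <= lam.
Proof.
move=> g1 gk gt.
have rho0 : 0 < rho by exact: cell_ratio_gt0.
have tau1 : 1 <= tau by apply: nat_root_ge1 => //; exact: ltnW.
have tau0 : 0 < tau by exact: lt_le_trans tau1.
have g0 : 0 < g by exact: lt_le_trans g1.
have K0 : 0 < lower_const M eta dirs k1 k2 (3 ^+ d) by apply: lower_const_gt0; rewrite ?exprn_ge0.
pose q := g / tau / delta.
have q0 : 0 <= q by rewrite !divr_ge0// ltW.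
(* Thus [b * delta] lies between [g / tau] and [g / tau + delta]: the lower bound limits the number
   of boxes, the square of the upper one yields [2 * g ^+ 2 + 2] in [coarse_const]. *)
pose b := (Num.truncn q).+1.
have /andP[q1 q2] := truncn_itv q0.
have bq : b%:R * delta <= g / tau + delta.
  rewrite -natr1 mulrDl mul1r lerD2r.
  by move: q1; rewrite [q]/(_ / _) ler_pdivlMr.
have qb : g / tau <= delta * b%:R.
  have : q * delta < b%:R * delta by rewrite ltr_pM2r.
  by rewrite /q divfK ?gt_eqF// [ltRHS]mulrC => /ltW.
have mt : (kap * b)%:R * delta <= t0.
  rewrite natrM -mulrA; apply: (@le_trans _ _ (kap%:R * (g / tau + delta))).
    by rewrite ler_wpM2l.
  rewrite mulrDr; move: gt delta_t0; rewrite -[8 * _ * _]mulrA.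
  have : 0 <= kap%:R * delta by rewrite mulr_ge0// ltW.
  move: (kap%:R * (g / tau)) (kap%:R * delta) => u v; lra.
have [k [K [hk hK]]] := lower_coarse eta_ge0 eta_noninc eta_half d0 n0 delta0 k10 k20
  kap0 cones dirsM M0 xA gs counts (ltn0Sn (Num.truncn q)) mt.
have l0 : 0 < l%:R :> R by rewrite ltr0n ltnW.
have kl : (k < l)%N.
  rewrite -(ltr_nat R).
  have gd : g <= g ^+ d by rewrite -[leLHS]expr1 ler_weXn2l.
  have h1 : k%:R * (k1 * (g / tau) ^+ d) <= 1.
    apply: le_trans hk; rewrite ler_wpM2l// ler_pM2l// lerXn2r ?nnegrE//.
      by rewrite divr_ge0// ltW.
    by rewrite mulr_ge0// ltW.
  rewrite expr_div_n nat_root_expd// in h1.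
  have h2 : k%:R * (k1 * g ^+ d) <= l%:R by move: h1; rewrite !mulrA ler_pdivrMr// mul1r.
  have h3 : k%:R * 2 <= l%:R :> R.
    apply: le_trans h2; rewrite ler_wpM2l// (le_trans gk)// ler_pM2l//.
  apply: (@le_lt_trans _ _ (l%:R / 2)); first by rewrite ler_pdivlMr.
  by rewrite ltr_pdivrMr// ltr_pMr// ltrDl.
have m0 : (0 < kap * b)%N by rewrite muln_gt0 kap0.
apply: le_trans (eigenvalue_ge_of_sum_sqr kl K0 m0 hK).
set Y := Num.min _ _; have Y1 : Y <= tau ^+ 2 by rewrite /Y ge_min lexx.
have Y2 : Y <= eps ^- 2 by rewrite /Y ge_min lexx orbT.
have eps0 : 0 < eps by exact: graph_scale_gt0.
have Y0 : 0 <= Y by rewrite /Y le_min !exprn_ge0 ?invr_ge0 ?exprn_ge0 ?(ltW tau0) ?(ltW eps0).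
rewrite /coarse_const -mulrA ler_wpM2l ?divr_ge0 ?(ltW Cl0) ?(ltW K0)//.
have em0 : 0 < eps * (kap * b)%:R by rewrite mulr_gt0// ltr0n.
have Q0 : 0 < rho ^+ 2 * kap%:R ^+ 2 * (2 * g ^+ 2 + 2).
  by rewrite !mulr_gt0 ?exprn_gt0// ltr_wpDl// mulr_ge0// exprn_ge0// ltW.
rewrite ler_pdivrMl// -ler_pdivrMr ?invr_gt0 ?exprn_gt0// invrK.
have -> : (eps * (kap * b)%:R) ^+ 2 = rho ^+ 2 * kap%:R ^+ 2 * (b%:R * delta) ^+ 2.
  by rewrite natrM /graph_scale -/rho; ring.
rewrite mulrCA ler_pM2l ?mulr_gt0 ?exprn_gt0//.
have b2 : (b%:R * delta) ^+ 2 <= 2 * (g / tau) ^+ 2 + 2 * delta ^+ 2.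
  apply: (@le_trans _ _ ((g / tau + delta) ^+ 2)).
    rewrite lerXn2r ?nnegrE//; first by rewrite mulr_ge0// ltW.
    by rewrite addr_ge0// ?divr_ge0// ltW.
  by have := sqr_ge0 (g / tau - delta); nra.
apply: (le_trans (ler_wpM2l Y0 b2)); rewrite mulrDr; apply: lerD.
  rewrite mulrCA ler_pM2l// expr_div_n mulrA ler_pdivrMr ?exprn_gt0// mulrC.
  by rewrite ler_wpM2l// exprn_ge0// ltW.
rewrite mulrCA -[leRHS]mulr1 ler_pM2l//.
apply: (le_trans (ler_wpM2r _ Y2)); first by rewrite exprn_ge0// ltW.
rewrite /graph_scale -/rho exprMn invfM -mulrA mulVf ?mulr1 ?expf_neq0 ?gt_eqF//.
rewrite invf_le1 ?exprn_gt0// exprn_ege1//.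
by rewrite /rho ler1n -(ltr0n R).
Qed.

Variables (x0 : 'rV[R]_d) (r0 Cp : R).
Hypothesis Cp0 : 0 <= Cp.
Hypothesis poincare : forall (t : seq Zd) (U : Zd -> R),
  \sum_(z <- cells_near delta s x0 r0) U z = 0 ->
  uniq t -> (forall w, w \in t -> w \in s) ->
  (forall w (u : 'rV[R]_d), w \in t ->
     sup_near (t0 / (4 * kap%:R)) (corner delta w) u -> A u) ->
  \sum_(w <- t) U w ^+ 2 <= Cp * (delta ^- 2 * energy 1 s U).

Definition gap_const : R :=
  Cl / lower_const M eta dirs k1 k2 (4 * Cp / t0 ^+ 2) / (rho * t0) ^+ 2.

(** A single constraint, mean zero on the base ball, is allowed because [l >= 2]. Every point
    travels the full length [t0] of its cone, up to rounding, and so reaches the depth at which the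
    Poincare inequality of the domain holds. *)
Lemma eigenvalue_gap : gap_const <= lam.
Proof.
have rho0 : 0 < rho by exact: cell_ratio_gt0.
have t02 : 0 <= t0 ^+ 2 by rewrite exprn_ge0// ltW.
have B0 : 0 <= 4 * Cp / t0 ^+ 2 by rewrite divr_ge0// mulr_ge0.
have K0 : 0 < lower_const M eta dirs k1 k2 (4 * Cp / t0 ^+ 2) by exact: lower_const_gt0.
have kd : kap%:R * delta <= t0 / 8 by rewrite ler_pdivlMr// mulrC mulrA.
have dk : delta <= kap%:R * delta by rewrite ler_peMl ?(ltW delta0)// ler1n.
pose q := t0 / delta.
have q8 : 8 * kap%:R <= q by rewrite ler_pdivlMr.
have k1R : 1 <= kap%:R :> R by rewrite ler1n.
have q0 : 0 <= q by apply: le_trans q8; rewrite mulr_ge0.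
pose m := Num.truncn q.
have /andP[q1 q2] := truncn_itv q0.
have mt : m%:R * delta <= t0 by move: q1; rewrite ler_pdivlMr.
have qm : q / 2 <= m%:R by apply: truncn_ratio; lra.
have km : (kap <= m)%N by rewrite -(ler_nat R); apply: le_trans qm; lra.
have m0 : (0 < m)%N by exact: leq_trans km.
pose K := avg_constraint_mx R cell (fun _ : 'I_1 => cells_near delta s x0 r0).
pose dir := direction kap delta t0 dirs s.
pose t := undup [seq cell i + dir (cell i) *+ m | i : 'I_n].
have tP w : w \in t -> exists i, w = cell i + dir (cell i) *+ m.
  by rewrite mem_undup => /mapP[i _ ->]; exists i.
have ut : uniq t by exact: undup_uniq.
have esc i (e : Zd) : (forall j, (kap * (absz (e 0%R j)).+1 <= m)%N) ->
    cell i + dir (cell i) *+ m + e \in s.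
  have [_ h] := directionP delta0 cones xA gs i; exact: h m e m0 mt.
have ts w : w \in t -> w \in s.
  move=> /tP[i ->]; rewrite -[_ + _]addr0; apply: esc => j.
  by rewrite mxE absz0 muln1.
(* The cell of [u] is an offset of [w] whose width condition reads [t0 / 4 + 2 * kap * delta <= t0 /
   2 <= m * delta]; this is where [8 * kap * delta <= t0] is spent. *)
have deep w (u : 'rV[R]_d) : w \in t ->
    sup_near (t0 / (4 * kap%:R)) (corner delta w) u -> A u.
  move=> wt wu; have [i wE] := tP _ wt.
  have : cell_of delta u \in s; last first.
    by move=> /(proj2 gs); apply; exact: cell_of_cube.
  have -> : cell_of delta u = w + (cell_of delta u - w) by rewrite addrC subrK.
  rewrite wE; apply: esc => j; rewrite -wE.
  have := wu j; have := cell_ofP u j delta0; rewrite !cornerE.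
  have -> : (cell_of delta u - w) 0 j = cell_of delta u 0 j - w 0 j.
    by move: (cell_of delta u) => y; rewrite !mxE.
  move: (cell_of delta u 0 j) (w 0 j) (u 0 j) => y z v h1 h2.
  rewrite -(ler_nat R) natrM -natr1.
  have yz : (absz (y - z))%:R * delta <= t0 / (4 * kap%:R) + delta.
    have -> : (absz (y - z))%:R = `|y%:~R - z%:~R| :> R.
      by rewrite -intrB -intr_norm -[LHS]/((absz (y - z))%:Z%:~R) abszE.
    rewrite -[X in _ * X](gtr0_norm delta0) -normrM mulrBl.
    move: h2; rewrite ler_norml => h2; rewrite ler_norml.
    rewrite ![_%:~R * delta]mulrC; move: (delta * y%:~R) (delta * z%:~R) h1 h2.
    by move=> a c; lra.
  have h3 : kap%:R * ((absz (y - z))%:R + 1) * delta <= t0 / 4 + 2 * (kap%:R * delta).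
    rewrite -mulrA mulrDl mul1r.
    have -> : t0 / 4 + 2 * (kap%:R * delta) = kap%:R * (t0 / (4 * kap%:R) + delta + delta).
      by field; rewrite gt_eqF.
    by rewrite ler_pM2l// lerD2r.
  rewrite -(ler_pM2r delta0).
  apply: (le_trans h3); apply: (@le_trans _ _ (t0 / 2)); first by lra.
  have -> : t0 / 2 = q / 2 * delta by rewrite /q; field; rewrite gt_eqF.
  by rewrite ler_pM2r.
have l1 : (1 < l)%N by exact: l2.
have hK (u : 'rV[R]_n) : u *m K = 0 -> \sum_i u 0 i ^+ 2 <=
    lower_const M eta dirs k1 k2 (4 * Cp / t0 ^+ 2) * m%:R ^+ 2 * dirichlet pw (fun i => u 0 i).
  move=> uK.
  apply: (sum_sqr_le_dirichlet eta_ge0 eta_noninc eta_half d0 n0 delta0 k10 k20 kap0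
    cones dirsM xA gs counts km mt ut _ B0) => [i|].
    by rewrite mem_undup; apply/mapP; exists i => //; rewrite mem_enum.
  have base : \sum_(z <- cells_near delta s x0 r0) cell_avg cell (fun i => u 0 i) z = 0.
    by rewrite -(avg_constraint_mxE cell (fun _ : 'I_1 => cells_near delta s x0 r0) u 0) -/K uK mxE.
  apply: (le_trans (poincare base ut ts deep)).
  set U := cell_avg _ _.
  have E0 : 0 <= energy M s U by exact: energy_ge0.
  rewrite mulrA; apply: ler_pM.
  - by rewrite mulr_ge0// invr_ge0 exprn_ge0// ltW.
  - exact: energy_ge0.
  - have -> : 4 * Cp / t0 ^+ 2 * m%:R ^+ 2 = Cp * (2 * m%:R / t0) ^+ 2.
      by field; rewrite gt_eqF.
    rewrite ler_wpM2l// -exprVn lerXn2r ?nnegrE ?invr_ge0 ?divr_ge0 ?mulr_ge0 ?(ltW delta0) ?(ltW t00)//.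
    rewrite ler_pdivlMr// mulrC -/q; lra.
  - exact: energy_le.
apply: le_trans (eigenvalue_ge_of_sum_sqr l1 K0 m0 hK).
rewrite ler_wpM2l ?divr_ge0 ?(ltW Cl0) ?(ltW K0)//.
have em0 : 0 < eps * m%:R by rewrite mulr_gt0 ?ltr0n// graph_scale_gt0.
have rt0 : 0 < rho * t0 by exact: mulr_gt0.
rewrite lef_pV2 ?posrE ?exprn_gt0//.
rewrite lerXn2r ?nnegrE ?(ltW em0) ?(ltW rt0)//.
by rewrite /graph_scale -/rho -mulrA ler_pM2l// mulrC.
Qed.

End eigenvalue_lower.

Lemma dirs_radius (d kap : nat) (dirs : seq 'rV[int]_d) : (0 < kap)%N ->
  exists2 M : nat, (0 < M)%N &
    forall a, a \in dirs -> near_cells M a 0 /\ near_cells M (a *+ kap) 0.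
Proof.
move=> kap0; pose M := (\sum_(a <- dirs) \sum_i absz (a 0%R i) * kap).+1%N.
exists M => // a ad.
have h i : (absz (a 0%R i) * kap <= M)%N.
  apply: leq_trans (leqnSn _); rewrite (big_rem a)//=; apply: leq_trans (leq_addr _ _).
  by rewrite (bigD1 i)//=; exact: leq_addr.
have h1 i : (absz (a 0%R i) <= M)%N by apply: leq_trans (h i); rewrite leq_pmulr.
split; apply/near_cellsP => i.
  by rewrite [_ 0 i in X in _ - X]mxE subr0; have := h1 i; move: (a 0 i) => b; lia.
rewrite mulmxnE [_ 0 i in X in _ - X]mxE subr0 -mulr_natr natz normrM.
by have := h i; move: (a 0 i) => b; lia.
Qed.

Theorem regular_sample_spectrum (R : realType) d (p q r : R) (A : set 'rV[R]_d)
    (eta : R -> R) (k1 k2 : R) (x0 : 'rV[R]_d) : (0 < d)%N ->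
  open A -> connected A -> bounded_set A -> lipschitz_boundary A -> A x0 ->
  (forall t : R, 0 <= t -> 0 <= eta t) ->
  (forall u v : R, 0 <= u -> u <= v -> eta v <= eta u) ->
  (forall t, 1 < t -> eta t = 0) -> 0 < eta (2^-1) -> 0 < k1 -> 0 < k2 ->
  exists (M : nat) (C C' delta1 : R), [/\ 0 < C, 0 < C', 0 < delta1 &
  forall n (x : 'I_n -> 'rV[R]_d) delta s l, 0 < delta <= delta1 ->
    (forall i, A (x i)) -> good_cells A delta s -> regular_counts delta x s k1 k2 ->
    (2 <= l <= n)%N ->
    C' * Num.min (l%:R `^ (2 / d%:R)) (graph_scale d M delta ^- 2) <=
      eigenvalue_nth (graph_laplacian eta p q r (graph_scale d M delta) x) l <=
    C * Num.min (l%:R `^ (2 / d%:R)) (graph_scale d M delta ^- 2)].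
Proof.
move=> d0 oA cA bA lA Ax0 eta0 eta_ni eta_s eta_h k10 k20.
have [dirs [kap [t0 [kap0 t00 cones]]]] := lipschitz_cones oA bA lA.
have {}cones y : A y -> exists2 a, a \in dirs & cone_at A a kap t0 y by exact: cones.
have [M M0 dirsM] := dirs_radius dirs kap0.
have [e e0 Ae] := open_sup_near oA Ax0.
pose r0 := e / 2.
have r00 : 0 < r0 by rewrite divr_gt0.
have Ar0 u : sup_near (2 * r0) x0 u -> A u.
  by move=> h; apply: Ae; apply: sup_near_le h; rewrite /r0; lra.
have kapR : 0 < kap%:R :> R by rewrite ltr0n.
have rho0 : 0 < t0 / (4 * kap%:R) by rewrite divr_gt0// mulr_gt0.
have [Cp [delta2 [Cp0 delta20 poin]]] := connected_poincare oA cA bA Ax0 r00 Ar0 rho0.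
pose rho : R := (cell_ratio d M)%:R.
have rhoR : 0 < rho by exact: cell_ratio_gt0.
pose al := rho ^- d * eta 2^-1 * k1.
have al0 : 0 < al by rewrite !mulr_gt0// invr_gt0 exprn_gt0.
have [Cl [Cu [Cl0 Cu0 spec]]] := laplacian_spectrum p q r (degree_bound d M eta k2) al0.
pose g : R := Num.max 1 (2 / k1).
have g1 : 1 <= g by rewrite le_max lexx.
have g0 : 0 < g by exact: lt_le_trans g1.
have gk : 2 <= k1 * g by rewrite -ler_pdivrMl// mulrC le_max lexx orbT.
(* When the coarse argument has no room in the cones, [tau < tmax]; the minimum is then at most
   [tmax ^ 2], and the gap [c2] divided by [tmax ^ 2] is a valid constant. *)
pose tmax := 2 * kap%:R * g / t0.
have tmax0 : 0 < tmax by rewrite divr_gt0// !mulr_gt0.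
pose c1 := coarse_const M kap eta dirs k1 k2 Cl g.
pose c2 := gap_const M eta t0 dirs k1 k2 Cl Cp.
have lc0 B : 0 <= B -> 0 < lower_const M eta dirs k1 k2 B by move=> B0; exact: lower_const_gt0.
have c10 : 0 < c1.
  rewrite /c1 /coarse_const; apply: divr_gt0.
    by apply: divr_gt0 => //; apply: lc0; rewrite exprn_ge0.
  by rewrite !mulr_gt0 ?exprn_gt0// ltr_wpDl// mulr_ge0// exprn_ge0// ltW.
have c20 : 0 < c2.
  rewrite /c2 /gap_const; apply: divr_gt0; last by rewrite exprn_gt0// mulr_gt0.
apply: divr_gt0 => //; apply: lc0; apply: divr_ge0; first exact: mulr_ge0.
by rewrite exprn_ge0// ltW.
have U0 : 0 <= upper_const d M eta k1 k2 r0 Cu by exact: upper_const_ge0.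
(* [upper_const] is only known to be nonnegative; adding 1 makes the constant positive. *)
exists M, (upper_const d M eta k1 k2 r0 Cu + 1), (Num.min c1 (c2 / tmax ^+ 2)).
exists (Num.min r0 (Num.min delta2 (t0 / (8 * kap%:R)))).
split; [by rewrite ltr_wpDl|by rewrite lt_min c10 divr_gt0// exprn_gt0| |].
  by rewrite !lt_min r00 delta20 divr_gt0// mulr_gt0.
move=> n x delta s l /andP[delta0]; rewrite !le_min => /andP[dr0 /andP[dd2 dt0]].
move=> xA gs counts /andP[l2 ln]; set eps := graph_scale d M delta; set m := Num.min (l%:R `^ _) _.
have n0 : (0 < n)%N by apply: leq_trans ln; exact: leq_trans l2.
have dt : 8 * kap%:R * delta <= t0 by rewrite mulrC -ler_pdivlMr// mulr_gt0.
have eps0 : 0 < eps by exact: graph_scale_gt0.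
have pdb i : al <= pre_degree eta eps x i <= degree_bound d M eta k2.
  apply/andP; split; last exact: (pre_degree_le M eta0 eta_ni eta_s eta_h d0 n0 delta0 k10 counts).
  have kt : kap%:R * delta <= t0.
    by apply: le_trans dt; rewrite -mulrA ler_peMl// ?ler1n// mulr_ge0// ltW.
  have ts := direction_path delta0 kap0 cones xA gs i (leqnn kap) kt.
  apply: (pre_degree_ge eta0 eta_ni eta_h d0 n0 delta0 counts ts).
  have [ad _] := directionP delta0 cones xA gs i (kap := kap).
  have [_] := dirsM _ ad; rewrite -(near_cells_add M (cell_of delta (x i))) addr0.
  by move=> /near_cellsP h; apply/near_cellsP => k; rewrite distrC.
have [spec_ge spec_le] := spec d eta n eps x eps0 eta0 pdb n0.
set lam := eigenvalue_nth _ l.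
have ll : (l <= n)%N by [].
have l0 : (0 < l)%N by exact: leq_trans l2.
have lam_ge k (K : 'M[R]_(n, k)) t : (k < l)%N -> 0 <= t ->
    (forall u : 'rV[R]_n, u *m K = 0 ->
     t * \sum_i u 0 i ^+ 2 <= dirichlet (pre_weight eta eps x) (fun i => u 0 i)) ->
    Cl * eps ^- 2 * t <= lam.
  by move=> kl t_ge hK; apply: (spec_ge l k K t) => //; rewrite kl.
have lam_le (B : 'M[R]_(l, n)) t : row_free B -> 0 <= t ->
  (forall y : 'rV[R]_l, dirichlet (pre_weight eta eps x) (fun i => (y *m B) 0 i) <=
    t * \sum_i (y *m B) 0 i ^+ 2) -> lam <= Cu * eps ^- 2 * t.
  by move=> fB t_ge hB; apply: (spec_le l B t).
have mE : m = Num.min (nat_root R d l ^+ 2) (eps ^- 2) by rewrite -nat_root_sqr.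
rewrite mE.
have tau1 : 1 <= nat_root R d l by exact: nat_root_ge1.
have tau0 : 0 < nat_root R d l by exact: lt_le_trans tau1.
set Y := Num.min (_ ^+ 2) _.
have Y0 : 0 <= Y by rewrite /Y le_min !exprn_ge0 ?invr_ge0 ?exprn_ge0 ?(ltW tau0) ?(ltW eps0).
apply/andP; split; last first.
  have := eigenvalue_upper eta0 eta_ni eta_s eta_h d0 k10 k20 r00 Ar0 n0 delta0 dr0 gs counts
    Cu0 l0 ll lam_le.
  by move=> /le_trans; apply; rewrite ler_wpM2r// lerDl.
have [gt|gt] := leP (kap%:R * (g / nat_root R d l)) (t0 / 2).
  have := eigenvalue_lower_coarse eta0 eta_ni eta_h d0 k10 k20 kap0 cones dirsM M0 n0 delta0
    dt xA gs counts Cl0 l2 lam_ge g1 gk gt.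
  by apply: le_trans; rewrite ler_wpM2r// ge_min lexx.
have poin' (t : seq 'rV[int]_d) (U : 'rV[int]_d -> R) :
    \sum_(z <- cells_near delta s x0 r0) U z = 0 -> uniq t -> (forall w, w \in t -> w \in s) ->
    (forall w (u : 'rV[R]_d), w \in t ->
       sup_near (t0 / (4 * kap%:R)) (corner delta w) u -> A u) ->
    \sum_(w <- t) U w ^+ 2 <= Cp * (delta ^- 2 * energy 1 s U).
  by move=> *; apply: poin => //; rewrite delta0.
have := eigenvalue_gap eta0 eta_ni eta_h d0 k10 k20 kap0 t00 cones dirsM M0 n0 delta0
    dt xA gs counts Cl0 l2 lam_ge Cp0 poin'.
apply: le_trans; apply: (@le_trans _ _ (c2 / tmax ^+ 2 * Y)).
  by rewrite ler_wpM2r// ge_min lexx orbT.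
rewrite -[leRHS]mulr1 -mulrA ler_wpM2l ?(ltW c20)// ler_pdivrMl ?exprn_gt0// mulr1.
apply: (@le_trans _ _ (nat_root R d l ^+ 2)); first by rewrite /Y ge_min lexx.
rewrite lerXn2r ?nnegrE ?(ltW tau0) ?(ltW tmax0)// /tmax ler_pdivlMr//.
move: gt; rewrite mulrA ltr_pdivlMr// => gt; move: gt.
have -> : t0 / 2 * nat_root R d l = (nat_root R d l * t0) / 2 by ring.
by move=> /ltW; rewrite ler_pdivrMr//; move=> /le_trans; apply; rewrite le_eqVlt; apply/orP; left; apply/eqP; ring.
Qed.

(** * Concentration of the cell counts *)

Section cell_measurability.
Variables (R : realType) (d : nat).
Local Notation Zd := 'rV[int]_d.

Lemma measurable_cell (delta : R) (z : Zd) :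
  0 < delta -> measurable [set x : 'rV[R]_d | cell_of delta x = z].
Proof.
move=> d0; rewrite (_ : [set _ | _] = \bigcap_(i in [set: 'I_d])
  (rV_coord i @^-1` `[corner delta z 0 i, corner delta z 0 i + delta[)); last first.
  apply/seteqP; split => x /= h.
    by move=> i _; rewrite -[z]h /rV_coord /= in_itv /=; exact: cell_ofP.
  apply/rowP => i; have := h i I; rewrite /rV_coord /= in_itv /= cornerE mxE => /andP[h1 h2].
  apply: Num.Theory.floor_def; rewrite intrD ler_pdivlMr// ltr_pdivrMr// mulrC h1 /=.
  by rewrite mulrDl mul1r mulrC.
apply: fin_bigcap_measurable => [|i _]; first exact: finite_finset.
rewrite -[X in measurable X]setTI; exact: measurable_rV_coord.
Qed.

(** The sigma-algebra is generated by coordinates: an open set is the union, over the sides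
    [1 / (k + 1)], of the countably many half-open cells whose closed cube it contains. *)
Lemma open_measurable_rV (A : set 'rV[R]_d) : open A -> measurable A.
Proof.
move=> oA; pose del (k : nat) : R := k.+1%:R^-1.
have del0 k : 0 < del k by rewrite invr_gt0 ltr0n.
rewrite (_ : A = \bigcup_k \bigcup_(z in [set z : Zd | cube (del k) z `<=` A])
   [set x | cell_of (del k) x = z]); last first.
  apply/seteqP; split=> [x Ax|x [k _ [z /= zA xz]]]; last first.
    by apply: zA; rewrite -xz; exact: cell_of_cube.
  have [e e0 xe] := (nbhs_sup_near x A).1 (open_nbhs_nbhs (conj oA Ax)).
  exists (Num.truncn e^-1) => //; exists (cell_of (del (Num.truncn e^-1)) x) => //= y hy.
  apply: xe => i; have := hy i; have := cell_ofP x i (del0 (Num.truncn e^-1)).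
  have : del (Num.truncn e^-1) <= e.
    rewrite /del -[leRHS]invrK lef_pV2 ?posrE ?ltr0n ?invr_gt0//.
    have e1 : 0 <= e^-1 by rewrite invr_ge0 ltW.
    by have /andP[_ /ltW] := truncn_itv e1.
  rewrite ler_norml; lra.
apply: bigcupT_measurable => k.
have -> : \bigcup_(z in [set z : Zd | cube (del k) z `<=` A]) [set x | cell_of (del k) x = z] =
   \bigcup_z (if `[< cube (del k) z `<=` A >] then [set x | cell_of (del k) x = z] else set0).
  apply/seteqP; split => [x [z /= h xz]|x [z _]]; first by exists z; rewrite ?asboolT.
  by case: asboolP => // h xz; exists z.
apply: countable_bigcupT_measurable => [|z]; first exact: countableP.
by case: ifP => // _; exact: measurable_cell.
Qed.

End cell_measurability.

Section density.
Variables (R : realType) (d : nat) (A : set 'rV[R]_d) (G : probability 'rV[R]_d R).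
Variables (g : 'rV[R]_d -> R) (gmin gmax : R).
Hypothesis oA : open A.
Hypothesis hG : has_density_on G A g.
Hypothesis gmin0 : 0 < gmin.
Hypothesis gb : forall x, A x -> gmin <= g x <= gmax.

Lemma density_bounds (B : set 'rV[R]_d) : measurable B ->
  (gmin%:E * lebesgue_rV R d (B `&` A) <= G B <= gmax%:E * lebesgue_rV R d (B `&` A))%E.
Proof.
move=> mB; have mBA : measurable (B `&` A).
  by apply: measurableI => //; exact: open_measurable_rV.
have mg : measurable_fun (B `&` A) g.
  apply: measurable_funS (proj1 hG); first exact: open_measurable_rV.
  by move=> x [].
rewrite (proj2 hG)// -!integral_cst//; apply/andP; split.
  apply: ge0_le_integral => // [x _||x [_ /gb/andP[h _]]]; last by rewrite lee_fin.
    by rewrite lee_fin ltW.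
  exact/measurable_EFinP.
apply: ge0_le_integral => // [x [_ /gb/andP[h _]]||x [_ /gb/andP[_ h]]]; last by rewrite lee_fin.
  by rewrite lee_fin (le_trans _ h)// ltW.
exact/measurable_EFinP.
Qed.

Lemma density_support : A !=set0 /\ G (~` A) = 0%E.
Proof.
split; last first.
  rewrite (proj2 hG); last by apply: measurableC; exact: open_measurable_rV.
  by rewrite setICl integral_set0.
apply/set0P/eqP => A0.
have := @probability_setT _ _ _ G; rewrite (proj2 hG)// A0 setI0 integral_set0 => /eqP.
by rewrite eqe eq_sym oner_eq0.
Qed.

Lemma density_cell_le (delta : R) z : 0 < delta ->
  (G [set x | cell_of delta x = z] <= (gmax * delta ^+ d)%:E)%E.
Proof.
move=> d0; have mc := measurable_cell z d0.
have [[x0 /gb/andP[g1 g2]] _] := density_support.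
have /andP[_ h] := density_bounds mc; apply: (le_trans h).
rewrite EFinM lee_pmul2l ?lte_fin ?(lt_le_trans gmin0)// ?(le_trans g1)//.
pose b := corner delta z + const_mx delta : 'rV[R]_d.
have bE i : b 0 i = corner delta z 0 i + delta by rewrite mxE [const_mx _ _ _]mxE.
have -> : delta ^+ d = \prod_(i < d) (b 0 i - corner delta z 0 i).
  under eq_bigr do rewrite bE addrC addKr.
  by rewrite prodr_const card_ord.
rewrite -lebesgue_rV_box; last by move=> i; rewrite bE lerDl ltW.
apply: le_measure; rewrite ?inE.
- by apply: measurableI => //; exact: open_measurable_rV.
- exact: measurable_box.
- move=> x [/= xz _] i; rewrite bE -xz.
  by have /andP[-> /ltW ->] := cell_ofP x i d0.
Qed.

(** The volume is computed for closed boxes and the cell is half-open; a closed box of half the side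
    fits inside, at the price of [2 ^ d]. *)
Lemma density_cell_ge (delta : R) z : 0 < delta -> cube delta z `<=` A ->
  ((gmin * (delta / 2) ^+ d)%:E <= G [set x | cell_of delta x = z])%E.
Proof.
move=> d0 zA; have mc := measurable_cell z d0.
have /andP[+ _] := density_bounds mc; apply: le_trans.
rewrite EFinM lee_pmul2l//.
pose b := corner delta z + const_mx (delta / 2) : 'rV[R]_d.
have bE i : b 0 i = corner delta z 0 i + delta / 2 by rewrite mxE [const_mx _ _ _]mxE.
have d20 : 0 < delta / 2 by rewrite divr_gt0.
have -> : (delta / 2) ^+ d = \prod_(i < d) (b 0 i - corner delta z 0 i).
  under eq_bigr do rewrite bE addrC addKr.
  by rewrite prodr_const card_ord.
rewrite -lebesgue_rV_box; last by move=> i; rewrite bE lerDl ltW.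
apply: le_measure; rewrite ?inE.
- exact: measurable_box.
- by apply: measurableI => //; exact: open_measurable_rV.
- move=> x /= hx; have {}hx i : corner delta z 0 i <= x 0 i < corner delta z 0 i + delta.
    have := hx i; rewrite bE => /andP[-> /= h]; apply: le_lt_trans h _.
    by rewrite ltrD2l ltr_pdivrMr// ltr_pMr// ltrDl.
  split; last by apply: zA => i; have /andP[-> /ltW ->] := hx i.
  apply/rowP => i; have := hx i; rewrite cornerE mxE => /andP[h1 h2].
  apply: Num.Theory.floor_def; rewrite intrD ler_pdivlMr// ltr_pdivrMr// mulrC h1 /=.
  by rewrite mulrDl mul1r mulrC.
Qed.

End density.

Lemma measure_bigsetU_le (R : realType) disp (T : measurableType disp)
    (mu : {measure set T -> \bar R}) (I : Type) (s : seq I) (Q : pred I) (F : I -> set T) :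
  (forall i, measurable (F i)) ->
  (mu (\big[setU/set0]_(i <- s | Q i) F i) <= \sum_(i <- s | Q i) mu (F i))%E.
Proof.
move=> mF; elim: s => [|i s IH]; first by rewrite !big_nil measure0.
rewrite !big_cons; case: (Q i) => //; apply: le_trans (leeD (lexx _) IH).
by apply: measureU2 => //; apply: bigsetU_measurable => j _; exact: mF.
Qed.

Section binomial_tail.
Variables (R : realType) (d : nat) (G : probability 'rV[R]_d R).
Variables (disp : measure_display) (Omega : measurableType disp) (P : probability Omega R).
Variables (n : nat) (X : 'I_n -> {RV P >-> 'rV[R]_d}).
Hypothesis iid : iid_sample G X.
Variables (B : set 'rV[R]_d) (b : R).
Hypothesis mB : measurable B.
Hypothesis GB : G B = b%:E.

Let hits (omega : Omega) : {set 'I_n} := [set i | `[< B (X i omega) >]]%SET.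

Let weight_of (J : {set 'I_n}) : R := \prod_i (if i \in J then b else 1 - b).

Let b01 : 0 <= b <= 1.
Proof. by rewrite -!lee_fin -GB measure_ge0 probability_le1. Qed.

(** The event splits according to the exact set [J] of indices that hit [B]; independence, applied
    to [B] and its complement, gives each piece the probability [weight_of J]. *)
Let hits_le (Q : pred {set 'I_n}) : measurable [set omega | Q (hits omega)] /\
  (P [set omega | Q (hits omega)] <= (\sum_(J | Q J) weight_of J)%:E)%E.
Proof.
pose F (J : {set 'I_n}) := \bigcap_(i in [set: 'I_n]) (X i @^-1` (if i \in J then B else ~` B)).
have mFi J i : measurable (if i \in J then B else ~` B).
  by case: ifP => // _; exact: measurableC.
have mF J : measurable (F J).
  apply: fin_bigcap_measurable => [|i _]; first exact: finite_finset.
  by apply: measurable_funPTI.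
have FE J omega : F J omega <-> hits omega = J.
  split=> [h|<- i _]; last by rewrite /= inE; case: asboolP.
  apply/setP => i; rewrite inE; have := h i I; rewrite /=.
  by case: (i \in J) => h'; [exact/asboolT|exact/asboolF].
have PF J : P (F J) = (weight_of J)%:E.
  rewrite (proj2 iid)// -prodEFin; apply: eq_bigr => i _.
  have -> : P (X i @^-1` (if i \in J then B else ~` B)) = G (if i \in J then B else ~` B).
    by rewrite -(proj1 iid i).
  by case: ifP => _ //; rewrite probability_setC// GB EFinB.
have -> : [set omega | Q (hits omega)] = \big[setU/set0]_(J <- index_enum _ | Q J) F J.
  rewrite -bigcup_seq_cond; apply/seteqP; split=> [omega /= h|omega [J /= /andP[_ QJ] /FE h]]; last by rewrite h.
  by exists (hits omega); [rewrite /= mem_index_enum|exact/FE].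
split; first by apply: bigsetU_measurable.
by rewrite -sumEFin; under [leRHS]eq_bigr do rewrite -PF; exact: measure_bigsetU_le.
Qed.

(* Exponential Markov inequality, written as a finite sum over the sets of indices
   of the sample points that lie in [B]; [t = 1] and [t = -1] give both tails. *)
Lemma binomial_tail (t a : R) (E : set Omega) :
  E = [set omega | t * a <= t * #|[set i | `[< B (X i omega) >]]%SET|%:R] ->
  measurable E /\ (P E <= (expR (- (t * a) + n%:R * b * (expR t - 1)))%:E)%E.
Proof.
move=> ->; have [mE PE] := hits_le (fun J => t * a <= t * #|J|%:R).
split=> //; apply: (le_trans PE); rewrite lee_fin.
have w0 J : 0 <= weight_of J.
  by apply: prodr_ge0 => i _; case: ifP => _; move: b01; lra.
apply: (@le_trans _ _ (\sum_(J : {set 'I_n}) expR (t * #|J|%:R - t * a) * weight_of J)).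
  rewrite [leRHS](bigID (fun J : {set 'I_n} => t * a <= t * #|J|%:R))/= ler_wpDr//.
    by apply: sumr_ge0 => J _; rewrite mulr_ge0 ?expR_ge0.
  apply: ler_sum => J hJ; rewrite ler_peMl//; apply: le_trans (expR_ge1Dx _); lra.
(* Expanding the product of [n] equal sums over subsets gives the exponential moment in closed form;
   [1 + x <= exp x] then finishes. *)
have -> : \sum_(J : {set 'I_n}) expR (t * #|J|%:R - t * a) * weight_of J =
    expR (- (t * a)) * (b * expR t + (1 - b)) ^+ n.
  have -> : (b * expR t + (1 - b)) ^+ n = \prod_(i < n) (b * expR t + (1 - b)).
    by rewrite prodr_const card_ord.
  rewrite bigA_distr big_distrr; apply: eq_big => // J _ /=.
  rewrite addrC expRD -mulrA; congr (_ * _).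
  rewrite /weight_of (bigID (mem J))/= [in RHS](bigID (mem J))/= mulrA; congr (_ * _).
    rewrite (eq_bigr (fun=> b)) => [|i ->//]; rewrite [in RHS](eq_bigr (fun=> b * expR t)) => [|i ->//].
    by rewrite !prodr_const exprMn mulrC expRM_natr.
  rewrite (eq_bigr (fun=> 1 - b)) => [|i /negbTE ->//].
  by rewrite [in RHS](eq_bigr (fun=> 1 - b)) => [|i /negbTE ->//].
rewrite expRD ler_pM2l ?expR_gt0// -mulrA expRM_natl lerXn2r ?nnegrE ?expR_ge0//.
  by have /andP[h h'] := b01; apply: addr_ge0; rewrite ?subr_ge0// mulr_ge0 ?expR_ge0.
apply: le_trans (expR_ge1Dx _); rewrite mulrBr; lra.
Qed.

End binomial_tail.

Lemma expR1_le4 (R : realType) : expR (1 : R) <= 4.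
Proof.
have h : 2^-1 <= expR (- 2^-1 : R) by apply: le_trans (expR_ge1Dx _); lra.
have -> : (1 : R) = 2^-1 + 2^-1 by lra.
rewrite expRD; have e0 := expR_gt0 (2^-1 : R).
rewrite expRN in h; rewrite lef_pV2 ?posrE// in h.
apply: (@le_trans _ _ (2 * 2)); last lra.
by apply: ler_pM => //; exact: ltW.
Qed.

Lemma expRN1_le (R : realType) : expR (- 1 : R) <= 2^-1.
Proof.
rewrite expRN lef_pV2 ?posrE ?expR_gt0//; apply: le_trans (expR_ge1Dx _); lra.
Qed.

Section regular_sample.
Variables (R : realType) (d : nat) (A : set 'rV[R]_d) (G : probability 'rV[R]_d R).
Variables (g : 'rV[R]_d -> R) (gmin gmax rho : R).
Hypothesis oA : open A.
Hypothesis hG : has_density_on G A g.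
Hypothesis gmin0 : 0 < gmin.
Hypothesis gb : forall x, A x -> gmin <= g x <= gmax.
Hypothesis rho0 : 0 < rho.
Hypothesis A_rho : forall x, A x -> sup_near rho 0 x.

Let gmaxm : gmin <= gmax.
Proof.
by have [[x0 /gb/andP[g1 g2]] _] := density_support oA hG; exact: le_trans g1 g2.
Qed.

(** A quarter of the lower bound on the mass of a good cell per unit [delta ^ d]. With v = n delta ^
    d, the lower tail has exponent at most c v - 4 c v / 2 = - c v, and the upper one at most (- 4 +
    3) gmax v, which is no larger than - c v. *)
Let c := gmin * 2^-1 ^+ d / 4.

Let c0 : 0 < c. Proof. by rewrite !mulr_gt0// exprn_gt0. Qed.

Let cm : c <= gmax.
Proof.
apply: le_trans gmaxm; rewrite /c -mulrA ger_pMr// ler_pdivrMr// mul1r.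
have : (2^-1 : R) ^+ d <= 1 by rewrite exprn_ile1//; lra.
lra.
Qed.

Section cells.
Variables (disp : measure_display) (Omega : measurableType disp) (P : probability Omega R).
Variables (n : nat) (X : 'I_n -> {RV P >-> 'rV[R]_d}).
Hypothesis iid : iid_sample G X.
Variables (delta : R) (z : 'rV[int]_d).
Hypothesis delta0 : 0 < delta.

Let count (omega : Omega) : R := (size (points (fun i => cell_of delta (X i omega)) z))%:R.

Let countE omega :
  count omega = #|[set i | `[< [set x | cell_of delta x = z]%classic (X i omega) >]]%SET|%:R.
Proof.
rewrite /count /points -sum1_size big_filter sum1_card; congr (_%:R : R).
apply: eq_card => i; rewrite [RHS]inE.
transitivity (cell_of delta (X i omega) == z); first by [].
by apply/eqP/asboolP.
Qed.

Lemma cell_count_upper_tail :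
  measurable [set omega | 4 * gmax * (n%:R * delta ^+ d) <= count omega] /\
  (P [set omega | 4 * gmax * (n%:R * delta ^+ d) <= count omega]%R <=
     (expR (- (c * (n%:R * delta ^+ d))))%:E)%E.
Proof.
have mz := measurable_cell z delta0.
have Gz := density_cell_le oA hG gmin0 gb z delta0.
have Gfin : G [set x | cell_of delta x = z] \is a fin_num by rewrite fin_num_measure.
have Gb := fineK Gfin; rewrite -Gb lee_fin in Gz; set b := fine _ in Gb Gz.
have := @binomial_tail R d G disp Omega P n X iid _ b mz (esym Gb) 1
  (4 * gmax * (n%:R * delta ^+ d)) _ _.
move=> /(_ [set omega | 4 * gmax * (n%:R * delta ^+ d) <= count omega]) [|mE PE].
  by apply/seteqP; split=> omega /=; rewrite !mul1r countE.
split=> //; apply: le_trans PE _; rewrite lee_fin ler_expR.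
have D0 : 0 <= n%:R * delta ^+ d by rewrite mulr_ge0// exprn_ge0// ltW.
have h1 : n%:R * b <= gmax * (n%:R * delta ^+ d) by rewrite mulrCA ler_wpM2l.
have h2 : c * (n%:R * delta ^+ d) <= gmax * (n%:R * delta ^+ d) by rewrite ler_wpM2r.
have h3 : n%:R * b * (expR 1 - 1) <= gmax * (n%:R * delta ^+ d) * 3.
  apply: ler_pM.
  - by rewrite mulr_ge0// /b fine_ge0.
  - by rewrite subr_ge0 -expR0 ler_expR.
  - exact: h1.
  - by have := expR1_le4 R; lra.
lra.
Qed.

Lemma cell_count_lower_tail : cube delta z `<=` A ->
  measurable [set omega | count omega <= c * (n%:R * delta ^+ d)] /\
  (P [set omega | count omega <= c * (n%:R * delta ^+ d)]%R <=
     (expR (- (c * (n%:R * delta ^+ d))))%:E)%E.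
Proof.
move=> zA; have mz := measurable_cell z delta0.
have Gz := density_cell_ge oA hG gmin0 gb delta0 zA.
have Gfin : G [set x | cell_of delta x = z] \is a fin_num by rewrite fin_num_measure.
have Gb := fineK Gfin; rewrite -Gb lee_fin in Gz; set b := fine _ in Gb Gz.
have := @binomial_tail R d G disp Omega P n X iid _ b mz (esym Gb) (-1)
  (c * (n%:R * delta ^+ d)) _ _.
move=> /(_ [set omega | count omega <= c * (n%:R * delta ^+ d)]) [|mE PE].
  by apply/seteqP; split=> omega /=; rewrite !mulN1r lerN2 countE.
split=> //; apply: le_trans PE _; rewrite lee_fin ler_expR.
have h1 : 4 * (c * (n%:R * delta ^+ d)) <= n%:R * b.
  have -> : 4 * (c * (n%:R * delta ^+ d)) = n%:R * (gmin * (delta / 2) ^+ d).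
    by rewrite exprMn /c; field.
  by rewrite ler_wpM2l.
have h3 : n%:R * b * (expR (-1) - 1) <= n%:R * b * (- 2^-1).
  rewrite ler_wpM2l//; first by rewrite mulr_ge0// /b fine_ge0.
  by have := expRN1_le R; lra.
lra.
Qed.

End cells.
(** A finite list containing every cell that meets [A], over which the union bound runs. *)
Let box_cells (delta : R) : seq 'rV[int]_d :=
  let m := (Num.truncn (rho / delta)).+1 in intbox (\row_i (- m%:Z)) (2 * m).

Let box_cellsP delta x : 0 < delta -> A x -> cell_of delta x \in box_cells delta.
Proof.
move=> d0 /A_rho h; rewrite mem_intbox; apply/forallP => i; rewrite !mxE.
have := h i; rewrite mxE sub0r normrN ler_norml => /andP[h1 h2].
have r0 : 0 <= rho / delta by rewrite divr_ge0 ?ltW.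
have /andP[_] := truncn_itv r0; set m := (Num.truncn _).+1 => hm.
have /andP[h3 h4] := floor_itv (x 0 i / delta).
have h5 : - (rho / delta) <= x 0 i / delta by rewrite -mulNr ler_pM2r ?invr_gt0.
have h6 : x 0 i / delta <= rho / delta by rewrite ler_pM2r ?invr_gt0.
move: (Num.floor _) h3 h4 => a h3 h4.
have : a < m%:Z by rewrite -(ltr_int R) -[ltRHS]/(m%:R : R); lra.
have : - m%:Z < a + 1 by rewrite -(ltr_int R) mulrNz -[X in - X]/(m%:R : R); lra.
lia.
Qed.

Let size_box_cells delta : 0 < delta <= 1 ->
  (size (box_cells delta))%:R <= (2 * (rho + 1)) ^+ d * delta ^- d.
Proof.
move=> /andP[d0 d1]; rewrite size_intbox -exprVn -exprMn natrX lerXn2r ?nnegrE//.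
  by rewrite !mulr_ge0 ?invr_ge0 ?addr_ge0 ?(ltW d0) ?(ltW rho0).
have r0 : 0 <= rho / delta by rewrite divr_ge0 ?ltW.
have /andP[h _] := truncn_itv r0.
have h1 : 1 <= delta^-1 by rewrite -[leLHS]invr1 lef_pV2 ?posrE.
rewrite natrM -natr1 -mulrA ler_pM2l// mulrDl mul1r; lra.
Qed.

(** The excluded event is the null set where some point leaves [A], together with both tail events
    for the cells of [box_cells], whence the factor 2 in [K]. *)
Lemma regular_sample_prob : exists k1 k2 c' K : R, [/\ 0 < k1, 0 < k2, 0 < c', 0 < K &
  forall disp (Omega : measurableType disp) (P : probability Omega R) n
    (X : 'I_n -> {RV P >-> 'rV[R]_d}) (delta : R), iid_sample G X -> 0 < delta <= 1 ->
  exists (s : seq 'rV[int]_d) (E : set Omega), [/\ good_cells A delta s, measurable E,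
    ((1 - K * delta ^- d * expR (- (c' * (n%:R * delta ^+ d))))%:E <= P E)%E &
    forall omega, E omega -> (forall i, A (X i omega)) /\
      regular_counts delta (fun i => X i omega) s k1 k2]].
Proof.
have gmax0 : 0 < gmax by exact: lt_le_trans gmaxm.
exists c, (4 * gmax), c, (2 * (2 * (rho + 1)) ^+ d); split=> //.
- by rewrite mulr_gt0.
- by rewrite mulr_gt0// exprn_gt0// mulr_gt0// addr_gt0.
move=> disp Omega P n X delta iid d01; have /andP[delta0 _] := d01.
pose N z omega : R := (size (points (fun i => cell_of delta (X i omega)) z))%:R.
pose v : R := n%:R * delta ^+ d.
pose s := [seq z <- box_cells delta | `[< cube delta z `<=` A >]].
pose U z := [set omega | 4 * gmax * v <= N z omega].
pose V z := if `[< cube delta z `<=` A >] then [set omega | N z omega <= c * v] else set0.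
pose S := \big[setU/set0]_(i <- index_enum 'I_n) (X i @^-1` (~` A)).
pose T := \big[setU/set0]_(z <- box_cells delta) (U z `|` V z).
have mA : measurable (~` A) by apply: measurableC; exact: open_measurable_rV.
have mXi i : measurable (X i @^-1` (~` A)) by apply: measurable_funPTI.
have hU z := cell_count_upper_tail iid z delta0.
have hV z : measurable (V z) /\ (P (V z) <= (expR (- (c * v)))%:E)%E.
  rewrite /V; case: asboolP => zA; first exact: cell_count_lower_tail.
  by rewrite measure0 lee_fin expR_ge0.
have mUV z : measurable (U z `|` V z).
  by apply: measurableU; [exact: (hU z).1|exact: (hV z).1].
have mS : measurable S by apply: bigsetU_measurable.
have mT : measurable T by apply: bigsetU_measurable.
have PS : P S = 0%E.
  apply/eqP; rewrite eq_le measure_ge0 andbT; apply: (le_trans (measure_bigsetU_le _ _ _ mXi)).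
  rewrite big1// => i _; rewrite -(proj2 (density_support oA hG)) -(proj1 iid i)//.
have PT : (P T <= (2 * (2 * (rho + 1)) ^+ d * delta ^- d * expR (- (c * v)))%:E)%E.
  apply: (le_trans (measure_bigsetU_le _ _ _ mUV)).
  apply: (@le_trans _ _ (\sum_(z <- box_cells delta) (2 * expR (- (c * v)))%:E)%E).
    apply: lee_sum => z _; apply: le_trans (measureU2 _ _ _) _.
    - exact: (hU z).1.
    - exact: (hV z).1.
    - rewrite mulr_natl mulr2n EFinD; apply: leeD; [exact: (hU z).2|exact: (hV z).2].
  rewrite sumEFin lee_fin sumr_const_seq mulrA ler_pM2r ?expR_gt0// mulrC -mulrA ler_pM2l//.
  exact: size_box_cells.
exists s, (~` (S `|` T)); split.
- split; first exact/filter_uniq/intbox_uniq.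
  move=> z; rewrite mem_filter; split=> [/andP[/asboolP]//|zA]; rewrite asboolT//=.
  have Az : A (corner delta z) by apply: zA => i; rewrite lexx lerDl ltW.
  have -> : z = cell_of delta (corner delta z); last exact: box_cellsP.
  apply/esym/rowP => i; rewrite mxE cornerE [delta * _]mulrC mulfK ?gt_eqF//; exact: intrKfloor.
- by apply: measurableC; exact: measurableU.
- rewrite probability_setC; last exact: measurableU.
  rewrite EFinB leeB//; apply: (@le_trans _ _ (P S + P T)%E); first exact: measureU2.
  by rewrite PS add0e.
- move=> omega; rewrite /setC /= => /not_orP[nS nT].
  have XA i : A (X i omega).
    apply: contrapT => nA; apply: nS; rewrite /S -bigcup_seq; exists i => //=.
    exact: mem_index_enum.
  have nUV z : z \in box_cells delta -> ~ U z omega /\ ~ V z omega.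
    by move=> zb; apply/not_orP => h; apply: nT; rewrite /T -bigcup_seq; exists z.
  split=> //; split=> [z|z].
    rewrite mem_filter => /andP[zA /nUV[_]]; rewrite /V zA /= => /negP; rewrite -ltNge => /ltW.
    by [].
  have [/nUV[+ _]|zb] := boolP (z \in box_cells delta).
    by rewrite /U /= => /negP; rewrite -ltNge => /ltW.
  (* Outside [box_cells] a cell misses [A], hence holds no sample point. *)
  rewrite (_ : points _ _ = [::]).
    by rewrite /= !mulr_ge0 ?exprn_ge0 ?(ltW delta0) ?(ltW gmax0).
  apply/eqP; rewrite -(negbK (_ == _)) -has_filter; apply/hasPn => i _; apply/eqP => iz.
  by move: zb; rewrite -iz (box_cellsP delta0).
Qed.

End regular_sample.

(** * Measurability of the spectral event *)

Section spectrum_measurable.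
Variables (R : realType) (n : nat).

Lemma compact_measurable_rV m (K : set 'rV[R]_m) : compact K -> measurable K.
Proof.
move=> cK; rewrite -[K]setCK; apply: measurableC; apply: open_measurable_rV.
by apply: closed_openC; apply: compact_closed cK; exact: norm_hausdorff.
Qed.

(** The values at [0], ..., [n] of the monic polynomial with roots [a], as a continuous function of
    the roots. *)
Let root_values (a : 'rV[R]_n) : 'rV[R]_n.+1 := \row_j \prod_i (j%:R - a 0 i).

Let root_values_continuous : continuous root_values.
Proof.
move=> a V /nbhs_sup_near[e e0 aV].
have ct (j : 'I_n.+1) (s : seq 'I_n) :
    continuous (fun y : 'rV[R]_n => \prod_(i <- s) ((j%:R : R) - y 0 i)).
  elim: s => [|i s IH].
    rewrite (_ : (fun y => _) = cst (1 : R)); first exact: cst_continuous.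
    by apply/funext => y; rewrite big_nil.
  rewrite (_ : (fun y => _) =
      (fun y : 'rV[R]_n => (j%:R : R) - y 0 i) \* (fun y => \prod_(i <- s) ((j%:R : R) - y 0 i))).
    move=> b; apply: continuousM; last exact: IH.
    by apply: continuousB; [exact: cst_continuous|exact: coord_continuous].
  by apply/funext => y; rewrite big_cons.
apply: (@filterS _ (nbhs a) _
  [set y | forall j, `|root_values a 0 j - root_values y 0 j| < e]).
  by move=> y hy; apply: aV => j; exact: ltW.
have Fa : Filter (nbhs (a : 'rV[R]_n)) by exact: nbhs_filter.
apply: (@filter_forall _ _ (fun j y => `|root_values a 0 j - root_values y 0 j| < e) _ Fa) => j.
 have /cvgr_dist_lt/(_ e e0) := ct j (index_enum _) a.
by apply: filterS => y; rewrite !mxE.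
Qed.

Variables (lo hi : nat -> R).

(** The bound [k] makes the set compact, since the smallest eigenvalue, of index 0, is not
    constrained by [lo] and [hi]. *)
Let roots_in (k : nat) : set 'rV[R]_n := [set a | [/\ sup_near k%:R 0 a,
  forall i j : 'I_n, (i <= j)%N -> a 0 i <= a 0 j &
  forall i : 'I_n, (0 < i)%N -> lo i <= a 0 i <= hi i]].

Let roots_in_compact k : compact (roots_in k).
Proof.
suff cl : closed (roots_in k).
  by apply: subclosed_compact cl (@compact_box R n k%:R) _ => a [].
have cc i : continuous (fun a : 'rV[R]_n => a 0 i) by move=> a; exact: coord_continuous.
have closed_pre (f : 'rV[R]_n -> R) : continuous f -> closed [set a | 0 <= f a].
  move=> cf; apply: (@preimage_closed _ _ f [set x | 0 <= x]); last exact: closed_ge.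
  by move=> a _; exact: cf.
have cB (f h : 'rV[R]_n -> R) : continuous f -> continuous h ->
    closed [set a | f a <= h a].
  move=> cf ch; rewrite (_ : [set a | _] = [set a | 0 <= h a - f a]).
    by apply: closed_pre => a; apply: continuousB; [exact: ch|exact: cf].
  by apply/seteqP; split => a /=; rewrite subr_ge0.
have -> : roots_in k = [set x | sup_near k%:R 0 x] `&`
   (\bigcap_(ij in [set ij : 'I_n * 'I_n | (ij.1 <= ij.2)%N])
      [set a | a 0 ij.1 <= a 0 ij.2]) `&`
   (\bigcap_(i in [set i : 'I_n | (0 < i)%N]) ([set a | lo i <= a 0 i] `&` [set a | a 0 i <= hi i])).
  apply/seteqP; split=> [a [h1 h2 h3]|a [[h1 h2] h3]].
    split; first by split=> // -[i j] /= ij; exact: h2.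
    by move=> i /= /h3/andP[].
  split=> // [i j ij|i i0]; first exact: (h2 (i, j)).
  by have [/= -> ->] := h3 i i0.
apply: closedI; first apply: closedI.
- by apply: compact_closed; [exact: norm_hausdorff|exact: compact_box].
- by apply: closed_bigI => -[i j] _ /=; exact: cB.
- apply: closed_bigI => i _; apply: closedI; apply: cB => // a; exact: cst_continuous.
Qed.

Lemma horner_char_poly (M : 'M[R]_n) (t : R) : (char_poly M).[t] = \det (t%:M - M).
Proof.
rewrite /char_poly -[_.[t]]/(horner_eval t _) -det_map_mx; congr (\det _).
apply/matrixP => i j; rewrite !mxE -[LHS]/((_ - _).[t]) hornerD hornerN hornerC.
by case: (i == j); rewrite ?mulr1n ?mulr0n ?hornerX ?horner0.
Qed.

Lemma eq_monic_values (p q : {poly R}) : p \is monic -> q \is monic ->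
  size p = n.+1 -> size q = n.+1 -> (forall j : 'I_n.+1, p.[j%:R] = q.[j%:R]) -> p = q.
Proof.
move=> mp mq sp sq pq; apply/eqP; rewrite -subr_eq0; apply/eqP.
apply: (@roots_geq_poly_eq0 _ _ [seq (nat_of_ord j)%:R | j : 'I_n.+1]).
- apply/allP => _ /mapP[j _ ->]; by rewrite /root hornerD hornerN pq subrr.
- by rewrite map_inj_uniq ?enum_uniq// => i j /eqP; rewrite eqr_nat => /eqP/val_inj.
- rewrite size_map size_enum_ord (leq_trans (size_polyD _ _))// geq_max size_polyN.
  by rewrite sp sq leqnn.
Qed.

(* The values of the characteristic polynomial at [0], ..., [n] determine the
   spectrum, and the values allowed by the bounds form a countable union of
   continuous images of compact sets; so no measurability of the single
   eigenvalues is needed. *)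
Lemma measurable_spectrum_bounds disp (Omega : measurableType disp) (M : Omega -> 'M[R]_n) :
  (forall i j, measurable_fun setT (fun omega => M omega i j)) ->
  (forall omega, exists2 S : 'M[R]_n, S^T = S & char_poly (M omega) = char_poly S) ->
  measurable [set omega | forall l : nat, (2 <= l <= n)%N ->
    lo l.-1 <= eigenvalue_nth (M omega) l <= hi l.-1].
Proof.
move=> mM symM.
pose Phi omega : 'rV[R]_n.+1 := \row_j \det (j%:R%:M - M omega).
have mPhi : measurable_fun setT Phi.
  apply: measurable_fun_rV => j; under eq_fun do rewrite mxE /determinant.
  apply: measurable_sum => s; apply: measurable_funM => //; apply: measurable_prod => i _.
  under eq_fun do rewrite !mxE.
  by apply: measurable_funB.
rewrite (_ : [set omega | _] = \bigcup_k (Phi @^-1` (root_values @` roots_in k))); last first.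
  apply/seteqP; split=> omega /=.
    have [S symS MS] := symM omega => h.
    have szE := size_eigenvalues symS MS.
    have sE := eigenvalues_sorted symS MS.
    have pE := char_poly_eigenvalues symS MS.
    pose a : 'rV[R]_n := \row_i (eigenvalues (M omega))`_i.
    exists (Num.truncn (\sum_i `|a 0 i|)).+1 => //; exists a; last first.
      apply/rowP => j; rewrite !mxE -horner_char_poly pE horner_prod (big_nth 0) szE big_mkord.
      by apply: eq_bigr => i _; rewrite hornerXsubC mxE.
    split.
    - move=> i; rewrite mxE sub0r normrN.
      have : `|a 0 i| <= \sum_i `|a 0 i|.
        by rewrite (bigD1 i)//= lerDl sumr_ge0.
      move=> /le_trans; apply; have s0 : 0 <= \sum_i `|a 0 i| by exact: sumr_ge0.
      by have /andP[_ /ltW] := truncn_itv s0.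
    - by move=> i j ij; rewrite !mxE; apply: le_sorted_leq_nth; rewrite ?inE ?szE.
    - by move=> i i0; have := h i.+1; rewrite mxE; apply; rewrite ltnS i0 ltn_ord.
  move=> [k _ [a [h1 h2 h3] ha]] l /andP[l2 ln].
  pose s := [seq a 0 i | i : 'I_n].
  have szs : size s = n by rewrite size_map size_enum_ord.
  have sE i (ilt : (i < n)%N) : s`_i = a 0 (Ordinal ilt).
    rewrite (nth_map (Ordinal ilt)) ?size_enum_ord//; congr (a 0 _); apply: val_inj.
    exact: nth_enum_ord.
  have ln' : (l.-1 < n)%N by rewrite prednK// (leq_trans _ l2).
  rewrite /eigenvalue_nth (@eigenvaluesP _ _ _ s).
  - by rewrite sE; apply: (h3 (Ordinal ln')); rewrite -ltnS prednK// (leq_trans _ l2).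
  - apply/(sortedP 0) => i; rewrite szs => ilt.
    by rewrite (sE _ (ltnW ilt)) (sE _ ilt); exact: h2.
  - apply: eq_monic_values; first exact: char_poly_monic.
    + exact: monic_prod_XsubC.
    + exact: size_char_poly.
    + by rewrite size_prod_XsubC szs.
    + move=> j; have /rowP/(_ j) := ha; rewrite !mxE -horner_char_poly => <-.
      rewrite horner_prod big_image /=; apply: eq_bigr => i _.
      by rewrite hornerXsubC.
apply: bigcupT_measurable => k; rewrite -[X in measurable X]setTI.
apply: mPhi => //; apply: compact_measurable_rV.
apply: continuous_compact => //; apply: continuous_subspaceT; exact: root_values_continuous.
Qed.

End spectrum_measurable.

(** * The Laplacian of a random sample *)

Section random_laplacian.
Variables (R : realType) (d : nat) (p q r : R) (eta : R -> R) (n : nat) (eps : R).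
Hypothesis eta_ge0 : forall t, 0 <= t -> 0 <= eta t.
Hypothesis eta_ni : forall s t, 0 <= s -> s <= t -> eta t <= eta s.
Hypothesis eta_half : 0 < eta (2^-1).
Hypothesis eps0 : 0 < eps.

(** Measurability concerns all of [Omega], so this must hold for arbitrary points, without degree
    bounds: the self-weight is positive because [eta 0 >= eta (1/2) > 0], and every degree is
    therefore positive. *)
Lemma graph_laplacian_symmetric_similar (x : 'I_n -> 'rV[R]_d) :
  exists2 S : 'M[R]_n, S^T = S & char_poly (graph_laplacian eta p q r eps x) = char_poly S.
Proof.
pose h i := pre_degree eta eps x i `^ (1 - q / 2).
pose W i j := pre_weight eta eps x i j / (h i * h j).
pose a i := if q == 1 then 1 else (\sum_j W i j) `^ ((1 - p) / (q - 1)).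
pose b i := if q == 1 then 1 else (\sum_j W i j) `^ (- (r / (q - 1))).
have -> : graph_laplacian eta p q r eps x = scaled_laplacian W (eps ^- 2) a b.
  exact: graph_laplacianE.
have pw0 i j : 0 <= pre_weight eta eps x i j by exact: pre_weight_ge0.
have pwd i : 0 < pre_weight eta eps x i i.
  rewrite /pre_weight mulr_gt0//.
    by rewrite invr_gt0 mulr_gt0 ?exprn_gt0// ltr0n (leq_ltn_trans _ (ltn_ord i)).
  apply: lt_le_trans eta_half _; apply: eta_ni; first by rewrite divr_ge0 ?sqrtr_ge0 ?ltW.
  by rewrite subrr /enorm big1 ?sqrtr0 ?mul0r// => j _; rewrite mxE expr0n.
have pd i : 0 < pre_degree eta eps x i.
  by rewrite /pre_degree (bigD1 i)//= ltr_wpDr// sumr_ge0.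
have h0 i : 0 < h i by rewrite powR_gt0.
have WC i j : W i j = W j i by rewrite /W pre_weightC [h i * _]mulrC.
have W0 i : 0 < \sum_j W i j.
  rewrite (bigD1 i)//= ltr_wpDr ?sumr_ge0// => [j _|].
    by rewrite /W divr_ge0// mulr_ge0 ?(ltW (h0 _)).
  by rewrite /W divr_gt0// mulr_gt0.
have a0 i : 0 < a i by rewrite /a; case: ifP => // _; rewrite powR_gt0.
have b0 i : 0 < b i by rewrite /b; case: ifP => // _; rewrite powR_gt0.
exists (scaled_laplacian W (eps ^- 2) (fun i => Num.sqrt (a i * b i)) (fun i => Num.sqrt (a i * b i))).
  exact: scaled_laplacian_sym.
exact: char_poly_scaled_laplacian.
Qed.

Variables (disp : measure_display) (Omega : measurableType disp).
Variable X : 'I_n -> Omega -> 'rV[R]_d.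
Hypothesis mX : forall i, measurable_fun setT (X i).

Let measurable_fun_inv (f : Omega -> R) : (forall omega, 0 <= f omega) ->
  measurable_fun setT f -> measurable_fun setT (fun omega => (f omega)^-1).
Proof.
move=> f0 mf; under eq_fun do rewrite -powR_inv1//.
exact: (measurableT_comp (measurable_powR _)).
Qed.

Let mpre i j : measurable_fun setT (fun omega => pre_weight eta eps (X^~ omega) i j).
Proof.
have mN : measurable_fun setT (fun omega => enorm (X i omega - X j omega)).
  under eq_fun => omega.
    rewrite /enorm -powR12_sqrt; last by apply: sumr_ge0 => k _; exact: sqr_ge0.
    over.
  apply: (measurableT_comp (measurable_powR _)); apply: measurable_sum => k.
  apply: measurable_funX; under eq_fun do rewrite !mxE.
  by apply: measurable_funB; apply: (measurableT_comp (measurable_rV_coord k)).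
(* [eta] is monotone on the half-line only; this extension is monotone on the whole line, hence
   measurable, and agrees with it at the nonnegative arguments that occur. *)
pose f t := eta (Num.max 0 t).
have mf : measurable_fun setT f.
  apply: nonincreasing_measurable => // s t st; apply: eta_ni; first by rewrite le_max lexx.
  by rewrite ge_max !le_max lexx st !orbT.
have fE omega : eta (enorm (X i omega - X j omega) / eps) = f (enorm (X i omega - X j omega) / eps).
  by rewrite /f; congr eta; apply/esym/max_idPr; rewrite divr_ge0 ?sqrtr_ge0 ?ltW.
rewrite /pre_weight; apply: measurable_funM => //; under eq_fun do rewrite fE.
by apply: (measurableT_comp mf); apply: measurable_funM.
Qed.

Lemma measurable_graph_laplacian i j :
  measurable_fun setT (fun omega => graph_laplacian eta p q r eps (X^~ omega) i j).
Proof.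
under eq_fun do rewrite graph_laplacianE scaled_laplacianE.
have mh k : measurable_fun setT (fun omega => pre_degree eta eps (X^~ omega) k `^ (1 - q / 2)).
  by apply: (measurableT_comp (measurable_powR _)); apply: measurable_sum => l; exact: mpre.
have mW k l : measurable_fun setT (fun omega => pre_weight eta eps (X^~ omega) k l /
    (pre_degree eta eps (X^~ omega) k `^ (1 - q / 2) * pre_degree eta eps (X^~ omega) l `^ (1 - q / 2))).
  apply: measurable_funM; first exact: mpre.
  apply: measurable_fun_inv; last exact: measurable_funM.
  by move=> omega; rewrite mulr_ge0// powR_ge0.
have mD k s : measurable_fun setT (fun omega => (\sum_l pre_weight eta eps (X^~ omega) k l /
    (pre_degree eta eps (X^~ omega) k `^ (1 - q / 2) *
     pre_degree eta eps (X^~ omega) l `^ (1 - q / 2))) `^ s).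
  by apply: (measurableT_comp (measurable_powR _)); apply: measurable_sum.
apply: measurable_funM => //; apply: measurable_funM; last by case: (q == 1).
apply: measurable_funM; first by case: (q == 1).
apply: measurable_funB => //; case: (i == j); last first.
  by under eq_fun do rewrite mulr0n; exact: measurable_cst.
by under eq_fun do rewrite mulr1n; apply: measurable_sum.
Qed.

End random_laplacian.

(** As e is at most 4, [n >= 4] gives [ln n >= 1], so [eps ^ d >= 1 / n]: this turns the number of
    cells in the union bound into the factor [n] of the theorem. *)
Lemma log_ratio_scale (R : realType) (d n : nat) (eps : R) : (0 < d)%N -> (4 <= n)%N ->
  (ln n%:R / n%:R) `^ (d%:R^-1) <= eps -> 0 < eps /\ eps ^- d <= n%:R.
Proof.
move=> d0 n4 he; have n0 : 0 < n%:R :> R by rewrite ltr0n (leq_trans _ n4).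
have ln1 : 1 <= ln n%:R :> R.
  rewrite -ler_expR lnK ?posrE// (le_trans (expR1_le4 R))// (_ : 4 = 4%:R :> R)//.
  by rewrite ler_nat.
have y0 : 0 < ln n%:R / n%:R :> R by rewrite divr_gt0// (lt_le_trans ltr01).
have eps0 : 0 < eps by apply: lt_le_trans he; rewrite powR_gt0.
split=> //; rewrite -[leRHS]invrK lef_pV2 ?posrE ?invr_gt0 ?exprn_gt0//.
apply: (@le_trans _ _ (ln n%:R / n%:R)); first by rewrite -[leLHS]mul1r ler_pM2r ?invr_gt0.
have -> : ln n%:R / n%:R = ((ln n%:R / n%:R) `^ (d%:R^-1)) ^+ d :> R.
  rewrite -powR_mulrn ?powR_ge0// -powRrM mulVf ?pnatr_eq0 -?lt0n// powRr1//.
  exact: ltW.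
by rewrite lerXn2r ?nnegrE ?powR_ge0 ?(ltW eps0).
Qed.

Theorem lemmaA1 (R : realType) (d : nat) (hd : (1 <= d)%N) (p q r : R)
    (A : set 'rV[R]_d) (G : probability 'rV[R]_d R) (g : 'rV[R]_d -> R)
    (eta : R -> R)
    (hG : has_density_on G A g)
    (hA1 : assumption_domain A)
    (hA2 : assumption_density A g)
    (hA3 : assumption_kernel d eta)
    (hA4 : assumption_covering A eta) :
  exists C C' C1 C2 C3 c : R,
    [/\ 0 < C, 0 < C' & 0 < C1] /\ [/\ 0 < C2, 0 < C3 & 0 < c] /\
    exists2 N : nat, (0 < N)%N &
    forall (disp : measure_display) (Omega : measurableType disp)
      (P : probability Omega R) (n : nat)
      (X : 'I_n -> {RV P >-> 'rV[R]_d}) (eps : R),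
      iid_sample G X ->
      (N <= n)%N ->
      C1 * (ln n%:R / n%:R) `^ (d%:R^-1) <= eps <= C2 ->
      prob_gt P
        [set omega | forall l : nat, (2 <= l <= n)%N ->
           let lambda := eigenvalue_nth
             (graph_laplacian eta p q r eps (fun i => X i omega)) l in
           let m := Num.min (l%:R `^ (2 / d%:R)) (eps ^- 2) in
           C' * m <= lambda <= C * m]
        (1 - C3 * n%:R * expR (- (c * n%:R * eps ^+ d))).
Proof.
have [oA cA bA lA] := hA1; have [[gmin [gmax [gmin0 gb]]] _] := hA2.
have [eta_ge0 eta_ni eta_s _ [eta_half _]] := hA3.
have [[x0 Ax0] _] := density_support oA hG.
have [rho rho0 A_rho] := bounded_sup_near bA.
have [k1 [k2 [c [K [k10 k20 c0 K0 sample]]]]] := regular_sample_prob oA hG gmin0 gb rho0 A_rho.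
have [M [C [C' [delta1 [C0 C'0 delta10 spec]]]]] :=
  regular_sample_spectrum p q r hd oA cA bA lA Ax0 eta_ge0 eta_ni eta_s eta_half k10 k20.
pose k : R := (cell_ratio d M)%:R; have k0 : 0 < k by rewrite /k cell_ratio_gt0.
(* With [delta = eps / k], the bound on [eps] ensures that [delta] is at most [delta1] and 1, and
   [delta ^- d = k ^ d * eps ^- d <= k ^ d * n]. The summand 1 in the fifth constant makes the
   probability bound strict. *)
exists C, C', 1, (k * Num.min delta1 1), (K * k ^+ d + 1), (c * k ^- d).
have min0 : 0 < Num.min delta1 1 by rewrite lt_min delta10 ltr01.
have Kk0 : 0 < K * k ^+ d by rewrite mulr_gt0 ?exprn_gt0.
split; first by split.
split; first by split; rewrite ?mulr_gt0 ?addr_gt0 ?invr_gt0 ?exprn_gt0.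
exists 4 => // disp Omega P n X eps iid n4; rewrite mul1r => /andP[eps_ge eps_le].
have [eps0 eps_n] := log_ratio_scale hd n4 eps_ge.
have n0 : 0 < n%:R :> R by rewrite ltr0n (leq_trans _ n4).
pose delta := eps / k; have delta0 : 0 < delta by rewrite divr_gt0.
have epsE : graph_scale d M delta = eps by rewrite /graph_scale -/k mulrC divfK ?gt_eqF.
have /andP[delta_le1 delta_le] : (delta <= delta1) && (delta <= 1).
  by rewrite -le_min ler_pdivrMr// mulrC.
have [s [E [gs mE PE hE]]] := sample disp Omega P n X delta iid (introT andP (conj delta0 delta_le)).
rewrite /prob_gt; set F := [set omega | _].
have mF : measurable F.
  have := @measurable_spectrum_bounds R n
    (fun i => C' * Num.min (i.+1%:R `^ (2 / d%:R)) (eps ^- 2))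
    (fun i => C * Num.min (i.+1%:R `^ (2 / d%:R)) (eps ^- 2)) disp Omega
    (fun omega => graph_laplacian eta p q r eps (fun i => X i omega)).
  move=> /(_ _ _)/wrap[|omega|].
  - by apply: measurable_graph_laplacian => // i; exact: measurable_funPT.
  - exact: graph_laplacian_symmetric_similar.
  - congr measurable; apply/seteqP; split=> omega /= h l /andP[l2 ln];
      by have := h l; rewrite l2 ln prednK ?(leq_trans _ l2)//; apply.
(* The regular samples are contained in the spectral event; measurability of the latter was shown
   separately, so monotonicity of [P] concludes. *)
have EF : E `<=` F.
  move=> omega /hE[XA counts] l ln.
  have := spec n (fun i => X i omega) delta s l.
  by rewrite epsE; apply=> //; rewrite delta0.
split=> //; apply: (@lt_le_trans _ _ (P E)); last by apply: le_measure; rewrite ?inE.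
apply: lt_le_trans PE; rewrite lte_fin ltrD2l ltrN2.
have dE : delta ^+ d = k ^- d * eps ^+ d by rewrite /delta exprMn exprVn mulrC.
have -> : c * k ^- d * n%:R * eps ^+ d = c * (n%:R * delta ^+ d) by rewrite dE; ring.
rewrite ltr_pM2r ?expR_gt0//.
apply: (@le_lt_trans _ _ (K * k ^+ d * n%:R)).
  by rewrite dE invfM invrK mulrA ler_pM2l.
by rewrite ltr_pM2r// ltrDl.
Qed.
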